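(* Let $\mathcal{A}\subseteq\mathbb{C}^{n\times n}$ be spanned by $A_1,\dots,A_p$ with Gaussian integer entries of absolute value at most $M$, let $d$ be the minimum blow-up size of $\mathcal{A}$ and $k$ an upper bound on $\operatorname{ncrank}\mathcal{A}$, and let $c=n-\operatorname{ncrank}\mathcal{A}$. There is a randomized algorithm which, given $A_1,\dots,A_p,d,k$, outputs the minimum $c$-shrunk subspace of $\mathcal{A}$ with probability at least $1/2$, using $O(pd^4n^4)$ arithmetic operations over $\mathbb{Q}$, and such that its output and all intermediate vectors have Gaussian integer entries of magnitude at most $e^{O(n^2d^2\log(Mndk)+nd\log M)}$.
   Context: For a subspace $U\subseteq\mathbb{C}^n$, $\mathcal{A}(U)=\operatorname{span}\{Au:A\in\mathcal{A},u\in U\}$; $U$ is $c$-shrunk if $\dim U-\dim\mathcal{A}(U)\ge c$. $\operatorname{ncrank}\mathcal{A}=\min_U(n-\dim U+\dim\mathcal{A}(U))$, so $c=n-\operatorname{ncrank}\mathcal{A}$ is the largest shrinkage; the $c$-shrunk subspaces for this $c$ have a unique minimum (contained in all others), called the minimum $c$-shrunk subspace. Also $\operatorname{ncrank}\mathcal{A}=\sup_{d\ge1}\max\{\frac1d\operatorname{rk}(\sum_iA_i\otimes X_i):X_i\in\mathbb{C}^{d\times d}\}$, and the minimum blow-up size is the least $d$ attaining this supremum. *)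

(* Defs.v *)
From HB Require Import structures.
From mathcomp Require Import all_boot all_order all_algebra.
From mathcomp Require Import mxtens complex.
From mathcomp Require Import all_classical all_reals all_analysis.

Set Implicit Arguments.
Unset Strict Implicit.
Unset Printing Implicit Defensive.

Import Order.TTheory GRing.Theory Num.Theory.
Local Open Scope ring_scope.

(** * Matrix spaces, shrunk subspaces, noncommutative rank *)

Definition mxspan (F : fieldType) (n p : nat) (A : 'I_p -> 'M[F]_n) :
    {vspace 'M[F]_n} :=
  <<[seq A t | t <- enum 'I_p]>>%VS.

(* Spanning over bases of [AA] and [U] suffices: see [mxact_sub]. *)
Definition mxact (F : fieldType) (n : nat) (AA : {vspace 'M[F]_n})
    (U : {vspace 'cV[F]_n}) : {vspace 'cV[F]_n} :=
  <<[seq B *m u | B <- vbasis AA, u <- vbasis U]>>%VS.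

Lemma mxact_sub (F : fieldType) (n : nat) (AA : {vspace 'M[F]_n})
    (U W : {vspace 'cV[F]_n}) :
  (mxact AA U <= W)%VS <->
  (forall B u, B \in AA -> u \in U -> B *m u \in W).
Proof.
split=> [/span_subvP sW B u BA uU | sW]; last first.
  by apply/span_subvP => _ /allpairsP[[B u] [/= hB hu ->]]; apply: sW;
    exact: vbasis_mem.
rewrite (coord_vbasis BA) mulmx_suml; apply: rpred_sum => i _.
rewrite (coord_vbasis uU) mulmx_sumr; apply: rpred_sum => j _.
rewrite -scalemxAl -scalemxAr !rpredZ //; apply: sW.
by apply/allpairsP; exists ((vbasis AA)`_i, (vbasis U)`_j);
  split=> //=; rewrite mem_nth // size_tuple.
Qed.

Definition shrunk (F : fieldType) (n : nat) (AA : {vspace 'M[F]_n}) (c : nat)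
    (U : {vspace 'cV[F]_n}) : Prop :=
  (c + \dim (mxact AA U) <= \dim U)%N.

Definition min_shrunk (F : fieldType) (n : nat) (AA : {vspace 'M[F]_n})
    (c : nat) (U : {vspace 'cV[F]_n}) : Prop :=
  shrunk AA c U /\ forall V, shrunk AA c V -> (U <= V)%VS.

Definition ncrank_val (F : fieldType) (n : nat) (AA : {vspace 'M[F]_n}) :
    pred nat :=
  fun r => `[< exists U : {vspace 'cV[F]_n},
                 r = (n - \dim U + \dim (mxact AA U))%N >].

Lemma ncrank_val_ex (F : fieldType) (n : nat) (AA : {vspace 'M[F]_n}) :
  exists r, ncrank_val AA r.
Proof.
by exists (n - \dim (0 : {vspace 'cV[F]_n}) + \dim (mxact AA 0))%N;
  apply/asboolP; exists 0%VS.
Qed.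

(* [n - \dim U] is not truncated, as [\dim U <= n]. *)
Definition ncrank (F : fieldType) (n : nat) (AA : {vspace 'M[F]_n}) : nat :=
  ex_minn (ncrank_val_ex AA).

(** * Blow-ups *)

Definition blowup (F : fieldType) (n p d : nat) (A : 'I_p -> 'M[F]_n)
    (X : 'I_p -> 'M[F]_d) : 'M[F]_(n * d) :=
  \sum_(t < p) A t *t X t.

Definition blowup_ratios (R : realType) (n p : nat)
    (A : 'I_p -> 'M[R[i]]_n) : set R :=
  [set x | exists (d : nat) (X : 'I_p -> 'M[R[i]]_d),
             (0 < d)%N /\ x = (\rank (blowup A X))%:R / d%:R]%classic.

Definition blowup_attains (R : realType) (n p : nat)
    (A : 'I_p -> 'M[R[i]]_n) (d : nat) : Prop :=
  exists X : 'I_p -> 'M[R[i]]_d,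
    (\rank (blowup A X))%:R / d%:R = sup (blowup_ratios A).

Definition min_blowup_size (R : realType) (n p : nat)
    (A : 'I_p -> 'M[R[i]]_n) (d : nat) : Prop :=
  [/\ (0 < d)%N, blowup_attains A d &
      forall d' : nat, (0 < d')%N -> blowup_attains A d' -> (d <= d')%N].

(** * Gaussian integers *)

Definition gaussint (R : realType) (z : R[i]) : Prop :=
  exists a b : int, z = (a%:~R +i* b%:~R)%C.

Definition magnitude (R : realType) (z : R[i]) : R := Normc.normc z.

(** * Randomized programs

   Three kinds of storage: index registers (naturals), scalar registers
   (elements of Q(i)) and arrays of scalars.  The arrays hold the vectors the
   program works with; a program mentions only finitely many registers.
   A scalar influences control flow and indices only through the zero test
   [IfZero], and there is no instruction converting between indices and scalars.
   Scalars are interpreted in [R[i]] but, constants being Gaussian integers, a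
   run on an input in Q(i) stays in Q(i).  Division by zero yields zero, as
   in MathComp. *)

Inductive iexp : Type :=
| IVar of nat
| ICst of nat
| IAdd of iexp & iexp
| ISub of iexp & iexp
| IMul of iexp & iexp.

Inductive sop : Type := OAdd | OSub | OMul | ODiv.

Inductive cmd : Type :=
| Skip
| Seq of cmd & cmd
| ISet of nat & iexp
| SCst of nat & int & int           (* x := a + b i *)
| SOp of sop & nat & nat & nat      (* x := y op z *)
| SConj of nat & nat                (* x := conjugate of y *)
| Fetch of nat & nat & iexp          (* x := a[e] *)
| Store of nat & iexp & nat         (* a[e] := x *)
| Rand of nat & iexp                (* x := uniform in {0, ..., e} *)
| IfZero of nat & cmd & cmd
| IfLe of iexp & iexp & cmd & cmd
| For of nat & iexp & cmd.          (* for v = 0, ..., e - 1 do c *)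

(* [stored] records every value ever written into an array. *)
Record state (F : Type) : Type := State {
  ireg : nat -> nat;
  sreg : nat -> F;
  arr : nat -> nat -> F;
  cost : nat;
  stored : seq F }.

Definition upd (T : Type) (f : nat -> T) (x : nat) (v : T) : nat -> T :=
  fun y => if y == x then v else f y.

Definition set_ireg (F : Type) (s : state F) (x v : nat) : state F :=
  State (upd (ireg s) x v) (sreg s) (arr s) (cost s) (stored s).

Definition set_sreg (F : Type) (s : state F) (x : nat) (v : F) : state F :=
  State (ireg s) (upd (sreg s) x v) (arr s) (cost s) (stored s).

Definition store (F : Type) (s : state F) (a e : nat) (v : F) : state F :=
  State (ireg s) (sreg s) (upd (arr s) a (upd (arr s a) e v)) (cost s)
        (v :: stored s).

Definition tick (F : Type) (w : nat) (s : state F) : state F :=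
  State (ireg s) (sreg s) (arr s) (w + cost s) (stored s).

Fixpoint ieval (r : nat -> nat) (e : iexp) : nat :=
  match e with
  | IVar x => r x
  | ICst m => m
  | IAdd e1 e2 => (ieval r e1 + ieval r e2)%N
  | ISub e1 e2 => (ieval r e1 - ieval r e2)%N
  | IMul e1 e2 => (ieval r e1 * ieval r e2)%N
  end.

Definition sop_eval (R : realType) (o : sop) (y z : R[i]) : R[i] :=
  match o with
  | OAdd => y + z
  | OSub => y - z
  | OMul => y * z
  | ODiv => y / z
  end.

(* Number of operations over Q realizing the operation over Q(i), e.g.
   (a + b i) / (c + d i) = ((a c + b d) + (b c - a d) i) / (c^2 + d^2). *)
Definition sop_cost (o : sop) : nat :=
  match o with
  | OAdd | OSub => 2
  | OMul => 6
  | ODiv => 11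
  end.

(* A node [Draw m f] draws [j] uniformly among the [m.+1] elements of
   ['I_m.+1] and goes on with [f j]. *)
Inductive rtree (T : Type) : Type :=
| Done of T
| Draw m of ('I_m.+1 -> rtree T).

Fixpoint rbind (S T : Type) (t : rtree S) (g : S -> rtree T) : rtree T :=
  match t with
  | Done s => g s
  | Draw m f => Draw (fun j => rbind (f j) g)
  end.

Fixpoint prob (T : Type) (t : rtree T) (E : T -> Prop) : rat :=
  match t with
  | Done s => (`[< E s >] : nat)%:R
  | Draw m f => (\sum_(j < m.+1) prob (f j) E) / m.+1%:R
  end.

Fixpoint always (T : Type) (t : rtree T) (E : T -> Prop) : Prop :=
  match t with
  | Done s => E s
  | Draw m f => forall j, always (f j) E
  end.

(* Every executed instruction is charged, including index arithmetic, memory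
   accesses, tests, random draws and loop overhead; [cost] therefore bounds the
   number of arithmetic operations over Q. *)
Fixpoint exec (R : realType) (c : cmd) (s : state R[i]) : rtree (state R[i]) :=
  match c with
  | Skip => Done s
  | Seq c1 c2 => rbind (exec c1 s) (exec c2)
  | ISet x e => Done (tick 1 (set_ireg s x (ieval (ireg s) e)))
  | SCst x a b => Done (tick 1 (set_sreg s x (a%:~R +i* b%:~R)%C))
  | SOp o x y z =>
      Done (tick (sop_cost o)
                 (set_sreg s x (sop_eval o (sreg s y) (sreg s z))))
  | SConj x y => Done (tick 1 (set_sreg s x (conjc (sreg s y))))
  | Fetch x a e => Done (tick 1 (set_sreg s x (arr s a (ieval (ireg s) e))))
  | Store a e x => Done (tick 1 (store s a (ieval (ireg s) e) (sreg s x)))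
  | Rand x e =>
      @Draw _ (ieval (ireg s) e)
        (fun j => Done (tick 1 (set_sreg s x (nat_of_ord j)%:R)))
  | IfZero x c1 c2 =>
      if sreg s x == 0 then exec c1 (tick 2 s) else exec c2 (tick 2 s)
  | IfLe e1 e2 c1 c2 =>
      if (ieval (ireg s) e1 <= ieval (ireg s) e2)%N
      then exec c1 (tick 1 s) else exec c2 (tick 1 s)
  | For v e c =>
      iteri (ieval (ireg s) e)
        (fun j t => rbind t (fun s' => exec c (tick 1 (set_ireg s' v j))))
        (Done (tick 1 s))
  end.

(* Input: index registers 0, 1, 2, 3 contain n, p, d, k, and array 0 contains the
   entry (i, j) of A_t at position (t n + i) n + j. *)
Definition input_ireg (n p d k : nat) : nat -> nat :=
  fun x => nth 0%N [:: n; p; d; k] x.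

Definition input_arr (F : fieldType) (n p : nat) (A : 'I_p -> 'M[F]_n) :
    nat -> nat -> F :=
  fun a e => if a == 0%N then
    \sum_(t < p) \sum_(i < n) \sum_(j < n)
      A t i j *+ (e == (t * n + i) * n + j)%N
  else 0.

Definition input (R : realType) (n p d k : nat) (A : 'I_p -> 'M[R[i]]_n) :
    state R[i] :=
  State (input_ireg n p d k) (fun=> 0) (input_arr A) 0 [::].

(* Output: index register 4 contains the number of vectors, and array 1 contains
   the coordinate j of the l-th vector at position l n + j. *)
Definition output (R : realType) (n : nat) (s : state R[i]) :
    seq 'cV[R[i]]_n :=
  [seq \col_(j < n) arr s 1 (l * n + j)%N | l <- iota 0 (ireg s 4)].

(* Values occurring in the output or, at any time, in a vector of the run. *)
Definition vector_entry (R : realType) (n : nat) (s : state R[i]) (z : R[i]) :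
    Prop :=
  z \in stored s \/ exists2 v, v \in output n s & exists j, z = v j 0.

(* Main.v *)
Require Import Defs.
From HB Require Import structures.
From mathcomp Require Import all_boot all_order all_algebra.
From mathcomp Require Import mxtens complex.
From mathcomp Require Import all_classical all_reals all_analysis.
From mathcomp Require Import perm zify ring.
Set Implicit Arguments.
Unset Strict Implicit.
Unset Printing Implicit Defensive.
Import Order.TTheory GRing.Theory Num.Theory.
Local Open Scope ring_scope.

(** Let [N = n d] and let [B] be an [N * N] blow-up attaining the supremum.  Together with
    [X] every doubled tuple [[X, Y], [0, X]] attains it, and this forces the Wong sequence
    of [B] (start with [ker B], then take preimages under [B] of images under all
    blow-ups) to stay in the image of [B].  Hence [rank B = d * ncrank], and the smallest
    subspace [K] containing [ker B] with [C K <= B K] for all blow-ups [C] is [U (x) C^d],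
    where [U] is the minimum [c]-shrunk subspace.

    The program keeps at most [n^2] linearly independent [A_t]'s and draws random blow-ups
    [B = C_0, C_1, ..., C_N].  The spaces [F_0 = ker B] and
    [F_s = { x | B x + C_s x' = 0 for some x' in F_(s-1) }] increase generically until they
    reach [U (x) C^d], at the latest for [s = N].  Revealing the random integers one after
    the other, each of them spoils a still possible success for at most [N^2] of its values,
    so a range of size [4 N^5] gives probability [1/2].

    The systems are solved by inserting one row after the other into a projection onto
    the solution space.  Only a window of width [2 N] is stored, but the projection is a part
    of the one of a virtual system of order [O(N^2)] with integer coefficients; so its
    denominator and its numerators are minors of that system, which bounds them. *)

(** * Row-major indices *)

Lemma ltn_rowmajor m n i j : (i < m -> j < n -> i * n + j < m * n)%N.
Proof.
move=> im jn; apply: (@leq_trans (i.+1 * n)); last by rewrite leq_mul2r im orbT.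
by rewrite mulSn addnC ltn_add2r.
Qed.

Lemma divn_rowmajor n i j : (j < n -> (i * n + j) %/ n = i)%N.
Proof. by move=> jn; rewrite divnMDl ?(leq_trans _ jn) // divn_small // addn0. Qed.

Lemma modn_rowmajor n i j : (j < n -> (i * n + j) %% n = j)%N.
Proof. by move=> jn; rewrite modnMDl modn_small. Qed.

(** * Elimination by rank-one deflation of a projection *)

Section Elimination.
Variable F : fieldType.
Implicit Types (E : {pred F}) (dl : F).

(* The solutions of a linear system in reduced echelon form are the vectors fixed
   by such a matrix: a column vanishes at a pivot, a row is a unit row at a free
   variable. *)
Definition reduced_proj W (Q : 'M[F]_W) :=
  forall c, (forall i, Q i c = 0) \/ (forall j, Q c j = (c == j)%:R).

Definition deflate W (Q : 'M[F]_W) (v : 'rV[F]_W) (c : 'I_W) : 'M[F]_W :=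
  Q - ((v *m Q) 0 c)^-1 *: (col c Q *m (v *m Q)).

Lemma reduced_proj1 W : reduced_proj (1%:M : 'M[F]_W).
Proof. by move=> c; right=> j; rewrite mxE. Qed.

Lemma reduced_proj_idem W (Q : 'M[F]_W) : reduced_proj Q -> Q *m Q = Q.
Proof.
move=> rQ; apply/matrixP=> i j; rewrite mxE.
under eq_bigr => c _.
  rewrite (_ : Q i c * Q c j = Q i c * (c == j)%:R); first over.
  by case: (rQ c) => -> //; rewrite !mul0r.
by rewrite (bigD1 j) //= eqxx mulr1 big1 ?addr0 // => c /negPf->; rewrite mulr0.
Qed.

Lemma deflateE W (Q : 'M[F]_W) v c i j :
  deflate Q v c i j = Q i j - ((v *m Q) 0 c)^-1 * (Q i c * (v *m Q) 0 j).
Proof. by rewrite !mxE big_ord1 !mxE. Qed.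

Lemma mulmx_deflate m W (U : 'M[F]_(m, W)) (Q : 'M[F]_W) v c :
  U *m deflate Q v c =
    U *m Q - ((v *m Q) 0 c)^-1 *: (col c (U *m Q) *m (v *m Q)).
Proof. by rewrite mulmxBr -scalemxAr !colE !mulmxA. Qed.

Lemma mulmx_deflate_eq0 W (Q : 'M[F]_W) v c :
  (v *m Q) 0 c != 0 -> v *m deflate Q v c = 0.
Proof.
move=> vQc; rewrite mulmx_deflate [col c _]mx11_scalar mul_scalar_mx [_ 0 0]mxE.
by rewrite scalerA mulVf // scale1r subrr.
Qed.

Lemma reduced_proj_deflate W (Q : 'M[F]_W) v c :
  reduced_proj Q -> (v *m Q) 0 c != 0 -> reduced_proj (deflate Q v c).
Proof.
move=> rQ vQc c'; have [->|c'c] := eqVneq c' c.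
  by left=> i; rewrite deflateE mulrCA mulVf // mulr1 subrr.
case: (rQ c') => [Qc'|Qc']; [left=> i|right=> j]; rewrite deflateE Qc'.
  by rewrite [(v *m Q) 0 c']mxE big1 ?mulr0 ?subr0 // => k _; rewrite Qc' mulr0.
by rewrite Qc' (negPf c'c) mul0r mulr0 subr0.
Qed.

Lemma fixed_deflate W (Q : 'M[F]_W) v c (x : 'cV[F]_W) :
  reduced_proj Q -> (v *m Q) 0 c != 0 ->
  deflate Q v c *m x = x <-> Q *m x = x /\ v *m x = 0.
Proof.
move=> /reduced_proj_idem QQ vQc; split=> [fx|[Qx vx]].
  by split; rewrite -fx mulmxA ?mulmx_deflate_eq0 ?mul0mx // mulmx_deflate QQ.
by rewrite mulmxBl Qx -scalemxAl -!mulmxA Qx vx !mulmx0 scaler0 subr0.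
Qed.

End Elimination.

(** * The projection as a window of minors *)

Section Window.
Variable F : fieldType.
Implicit Types (E : {pred F}) (dl : F).

Definition compl_proj k D (V : 'M[F]_(k, D)) (piv : 'I_k -> 'I_D) : 'M[F]_D :=
  1%:M - colsub piv 1%:M *m invmx (colsub piv V) *m V.

(* [V] collects the rows inserted so far into a system of [D] unknowns, and [Q] is
   what the window [w] shows of the projection onto its kernel; [dl] is the minor
   of [V] which is a common denominator of the entries. *)
Definition windowed E D W dl (Q : 'M[F]_W) : Prop :=
  exists k (V : 'M[F]_(k, D)) (piv : 'I_k -> 'I_D) (w : 'I_W -> 'I_D),
  [/\ injective w, V \is a mxOver E, colsub piv V \in unitmx,
      dl = \det (colsub piv V) &
      rowsub w (compl_proj V piv) = Q *m rowsub w 1%:M].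

Definition cons_pivot k D (c : 'I_D) (piv : 'I_k -> 'I_D) (b : 'I_(1 + k)) :=
  if fintype.split b is inr b' then piv b' else c.

Lemma mulmx_colsub1 m k D (A : 'M[F]_(m, D)) (piv : 'I_k -> 'I_D) :
  A *m colsub piv 1%:M = colsub piv A.
Proof. by rewrite mulmx_colsub mulmx1. Qed.

Lemma mulmx_compl_proj k D (V : 'M[F]_(k, D)) (piv : 'I_k -> 'I_D) :
  colsub piv V \in unitmx -> V *m compl_proj V piv = 0.
Proof.
by move=> uV; rewrite mulmxBr mulmx1 !mulmxA mulmx_colsub1 mulmxV // mul1mx subrr.
Qed.

Lemma compl_proj_unique k D (V : 'M[F]_(k, D)) (piv : 'I_k -> 'I_D) Z :
  colsub piv V \in unitmx -> V *m (1%:M - colsub piv 1%:M *m Z) = 0 ->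
  1%:M - colsub piv 1%:M *m Z = compl_proj V piv.
Proof.
move=> uV; rewrite mulmxBr mulmx1 mulmxA mulmx_colsub1 => /eqP.
rewrite subr_eq0 => /eqP VE; rewrite /compl_proj -!mulmxA; congr (_ - _ *m _).
by rewrite [X in _ *m X]VE mulKmx.
Qed.

Lemma det_block_schur k (a : 'M[F]_1) (b : 'rV[F]_k) (c : 'cV[F]_k) (M : 'M[F]_k) :
  M \in unitmx ->
  \det (block_mx a b c M) = (a - b *m invmx M *m c) 0 0 * \det M.
Proof.
move=> uM.
have -> : block_mx a b c M =
    block_mx (a - b *m invmx M *m c) b 0 M *m block_mx 1%:M 0 (invmx M *m c) 1%:M.
  rewrite mulmx_block !mulmx1 !mulmx0 !add0r mulmxA subrK.
  by rewrite mulmxA mulmxV // mul1mx.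
by rewrite det_mulmx det_ublock det_lblock !det1 !mulr1 det_mx11.
Qed.

Section ConsPivot.
Variables (k D : nat) (V : 'M[F]_(k, D)) (piv : 'I_k -> 'I_D).
Variables (v : 'rV[F]_D) (c : 'I_D).
Hypothesis uV : colsub piv V \in unitmx.

Lemma colsub_cons_pivot m (A : 'M[F]_(m, D)) :
  colsub (cons_pivot c piv) A = row_mx (col c A) (colsub piv A).
Proof.
by apply/matrixP=> i b; rewrite !mxE /cons_pivot; case: fintype.split => b'; rewrite mxE.
Qed.

Lemma det_cons_pivot :
  \det (colsub (cons_pivot c piv) (col_mx v V)) =
    \det (colsub piv V) * (v *m compl_proj V piv) 0 c.
Proof.
have -> : colsub (cons_pivot c piv) (col_mx v V) =
    block_mx (col c v) (colsub piv v) (col c V) (colsub piv V).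
  rewrite -mulmx_colsub1 colsub_cons_pivot mul_col_row !mulmx_colsub1.
  by rewrite !colEsub.
rewrite det_block_schur // mulrC mulmxBr mulmx1 !mulmxA mulmx_colsub1; congr (_ * _).
by rewrite -[col c V]mulmx1 !colE !mulmx1 mulmxA -!colE !mxE.
Qed.

Lemma deflate_compl_proj : (v *m compl_proj V piv) 0 c != 0 ->
  deflate (compl_proj V piv) v c = compl_proj (col_mx v V) (cons_pivot c piv).
Proof.
move=> yc; set Q := compl_proj V piv; set s := ((v *m Q) 0 c)^-1.
pose Z := invmx (colsub piv V) *m V.
have QE : Q = 1%:M - colsub piv 1%:M *m Z by rewrite mulmxA.
pose Z' := col_mx (s *: (v *m Q)) (Z - col c Z *m (s *: (v *m Q))).
have dE : deflate Q v c = 1%:M - colsub (cons_pivot c piv) 1%:M *m Z'.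
  rewrite colsub_cons_pivot mul_row_col /deflate -/s {}/Z'; clearbody s Z.
  move: (v *m Q) => y; rewrite QE linearB /= !colE !mul1mx -mulmxA.
  move: (colsub _ _) (delta_mx _ _) => U e; rewrite mulmxBl mulmxBr -!mulmxA -!scalemxAr.
  by rewrite scalerBr !opprD !opprK !addrA; congr (_ + _); rewrite addrAC.
rewrite dE; apply: compl_proj_unique.
  by rewrite unitmxE det_cons_pivot unitrM -unitmxE uV unitfE.
rewrite -dE mul_col_mx mulmx_deflate_eq0 // mulmx_deflate mulmx_compl_proj //.
by rewrite linear0 mul0mx scaler0 subr0 col_mx0.
Qed.

End ConsPivot.

Lemma mxsub1 W D (w : 'I_W -> 'I_D) : injective w -> mxsub w w 1%:M = 1%:M :> 'M[F]_W.
Proof. by move=> injw; apply/matrixP=> i j; rewrite !mxE inj_eq. Qed.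

Section Inclusion.
Variables (W D : nat) (w : 'I_W -> 'I_D).
Hypothesis injw : injective w.

Lemma mulmx_rowsub1E m (A : 'M[F]_(m, W)) i j : (A *m rowsub w 1%:M) i (w j) = A i j.
Proof.
have /matrixP/(_ i j) : colsub w (A *m rowsub w 1%:M) = A.
  by rewrite -mulmx_colsub -mxsubcr mxsub1 // mulmx1.
by rewrite mxE.
Qed.

Lemma mulmx_rowsub1_notin m (A : 'M[F]_(m, W)) i x :
  x \notin codom w -> (A *m rowsub w 1%:M) i x = 0.
Proof.
move=> xw; rewrite mxE big1 // => j _; rewrite !mxE.
by rewrite (_ : (w j == x) = false) ?mulr0 //; apply: contraNF xw => /eqP <-; apply: codom_f.
Qed.

Lemma mxOver_rowsub1 E m (A : 'M[F]_(m, W)) :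
  0 \in E -> A \is a mxOver E -> A *m rowsub w 1%:M \is a mxOver E.
Proof.
move=> E0 /mxOverP EA; apply/mxOverP=> i x.
have [/codomP[j ->]|xw] := boolP (x \in codom w); first by rewrite mulmx_rowsub1E.
by rewrite mulmx_rowsub1_notin.
Qed.

End Inclusion.

Lemma windowed_deflate E D W dl (Q : 'M[F]_W) (v : 'rV[F]_W) c :
  0 \in E -> v \is a mxOver E -> (v *m Q) 0 c != 0 -> windowed E D dl Q ->
  windowed E D (dl * (v *m Q) 0 c) (deflate Q v c).
Proof.
move=> E0 Ev vQc [k [V [piv [w [injw EV uV -> QE]]]]].
set P := compl_proj V piv in QE; pose vw : 'rV[F]_D := v *m rowsub w 1%:M.
have inclP : rowsub w 1%:M *m P = Q *m rowsub w 1%:M by rewrite mul_rowsub_mx mul1mx.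
have vwP : vw *m P = v *m Q *m rowsub w 1%:M by rewrite -!mulmxA inclP.
have vwPE j : (vw *m P) 0 (w j) = (v *m Q) 0 j by rewrite vwP mulmx_rowsub1E.
exists _, (col_mx vw V), (cons_pivot (w c) piv), w; split=> //.
- apply/mxOverP=> i x; rewrite mxE; case: fintype.split => b; last exact: (mxOverP EV).
  exact: (mxOverP (mxOver_rowsub1 injw E0 Ev)).
- by rewrite unitmxE det_cons_pivot // vwPE unitrM -unitmxE uV unitfE.
- by rewrite det_cons_pivot // vwPE.
have colwQ : col (w c) (Q *m rowsub w 1%:M) = col c Q.
  by apply/colP=> i; rewrite mxE mulmx_rowsub1E // mxE.
rewrite -deflate_compl_proj ?vwPE // -/P rowsubE mulmx_deflate inclP vwPE colwQ vwP.
by rewrite mulmxBl -scalemxAl mulmxA.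
Qed.

Lemma windowed1 E W : windowed E W 1 (1%:M : 'M[F]_W).
Proof.
exists 0%N, 0, (widen_ord (leq0n W)), id; split=> //.
- exact: flatmxOver.
- by rewrite unitmxE det_mx00 unitr1.
- by rewrite det_mx00.
by rewrite /compl_proj mulmx0 subr0 mul1mx.
Qed.

(* The right half of the window is dropped, its left half moves to the right and [N]
   fresh unknowns, subject to no equation so far, enter on the left. *)
Lemma windowed_shift E D N dl (Q11 Q21 Q22 : 'M[F]_N) : 0 \in E ->
  windowed E D dl (block_mx Q11 (0 : 'M[F]_N) Q21 Q22) ->
  windowed E (D + N) dl (block_mx (1%:M : 'M[F]_N) (0 : 'M[F]_N) (0 : 'M[F]_N) Q11).
Proof.
move=> E0 [k [V [piv [w [injw EV uV -> QE]]]]].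
pose w' (i : 'I_(N + N)) :=
  match fintype.split i with inl j => rshift D j | inr j => lshift N (w (lshift N j)) end.
have w'l j : w' (lshift N j) = rshift D j by rewrite /w' (unsplitK (inl j)).
have w'r j : w' (rshift N j) = lshift N (w (lshift N j)) by rewrite /w' (unsplitK (inr j)).
pose u := rowsub (w \o lshift N) (1%:M : 'M[F]_D).
have inclE : rowsub w' (1%:M : 'M[F]_(D + N)) = block_mx 0 1%:M u 0.
  rewrite scalar_mx_block; apply/matrixP=> i j; rewrite mxE.
  by case: (split_ordP i) => i' ->; case: (split_ordP j) => j' ->;
    rewrite ?w'l ?w'r ?block_mxEul ?block_mxEur ?block_mxEdl ?block_mxEdr ?mxE.
have uP : u *m compl_proj V piv = Q11 *m u.
  move: QE; rewrite rowsubE => /(congr1 usubmx); rewrite -!mul_usub_mx usubmxEsub.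
  rewrite -rowsub_comp -/u => ->; rewrite block_mxEv col_mxKu.
  rewrite -[rowsub w 1%:M]vsubmxK mul_row_col mul0mx addr0.
  by rewrite usubmxEsub -rowsub_comp.
have cE : colsub (lshift N \o piv) (row_mx V 0) = colsub piv V.
  by rewrite colsub_comp -lsubmxEsub row_mxKl.
exists k, (row_mx V 0), (lshift N \o piv), w'; rewrite cE; split=> //.
- move=> x y; rewrite -[x]splitK -[y]splitK; case: fintype.split => i';
    case: fintype.split => j' /=;
    rewrite ?w'l ?w'r => /eqP; rewrite ?eq_lrshift ?eq_rlshift //.
    by rewrite (inj_eq (@rshift_inj _ _)) => /eqP ->.
  by rewrite (inj_eq (@lshift_inj _ _)) (inj_eq injw) (inj_eq (@lshift_inj _ _)) => /eqP ->.
- apply/mxOverP=> a j; rewrite mxE; case: fintype.split => j'; last by rewrite mxE.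
  exact: (mxOverP EV).
have -> : compl_proj (row_mx V 0) (lshift N \o piv) = block_mx (compl_proj V piv) 0 0 1%:M.
  rewrite /compl_proj cE (_ : colsub _ 1%:M = col_mx (colsub piv 1%:M) 0).
    rewrite mul_col_mx mul_col_row !mulmx0 !mul0mx.
    by rewrite scalar_mx_block opp_block_mx add_block_mx !oppr0 !addr0.
  by rewrite colsub_comp -lsubmxEsub scalar_mx_block block_mxEh row_mxKl;
    apply/matrixP=> i j; rewrite !mxE; case: fintype.split => i'; rewrite !mxE.
rewrite rowsubE inclE !mulmx_block !mulmx0 !mul0mx !mul1mx ?mulmx1 !addr0 !add0r.
by rewrite uP.
Qed.

Lemma windowed_pid E N : 0 \in E -> 1 \in E ->
  windowed E (N + N) 1 (block_mx (1%:M : 'M[F]_N) (0 : 'M[F]_N) (0 : 'M[F]_N) (0 : 'M[F]_N)).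
Proof.
move=> E0 E1; pose V : 'M[F]_(N, N + N) := row_mx 0 1%:M.
have VE : colsub (@rshift N N) V = 1%:M by rewrite -rsubmxEsub row_mxKr.
exists N, V, (@rshift N N), id; rewrite VE unitmx1 det1; split=> //.
  by apply/mxOverP=> a j; rewrite mxE; case: fintype.split => b; rewrite mxE //; case: eqP.
rewrite !mxsub_id mulmx1 /compl_proj VE invmx1 mulmx1 -rsubmxEsub.
rewrite scalar_mx_block block_mxEh row_mxKr mul_col_row !mulmx0 !mul0mx mulmx1.
by rewrite -block_mxEh opp_block_mx add_block_mx !oppr0 !addr0 subrr.
Qed.

End Window.

(** * Bounds on minors *)

Section NormBounds.
Variable R : numDomainType.
Implicit Types H a b : R.

Lemma normr_mulmx_le m n p (A : 'M[R]_(m, n)) (B : 'M[R]_(n, p)) a b :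
  (forall i j, `|A i j| <= a) -> (forall i j, `|B i j| <= b) ->
  forall i j, `|(A *m B) i j| <= n%:R * (a * b).
Proof.
move=> Aa Bb i j; rewrite mxE; apply: le_trans (ler_norm_sum _ _ _) _.
apply: le_trans (ler_sum (G := fun=> a * b) _ _) _ => [k _|].
  by rewrite normrM ler_pM.
by rewrite sumr_const card_ord mulr_natl.
Qed.

Lemma normr_det_le n (A : 'M[R]_n) H :
  (forall i j, `|A i j| <= H) -> `|\det A| <= n`!%:R * H ^+ n.
Proof.
move=> AH; apply: le_trans (ler_norm_sum _ _ _) _.
apply: le_trans (ler_sum (G := fun=> H ^+ n) _ _) _ => [s _|].
  rewrite normrM normrX normrN1 expr1n mul1r normr_prod.
  have -> : H ^+ n = \prod_(i < n) H by rewrite prodr_const card_ord.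
  by apply: ler_prod => i _; rewrite normr_ge0 AH.
by rewrite sumr_const -card_Sn mulr_natl.
Qed.

Lemma normr_adj_le n (A : 'M[R]_n) H i j :
  (forall i j, `|A i j| <= H) -> `|\adj A i j| <= n.-1`!%:R * H ^+ n.-1.
Proof.
move=> AH; rewrite mxE normrM normrX normrN1 expr1n mul1r.
by apply: normr_det_le => i' j'; rewrite !mxE.
Qed.

End NormBounds.

Section IntegralMatrices.
Variables (R : comNzRingType) (S : subringClosed R).

Lemma rpred_det n (A : 'M[R]_n) : A \is a mxOver S -> \det A \in S.
Proof.
move=> /mxOverP SA; apply: rpred_sum => s _.
by rewrite rpredM ?rpredX ?rpredN ?rpred1 // rpred_prod.
Qed.

Lemma mxOver_adj n (A : 'M[R]_n) : A \is a mxOver S -> \adj A \is a mxOver S.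
Proof.
move=> /mxOverP SA; apply/mxOverP=> i j; rewrite mxE rpredM ?rpredX ?rpredN ?rpred1 //.
by apply: rpred_det; apply/mxOverP=> i' j'; rewrite !mxE.
Qed.

End IntegralMatrices.

Definition bounded_in (R : numDomainType) (S : {pred R}) (H : R) : {pred R} :=
  [pred z | (z \in S) && (`|z| <= H)].

(* A bound for the numerators of [1 - E (V E)^-1 V], where [V] has at most [D] rows and
   entries of norm at most [H]. *)
Definition minor_bound (R : numDomainType) (H : R) (D : nat) : R :=
  D.+1`!%:R * H ^+ D.

Section MinorBounds.
Variables (F : numFieldType) (S : subringClosed F).
Implicit Types (H : F) (D W : nat).

Lemma sum_mul_bounded m (f g : 'I_m -> F) H H' :
  (forall l, f l \in bounded_in S H) -> (forall l, g l \in bounded_in S H') ->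
  \sum_l f l * g l \in bounded_in S (m%:R * (H * H')).
Proof.
move=> fH gH'; apply/andP; split.
  by apply: rpred_sum => l _; case/andP: (fH l) (gH' l) => Sf _ /andP[Sg _]; exact: rpredM.
rewrite mulr_natl -[X in _ *+ X]card_ord -sumr_const.
apply: le_trans (ler_norm_sum _ _ _) (ler_sum _ _) => l _.
by case/andP: (fH l) (gH' l) => _ fl /andP[_ gl]; rewrite normrM ler_pM.
Qed.

Lemma minor_bound_leq H D D' : 1 <= H -> (D <= D')%N -> minor_bound H D <= minor_bound H D'.
Proof.
move=> H_ge1 DD'; rewrite ler_pM ?ler0n ?exprn_ge0 ?ler_weXn2l ?(le_trans _ H_ge1) //.
by rewrite ler_nat leq_fact.
Qed.

Lemma minor_bound_ge1 H D : 1 <= H -> 1 <= minor_bound H D.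
Proof. by move=> H_ge1; rewrite mulr_ege1 ?exprn_ege1 // ler1n fact_gt0. Qed.

Lemma scaled_compl_proj k D (V : 'M[F]_(k, D)) (piv : 'I_k -> 'I_D) :
  colsub piv V \in unitmx ->
  \det (colsub piv V) *: compl_proj V piv =
    (\det (colsub piv V))%:M - colsub piv 1%:M *m (\adj (colsub piv V) *m V).
Proof.
move=> uV; rewrite scalerBr scalemx1 -mulmxA /invmx uV -scalemxAl -scalemxAr scalerA.
by rewrite divff ?scale1r // -unitfE -unitmxE.
Qed.

Lemma scaled_compl_proj_bounded H k D (V : 'M[F]_(k, D)) (piv : 'I_k -> 'I_D) :
  V \is a mxOver (bounded_in S H) -> colsub piv V \in unitmx ->
  \det (colsub piv V) *: compl_proj V piv \is a mxOver (bounded_in S (minor_bound H k)).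
Proof.
move=> /mxOverP bV uV; rewrite scaled_compl_proj //; set M := colsub piv V.
have SV : V \is a mxOver S by apply/mxOverP=> i j; case/andP: (bV i j).
have SM : M \is a mxOver S by apply/mxOverP=> i j; rewrite mxE (mxOverP SV).
have VH i j : `|V i j| <= H by case/andP: (bV i j).
have MH i j : `|M i j| <= H by rewrite mxE.
have E1 i j : `|colsub piv (1%:M : 'M[F]_D) i j| <= 1.
  by rewrite !mxE; case: eqP; rewrite ?normr1 ?normr0 ?ler01.
have SE : colsub piv 1%:M \is a mxOver S.
  by apply/mxOverP=> i j; rewrite !mxE rpred_nat.
have adjV i j : `|(\adj M *m V) i j| <= k`!%:R * H ^+ k.
  have H_ge0 : 0 <= H := le_trans (normr_ge0 _) (VH i j).
  apply: le_trans (normr_mulmx_le (fun i j => normr_adj_le i j MH) VH i j) _.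
  have k0 : (0 < k)%N := leq_ltn_trans (leq0n i) (ltn_ord i).
  by rewrite -[in leRHS](prednK k0) factS natrM exprSr prednK // !mulrA.
apply/mxOverP=> i j; rewrite inE; apply/andP; split.
  apply: (mxOverP (_ : _ \is a mxOver S)).
  by rewrite rpredB ?mxOver_scalar ?rpred0 ?rpred_det // !mxOverM ?mxOver_adj.
rewrite mxE [X in _ + X]mxE; apply: le_trans (ler_normB _ _) _.
rewrite /minor_bound factS natrM -mulrA -natr1 mulrDl mul1r addrC lerD //.
  by apply: le_trans (normr_mulmx_le E1 adjV i j) _; rewrite mul1r.
rewrite mxE normrMn; apply: le_trans (normr_det_le MH).
by case: (i == j); rewrite ?mulr1n ?mulr0n.
Qed.

Lemma windowed_bounded H D W dl (Q : 'M[F]_W) : 1 <= H ->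
  windowed (bounded_in S H) D dl Q ->
  [/\ dl != 0, dl \in bounded_in S (minor_bound H D) &
      dl *: Q \is a mxOver (bounded_in S (minor_bound H D))].
Proof.
move=> H_ge1 [k [V [piv [w [injw bV uV -> QE]]]]]; set M := colsub piv V.
have kD : (k <= D)%N.
  rewrite -(mxrank_unit uV) -mulmx_colsub1; apply: leq_trans (mxrankM_maxl _ _) _.
  exact: rank_leq_col.
have leD : minor_bound H k <= minor_bound H D by exact: minor_bound_leq.
have VS i j : V i j \in S by case/andP: (mxOverP bV i j).
have VH i j : `|V i j| <= H by case/andP: (mxOverP bV i j).
split; first by rewrite -unitfE -unitmxE.
  rewrite inE rpred_det /=; last by apply/mxOverP=> i j; rewrite mxE.
  apply: le_trans (normr_det_le (H := H) _) (le_trans _ leD) => [i j|]; first by rewrite mxE.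
  by rewrite /minor_bound factS natrM -mulrA ler_peMl ?ler1n ?mulr_ge0 ?exprn_ge0
    ?(le_trans _ H_ge1).
apply/mxOverP=> i j; rewrite mxE -(mulmx_rowsub1E injw) -QE.
have := mxOverP (scaled_compl_proj_bounded bV uV) (w i) (w j).
by rewrite !mxE => /andP[QS /le_trans/(_ leD) Qle]; apply/andP.
Qed.

(* What the correctness of an elimination with at most [D0] unknowns asks of the sets
   of the admissible matrix entries and of the admissible computed values. *)
Definition elimination_safe (entry value : {pred F}) (D0 : nat) : Prop :=
  [/\ 0 \in entry, 1 \in entry, {subset entry <= value} &
      forall D W dl (Q : 'M[F]_W), (D <= D0)%N -> (W <= D0)%N -> windowed entry D dl Q ->
      [/\ dl != 0, dl \in value, dl *: Q \is a mxOver value &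
          forall v : 'rV[F]_W, v \is a mxOver entry ->
            dl *: (v *m Q) \is a mxOver value]].

Lemma bounded_elimination_safe H D0 : 1 <= H -> (0 < D0)%N ->
  elimination_safe (bounded_in S H) (bounded_in S (D0%:R * H * minor_bound H D0)) D0.
Proof.
move=> H_ge1 D1; have H_ge0 : 0 <= H := le_trans ler01 H_ge1.
set B := minor_bound H D0; have B1 : 1 <= B by exact: minor_bound_ge1.
have DH1 : 1 <= D0%:R * H by rewrite mulr_ege1 // ler1n.
have leB : B <= D0%:R * H * B by rewrite ler_peMl // (le_trans ler01).
have leH : H <= D0%:R * H * B.
  by rewrite mulrAC ler_peMl // mulr_ege1 // ler1n.
split=> [|| z|D W dl Q DD0 WD0 wQ].
- by rewrite inE rpred0 normr0.
- by rewrite inE rpred1 normr1.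
- by case/andP=> Sz /le_trans/(_ leH) zB; apply/andP.
have leD : minor_bound H D <= B by exact: minor_bound_leq.
have [dl0 /andP[Sdl dlB] /mxOverP bQ] := windowed_bounded H_ge1 wQ.
have SQ : dl *: Q \is a mxOver S by apply/mxOverP=> i j; case/andP: (bQ i j).
have QB i j : `|(dl *: Q) i j| <= B by case/andP: (bQ i j) => _ /le_trans; apply.
split=> // [||v /mxOverP bv].
- by rewrite inE Sdl (le_trans dlB) // (le_trans leD).
- by apply/mxOverP=> i j; rewrite inE (mxOverP SQ) (le_trans (QB i j)).
have Sv : v \is a mxOver S by apply/mxOverP=> i j; case/andP: (bv i j).
have vH i j : `|v i j| <= H by case/andP: (bv i j).
apply/mxOverP=> i j; rewrite scalemxAr inE (mxOverP (mxOverM Sv SQ)) /=.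
apply: le_trans (normr_mulmx_le vH QB i j) _.
by rewrite mulrA !ler_wpM2r ?(le_trans ler01) // ler_nat.
Qed.

End MinorBounds.

(** * Row spaces *)

Section RowSpaces.
Variable F : fieldType.

Lemma submx_preim q1 q2 m n (Y : 'M[F]_(q1, m)) (K : 'M[F]_(q2, m)) (B : 'M[F]_(m, n)) :
  (kermx B <= K)%MS -> (Y *m B <= K *m B)%MS -> (Y <= K)%MS.
Proof.
move=> kK /submxP[D YB]; rewrite -[Y](subrK (D *m K)) addmx_sub ?submxMl //.
by apply: submx_trans kK; apply/sub_kermxP; rewrite mulmxBl YB mulmxA subrr.
Qed.

Lemma eqmx_rank_leq q1 q2 n (K : 'M[F]_(q1, n)) (K' : 'M[F]_(q2, n)) :
  (K <= K')%MS -> (\rank K' <= \rank K)%N -> (K :=: K')%MS.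
Proof.
move=> KK' r; apply/eqmxP; rewrite KK' /=.
by have [_ <-] := mxrank_leqif_sup KK'; rewrite eqn_leq mxrankS.
Qed.

Lemma ltmx_addsl q q' n (M : 'M[F]_(q, n)) (x : 'M[F]_(q', n)) :
  (M < M + x)%MS = ~~ (x <= M)%MS.
Proof. by rewrite ltmxE addsmxSl addsmx_sub submx_refl. Qed.

Lemma exists_spanning_rows n (S : 'rV[F]_n -> Prop) :
  exists q (M : 'M[F]_(q, n)), (forall i, S (row i M)) /\ forall x, S x -> (x <= M)%MS.
Proof.
pose rows_rank r := `[< exists q (M : 'M[F]_(q, n)), (forall i, S (row i M)) /\ \rank M = r >].
have exr : exists r, rows_rank r.
  by exists 0%N; apply/asboolP; exists 0%N, 0; rewrite mxrank0; split=> // -[].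
have ler r : rows_rank r -> (r <= n)%N.
  by move/asboolP=> [q [M [_ <-]]]; exact: rank_leq_col.
case: (ex_maxnP exr ler) => _ /asboolP[q [M [SM <-]]] rmax; exists q, M; split=> // x Sx.
apply: contraT; rewrite -ltmx_addsl => /rank_ltmx; rewrite ltnNge addsmxE; case/negP.
apply/rmax/asboolP; exists _, (col_mx M x); split=> // i.
by case: (split_ordP i) => j ->; rewrite ?rowKu ?rowKd // ord1 row_id.
Qed.

Lemma rank_ublock_geq m1 m2 n1 n2 q (A : 'M[F]_(m1, n1)) (C : 'M[F]_(m1, n2))
    (B : 'M[F]_(m2, n2)) (X : 'M[F]_(q, m1)) : X *m A = 0 ->
  (\rank A + \rank (B + X *m C)%MS <= \rank (block_mx A C 0 B))%N.
Proof.
move=> XA; set M := block_mx _ _ _ _; pose P : 'M[F]_(n1 + n2, n1) := col_mx 1%:M 0.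
rewrite -(mxrank_mul_ker M P) leq_add //.
  by rewrite mul_block_col !mulmx1 !mulmx0 !addr0 rank_col_mx0.
rewrite addsmxE -(rank_row_0mx n1) mxrankS // sub_capmx.
apply/andP; split; last by apply/sub_kermxP; rewrite mul_row_col mul0mx mulmx0 addr0.
have -> : row_mx 0 (col_mx B (X *m C)) = col_mx (row_mx 0 1%:M) (row_mx X 0) *m M.
  rewrite mul_col_mx !mul_row_block !mul0mx !mul1mx !addr0 !add0r XA.
  by rewrite -block_mxEv block_mxEh col_mx0.
exact: submxMl.
Qed.

End RowSpaces.

(** * Tensor products with an identity matrix *)

Section Slices.
Variables (F : fieldType) (d : nat).
Implicit Types (b : 'I_d) (m n q : nat).

Definition slice n b : 'M[F]_(n * d, n) := colsub (fun j => mxtens_index (j, b)) 1%:M.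

Lemma eq_mxtens_index n (i i' : 'I_n) b b' :
  (mxtens_index (i, b) == mxtens_index (i', b')) = (i == i') && (b == b').
Proof. by rewrite (can_eq (@mxtens_indexK n d)). Qed.

Lemma mulmx_sliceE n q (K : 'M[F]_(q, n * d)) b i j :
  (K *m slice n b) i j = K i (mxtens_index (j, b)).
Proof. by rewrite mulmx_colsub1 mxE. Qed.

Lemma trslice_mulmxE n q (K : 'M[F]_(n * d, q)) b i j :
  ((slice n b)^T *m K) i j = K (mxtens_index (i, b)) j.
Proof. by rewrite trmx_mxsub trmx1 mul_rowsub_mx mul1mx mxE. Qed.

Lemma mulmx_trsliceE n q (S : 'M[F]_(q, n)) b b' i j :
  (S *m (slice n b)^T) i (mxtens_index (j, b')) = S i j *+ (b == b').
Proof.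
rewrite trmx_mxsub trmx1; have [<-|bb'] := eqVneq b b'.
  by rewrite mulmx_rowsub1E // => k k' /eqP; rewrite eq_mxtens_index eqxx andbT => /eqP.
rewrite mulmx_rowsub1_notin //; apply/codomP=> -[k /eqP].
by rewrite eq_mxtens_index [b' == b]eq_sym (negPf bb') andbF.
Qed.

Lemma slice_mulmxE n q (S : 'M[F]_(n, q)) b b' i j :
  (slice n b *m S) (mxtens_index (i, b')) j = S i j *+ (b == b').
Proof. by rewrite -[slice n b *m S]trmxK mxE trmx_mul mulmx_trsliceE mxE. Qed.

Lemma trslice_sliceK n b : (slice n b)^T *m slice n b = 1%:M.
Proof.
by apply/matrixP=> i j; rewrite trslice_mulmxE !mxE eq_mxtens_index eqxx andbT.
Qed.

Lemma tens_delta m n (A : 'M[F]_(m, n)) b b' :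
  A *t delta_mx b b' = slice m b *m A *m (slice n b')^T.
Proof.
apply/matrixP=> i j; case: (mxtens_indexP i) => i1 i2; case: (mxtens_indexP j) => j1 j2.
rewrite tensmxE mulmx_trsliceE slice_mulmxE mxE -mulrnA mulnb mulr_natr.
by rewrite [i2 == b]eq_sym [j2 == b']eq_sym.
Qed.

Lemma sum_slice n : \sum_b slice n b *m (slice n b)^T = 1%:M.
Proof.
apply/matrixP=> i j; case: (mxtens_indexP i) => i1 i2; case: (mxtens_indexP j) => j1 j2.
rewrite summxE (bigD1 i2) //= big1 => [|b /negPf b_i2]; rewrite slice_mulmxE.
  by rewrite !mxE !eq_mxtens_index eqxx mulr1n addr0 [j1 == i1]eq_sym [j2 == i2]eq_sym.
by rewrite b_i2.
Qed.

Lemma tens1_slice m n (S : 'M[F]_(m, n)) b :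
  (S *t 1%:M) *m slice n b = slice m b *m S.
Proof.
apply/matrixP=> i j; case: (mxtens_indexP i) => i1 i2.
by rewrite mulmx_sliceE tensmxE slice_mulmxE mxE mulr_natr eq_sym.
Qed.

Lemma trslice_tens1 m n (S : 'M[F]_(m, n)) b :
  (slice m b)^T *m (S *t 1%:M) = S *m (slice n b)^T.
Proof.
apply/matrixP=> i j; case: (mxtens_indexP j) => j1 j2.
by rewrite trslice_mulmxE tensmxE mulmx_trsliceE mxE mulr_natr.
Qed.

Lemma tens1_subP m q n (S : 'M[F]_(m, n)) (V : 'M[F]_(q, n * d)) :
  reflect (forall b, S *m (slice n b)^T <= V)%MS (S *t (1%:M : 'M[F]_d) <= V)%MS.
Proof.
apply: (iffP idP) => [SV b|SV]; first by rewrite -trslice_tens1 mulmx_sub.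
rewrite -[X in (X <= _)%MS]mul1mx -sum_slice mulmx_suml summx_sub // => b _.
by rewrite -mulmxA trslice_tens1 mulmx_sub.
Qed.

Lemma tens_tens1_sub m q n k (S : 'M[F]_(m, n)) (S' : 'M[F]_(q, n)) (X : 'M[F]_(k, d)) :
  (S <= S')%MS -> (S *t X <= S' *t (1%:M : 'M[F]_d))%MS.
Proof. by case/submxP=> D ->; rewrite -[X]mulmx1 -tensmx_mul submxMl. Qed.

Lemma tensmx11 m : (1%:M : 'M[F]_m) *t (1%:M : 'M[F]_d) = 1%:M.
Proof.
apply/matrixP=> i j; case: (mxtens_indexP i) => i1 i2; case: (mxtens_indexP j) => j1 j2.
by rewrite tensmxE !mxE eq_mxtens_index -natrM mulnb.
Qed.

Lemma rank_tens1 m n (S : 'M[F]_(m, n)) : \rank (S *t (1%:M : 'M[F]_d)) = (\rank S * d)%N.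
Proof.
have -> : \rank (S *t (1%:M : 'M[F]_d)) = \rank (row_base S *t (1%:M : 'M[F]_d)).
  by apply/eqP; rewrite eqn_leq !mxrankS ?tens_tens1_sub ?eq_row_base.
apply/eqP; rewrite -/(row_free _); apply/row_freeP.
have /row_freeP[D SD] := row_base_free S.
by exists (D *t 1%:M); rewrite tensmx_mul SD mulmx1 tensmx11.
Qed.

(* The least row space [S] with [K <= S (x) F^d]. *)
Definition slices n q (K : 'M[F]_(q, n * d)) : 'M[F]_n := (\sum_b <<K *m slice n b>>)%MS.

Lemma sub_tens1_slices n q (K : 'M[F]_(q, n * d)) :
  (K <= slices K *t (1%:M : 'M[F]_d))%MS.
Proof.
rewrite -[X in (X <= _)%MS]mulmx1 -sum_slice mulmx_sumr; apply: summx_sub => b _.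
have /tens1_subP/(_ b) := submx_refl (slices K *t (1%:M : 'M[F]_d)).
apply: submx_trans; rewrite mulmxA submxMr //.
by rewrite (submx_trans _ (sumsmx_sup b _ (submx_refl _))) ?genmxE.
Qed.

End Slices.

Arguments slice F {d} n b.

Section TensorSums.
Variables (F : fieldType) (m n : nat).

Lemma tensmxDr q q' (A : 'M[F]_(m, n)) (X Y : 'M[F]_(q, q')) :
  A *t (X + Y) = A *t X + A *t Y.
Proof.
apply/matrixP=> i j; case: (mxtens_indexP i) => i1 i2; case: (mxtens_indexP j) => j1 j2.
by rewrite [RHS]mxE !tensmxE mxE mulrDr.
Qed.

Lemma tensmxZr q q' (A : 'M[F]_(m, n)) c (X : 'M[F]_(q, q')) :
  A *t (c *: X) = c *: (A *t X).
Proof.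
apply/matrixP=> i j; case: (mxtens_indexP i) => i1 i2; case: (mxtens_indexP j) => j1 j2.
by rewrite [RHS]mxE !tensmxE mxE mulrCA.
Qed.

End TensorSums.

(** * Shrunk subspaces and blow-ups *)

Section MatrixSpace.
Variables (F : fieldType) (n p : nat) (a : 'I_p -> 'M[F]_n).

(* Subspaces are row spaces acted upon from the right, so that [a t] stands for
   the transpose of the matrix [A_t] of the input. *)
Definition rowact (U : 'M[F]_n) : 'M[F]_n := (\sum_(t < p) U *m a t)%MS.

Definition row_shrunk c (U : 'M[F]_n) := (c + \rank (rowact U) <= \rank U)%N.

Definition row_min_shrunk c (U : 'M[F]_n) :=
  row_shrunk c U /\ forall V : 'M[F]_n, row_shrunk c V -> (U <= V)%MS.

Definition row_ncrank r :=
  (exists U : 'M[F]_n, r = (n - \rank U + \rank (rowact U))%N) /\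
  forall U : 'M[F]_n, (r <= n - \rank U + \rank (rowact U))%N.

Lemma rowact_subP q (U : 'M[F]_n) (W : 'M[F]_(q, n)) :
  reflect (forall t, U *m a t <= W)%MS (rowact U <= W)%MS.
Proof. by apply: (iffP sumsmx_subP) => UW t; [apply: UW|move=> _; apply: UW]. Qed.

Lemma rowactS (U V : 'M[F]_n) : (U <= V)%MS -> (rowact U <= rowact V)%MS.
Proof.
move=> UV; apply/rowact_subP=> t; apply: submx_trans (submxMr _ UV) _.
exact: (rowact_subP _ _ (submx_refl _)).
Qed.

Lemma rowactD (U V : 'M[F]_n) : (rowact (U + V)%MS <= rowact U + rowact V)%MS.
Proof.
apply/rowact_subP=> t; rewrite addsmxMr addsmxS //;
  exact: (rowact_subP _ _ (submx_refl _)).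
Qed.

Lemma row_ncrank_leq r : row_ncrank r -> (r <= n)%N.
Proof.
case=> _ /(_ 0); rewrite /rowact big1 ?mxrank0 ?subn0 ?addn0 // => t _.
by rewrite mul0mx.
Qed.

Lemma row_shrunk_cap r (U V : 'M[F]_n) : row_ncrank r ->
  row_shrunk (n - r) U -> row_shrunk (n - r) V -> row_shrunk (n - r) (U :&: V)%MS.
Proof.
move=> rP; have := row_ncrank_leq rP; case: rP => _ /(_ (U + V)%MS); rewrite /row_shrunk.
have := mxrank_sum_cap U V; have := mxrank_sum_cap (rowact U) (rowact V).
have := mxrankS (rowactD U V); have := rank_leq_col (U + V)%MS.
have : (\rank (rowact (U :&: V)%MS) <= \rank (rowact U :&: rowact V)%MS)%N.
  by rewrite mxrankS // sub_capmx !rowactS ?capmxSl ?capmxSr.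
by lia.
Qed.

Lemma exists_row_min_shrunk r : row_ncrank r -> exists U, row_min_shrunk (n - r) U.
Proof.
move=> rP; pose shrunk_rank s := `[< exists2 U : 'M[F]_n, row_shrunk (n - r) U & \rank U = s >].
have exs : exists s, shrunk_rank s.
  case: (rP) => -[U rE] _; exists (\rank U); apply/asboolP; exists U => //.
  by rewrite /row_shrunk; have := rank_leq_col U; have := row_ncrank_leq rP; lia.
case: (ex_minnP exs) => _ /asboolP[U sU <-] Umin; exists U; split=> // V sV.
apply: (submx_trans _ (capmxSr U V)); have [_ <-] := mxrank_leqif_sup (capmxSl U V).
rewrite eqn_leq mxrankS ?capmxSl //; apply/Umin/asboolP; exists (U :&: V)%MS => //;
  exact: row_shrunk_cap.
Qed.

Local Notation bl := (blowup a).

Lemma blowupD d (X Y : 'I_p -> 'M[F]_d) : bl (fun t => X t + Y t) = bl X + bl Y.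
Proof. by rewrite -big_split /=; apply: eq_bigr => t _; exact: tensmxDr. Qed.

Lemma blowupZ d (X : 'I_p -> 'M[F]_d) c : bl (fun t => c *: X t) = c *: bl X.
Proof. by rewrite scaler_sumr; apply: eq_bigr => t _; exact: tensmxZr. Qed.

Lemma blowup0 d : bl (fun=> 0 : 'M[F]_d) = 0.
Proof. by rewrite /blowup big1 // => t _; rewrite tensmx0. Qed.

Lemma tens1_blowup_sub d (S : 'M[F]_n) (X : 'I_p -> 'M[F]_d) :
  (S *t (1%:M : 'M[F]_d) *m bl X <= rowact S *t (1%:M : 'M[F]_d))%MS.
Proof.
rewrite mulmx_sumr; apply: summx_sub => t _.
by rewrite tensmx_mul mul1mx tens_tens1_sub //; exact: (rowact_subP _ _ (submx_refl _)).
Qed.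

Lemma rowact_slices_sub d q q' (K : 'M[F]_(q, n * d)) (V : 'M[F]_(q', n * d)) :
  (forall X, K *m bl X <= V)%MS -> (rowact (slices K) *t (1%:M : 'M[F]_d) <= V)%MS.
Proof.
move=> KV; apply/tens1_subP=> b'.
suff slicesV t : (slices K *m a t *m (slice F n b')^T <= V)%MS.
  rewrite /rowact; elim/big_rec: _ => [|t x _ IH]; first by rewrite mul0mx sub0mx.
  by rewrite addsmxMr addsmx_sub slicesV.
rewrite -mulmxA /slices sumsmxMr_gen; apply/sumsmx_subP=> b _.
rewrite genmxE (eqmxMr _ (genmxE _)).
pose X t' : 'M[F]_d := if t' == t then delta_mx b b' else 0.
have := KV X; rewrite /blowup (bigD1 t) //= big1 ?addr0 => [|t' t't]; last first.
  by rewrite /X (negPf t't) tensmx0.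
by rewrite /X eqxx tens_delta !mulmxA.
Qed.

Lemma rank_blowup_leq r d (X : 'I_p -> 'M[F]_d) : row_ncrank r -> (\rank (bl X) <= r * d)%N.
Proof.
case=> -[U ->] _; have := mxrank_mul_min (U *t (1%:M : 'M[F]_d)) (bl X).
have := mxrankS (tens1_blowup_sub U X); rewrite !rank_tens1.
have : (\rank U * d <= n * d)%N by rewrite leq_mul2r rank_leq_row orbT.
rewrite mulnDl mulnBl; move: (\rank (bl X)) (\rank (_ *m _)) (\rank U * d)%N.
by move: (\rank (rowact U) * d)%N (n * d)%N => *; lia.
Qed.

Section ClosedSpaces.
Variables (d : nat) (X0 : 'I_p -> 'M[F]_d).
Local Notation B := (bl X0).

Definition blowup_closed q (K : 'M[F]_(q, n * d)) :=
  (kermx B <= K)%MS /\ forall X, (K *m bl X <= K *m B)%MS.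

Lemma blowup_closed_tens q (K : 'M[F]_(q, n * d)) : blowup_closed K ->
  (K :=: slices K *t (1%:M : 'M[F]_d))%MS /\
  (K *m B :=: rowact (slices K) *t (1%:M : 'M[F]_d))%MS.
Proof.
case=> kK cK; have aK := rowact_slices_sub cK.
have sK : (slices K *t (1%:M : 'M[F]_d) <= K)%MS.
  by apply: (submx_preim kK); apply: submx_trans (tens1_blowup_sub _ _) aK.
split; apply/eqmxP; first by rewrite sub_tens1_slices sK.
rewrite aK andbT; apply: submx_trans (tens1_blowup_sub _ X0).
by rewrite submxMr ?sub_tens1_slices.
Qed.

Lemma blowup_closed_rank q (K : 'M[F]_(q, n * d)) : blowup_closed K ->
  (\rank (slices K) * d + \rank B = \rank (rowact (slices K)) * d + n * d)%N.
Proof.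
move=> cK; have [KE KBE] := blowup_closed_tens cK; have := mxrank_mul_ker K B.
have -> : \rank (K :&: kermx B)%MS = (n * d - \rank B)%N.
  by rewrite -mxrank_ker; apply/eqP;
    rewrite eqn_leq !mxrankS ?capmxSr // sub_capmx submx_refl cK.1.
rewrite KBE [in RHS]KE !rank_tens1 => <-.
by rewrite -addnA subnK // rank_leq_row.
Qed.

Lemma blowup_closed_ncrank r q (K : 'M[F]_(q, n * d)) :
  row_ncrank r -> blowup_closed K -> \rank B = (r * d)%N.
Proof.
move=> rP cK; apply/eqP; rewrite eqn_leq rank_blowup_leq //=.
have := blowup_closed_rank cK; case: rP => _ /(_ (slices K)).
by have := rank_leq_col (slices K); nia.
Qed.

Lemma blowup_closed_shrunk r q (K : 'M[F]_(q, n * d)) :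
  (0 < d)%N -> row_ncrank r -> blowup_closed K -> row_shrunk (n - r) (slices K).
Proof.
move=> d0 rP cK; have := blowup_closed_rank cK; rewrite (blowup_closed_ncrank rP cK).
by rewrite /row_shrunk; have := row_ncrank_leq rP; nia.
Qed.

Lemma row_shrunk_closed r (V : 'M[F]_n) :
  row_ncrank r -> \rank B = (r * d)%N -> row_shrunk (n - r) V ->
  blowup_closed (V *t (1%:M : 'M[F]_d)).
Proof.
move=> rP rB sV; have rn := row_ncrank_leq rP; set K := V *t _.
have KB := tens1_blowup_sub V X0; rewrite -/K in KB.
have rkerB := mxrank_ker B; have rKB := mxrank_mul_ker K B; have leKB := mxrankS KB.
have leker := mxrankS (capmxSr K (kermx B)).
have sVd : (n * d - r * d + \rank (rowact V) * d <= \rank V * d)%N.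
  by rewrite -mulnBl -mulnDl leq_mul2r; apply/orP; right.
rewrite !rank_tens1 in rKB leKB; rewrite rB in rkerB.
have [ecap eKB] : \rank (K :&: kermx B)%MS = \rank (kermx B) /\
    \rank (K *m B) = (\rank (rowact V) * d)%N.
  move: leker rkerB rKB leKB sVd.
  move: (\rank (_ :&: _)%MS) (\rank (kermx _)) (\rank (K *m _)) (\rank V * d)%N.
  by move: (\rank (rowact V) * d)%N (n * d)%N (r * d)%N => *; lia.
split=> [|X].
  have [_] := mxrank_leqif_sup (capmxSr K (kermx B)).
  by rewrite ecap eqxx sub_capmx => /esym/andP[].
apply: submx_trans (tens1_blowup_sub V X) _.
by have [_ <-] := mxrank_leqif_sup KB; rewrite rank_tens1 eKB.
Qed.

Lemma row_min_shrunk_closed r U :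
  (0 < d)%N -> row_ncrank r -> \rank B = (r * d)%N -> row_min_shrunk (n - r) U ->
  blowup_closed (U *t (1%:M : 'M[F]_d)) /\
  forall K : 'M[F]_(n * d), blowup_closed K -> (U *t (1%:M : 'M[F]_d) <= K)%MS.
Proof.
move=> d0 rP rB [sU mU]; split; first exact: row_shrunk_closed rP rB sU.
move=> K cK; have [-> _] := blowup_closed_tens cK; rewrite tens_tens1_sub //.
exact/mU/(blowup_closed_shrunk d0 rP cK).
Qed.

End ClosedSpaces.

(** * Blow-ups attaining the supremum *)

Definition attaining d (X0 : 'I_p -> 'M[F]_d) :=
  forall d' (X : 'I_p -> 'M[F]_d'), (\rank (bl X) * d <= \rank (bl X0) * d')%N.

Fixpoint wong d (X0 : 'I_p -> 'M[F]_d) l (x : 'rV[F]_(n * d)) : Prop :=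
  if l is l'.+1 then exists X x', wong X0 l' x' /\ x *m bl X0 = x' *m bl X
  else x *m bl X0 = 0.

Definition block_tuple d (P Q R S : 'I_p -> 'M[F]_d) t : 'M[F]_(d + d) :=
  block_mx (P t) (Q t) (R t) (S t).

(* The isometry F^n (x) F^d + F^n (x) F^d -> F^n (x) (F^d + F^d). *)
Definition tens_dsum d : 'M[F]_(n * d + n * d, n * (d + d)) :=
  col_mx ((1%:M : 'M[F]_n) *t (row_mx 1%:M 0 : 'M[F]_(d, d + d)))
         ((1%:M : 'M[F]_n) *t (row_mx 0 1%:M : 'M[F]_(d, d + d))).

Lemma tr_tens_dsumK d : (tens_dsum d)^T *m tens_dsum d = 1%:M.
Proof.
rewrite tr_col_mx !trmx_tens mul_row_col !tensmx_mul !trmx1 !mulmx1.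
rewrite !tr_row_mx !trmx1 !trmx0 !mul_col_row ?mulmx1 ?mulmx0 ?mul0mx.
by rewrite -tensmxDr // add_block_mx !addr0 !add0r -scalar_mx_block tensmx11.
Qed.

Lemma tens_dsumK d : tens_dsum d *m (tens_dsum d)^T = 1%:M.
Proof.
rewrite tr_col_mx mul_col_row !trmx_tens !tensmx_mul !trmx1 !mulmx1.
rewrite !tr_row_mx !trmx1 !trmx0 !mul_row_col ?mulmx1 ?mulmx0 ?mul0mx ?addr0 ?add0r.
by rewrite !tensmx11 !tensmx0 -scalar_mx_block.
Qed.

Lemma blowup_block_tuple d (P Q R S : 'I_p -> 'M[F]_d) :
  tens_dsum d *m bl (block_tuple P Q R S) *m (tens_dsum d)^T =
  block_mx (bl P) (bl Q) (bl R) (bl S).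
Proof.
have blE (e1 e2 : 'M[F]_(d, d + d)) :
    (1%:M *t e1) *m bl (block_tuple P Q R S) *m (1%:M *t e2)^T =
    \sum_t a t *t (e1 *m block_tuple P Q R S t *m e2^T).
  rewrite mulmx_sumr mulmx_suml; apply: eq_bigr => t _.
  by rewrite trmx_tens trmx1 !tensmx_mul !mul1mx mulmx1.
rewrite /tens_dsum tr_col_mx mul_col_mx mul_col_row !blE.
by congr block_mx; apply: eq_bigr => t _; rewrite /block_tuple mul_row_block tr_row_mx
  mul_row_col !trmx1 !trmx0 !mul1mx !mul0mx !mulmx1 !mulmx0 ?addr0 ?add0r.
Qed.

Lemma rank_blowup_block_tuple d (P Q R S : 'I_p -> 'M[F]_d) :
  \rank (bl (block_tuple P Q R S)) = \rank (block_mx (bl P) (bl Q) (bl R) (bl S)).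
Proof.
rewrite -blowup_block_tuple mxrankMfree ?eqmxMfull //.
  by apply/row_fullP; exists (tens_dsum d)^T; exact: tr_tens_dsumK.
by apply/row_freeP; exists (tens_dsum d); exact: tr_tens_dsumK.
Qed.

Lemma row_mx_blowup_block_tuple d (P Q R S : 'I_p -> 'M[F]_d) (x y : 'rV[F]_(n * d)) :
  row_mx x y *m tens_dsum d *m bl (block_tuple P Q R S) =
  row_mx (x *m bl P + y *m bl R) (x *m bl Q + y *m bl S) *m tens_dsum d.
Proof.
rewrite -mul_row_block -(blowup_block_tuple P Q R S) !mulmxA.
by rewrite -[RHS]mulmxA tr_tens_dsumK mulmx1.
Qed.

Lemma attaining_block_tuple d (X0 Y : 'I_p -> 'M[F]_d) : attaining X0 ->
  attaining (block_tuple X0 Y (fun=> 0) X0).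
Proof.
move=> aX d' X; have := aX d' X; rewrite rank_blowup_block_tuple blowup0.
have := rank_ublock_geq (bl Y) (bl X0) (mul0mx 1 (bl X0)).
by rewrite mul0mx addsmx0; nia.
Qed.

(* A Wong sequence of length [l + 1] for [X0] is one of length [l] for the doubled
   blow-up [[X0, Y], [0, X0]], which attains the supremum if [X0] does. *)
Lemma wong_block_tuple d (X0 : 'I_p -> 'M[F]_d) l y : wong X0 l.+1 y ->
  exists Y x P, y *m bl X0 = x *m bl P /\
    wong (block_tuple X0 Y (fun=> 0) X0) l (row_mx x y *m tens_dsum d).
Proof.
elim: l y => [|l IHl] y.
  case=> X [x [xB yB]]; exists (fun t => - 1 *: X t), x, X; split=> //=.
  rewrite row_mx_blowup_block_tuple blowup0 blowupZ xB mulmx0 addr0 yB.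
  by rewrite -scalemxAr scaleN1r addNr row_mx0 mul0mx.
case=> X' [x' [wx' yB]]; have [Y [x [P [x'B wx]]]] := IHl _ wx'.
exists Y, x', X'; split=> //.
exists (block_tuple P (fun=> 0) (fun=> 0) (fun t => Y t + X' t)), (row_mx x x' *m tens_dsum d).
split=> //; rewrite !row_mx_blowup_block_tuple !blowup0 !mulmx0 !addr0 add0r x'B.
by rewrite blowupD mulmxDr yB.
Qed.

Lemma wong_sub l d (X0 : 'I_p -> 'M[F]_d) x X : (0 < d)%N -> attaining X0 ->
  wong X0 l x -> (x *m bl X <= bl X0)%MS.
Proof.
elim: l d X0 x X => [|l IHl] d X0 x X d0 aX.
  move=> /= xB; apply: contraT; rewrite -ltmx_addsl => /rank_ltmx lt_rank.
  have := aX _ (block_tuple X0 X (fun=> 0) X0); rewrite rank_blowup_block_tuple blowup0.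
  by have := rank_ublock_geq (bl X) (bl X0) xB; nia.
move=> /wong_block_tuple[Y [x' [P [_ wx]]]].
have := IHl _ _ _ (block_tuple (fun=> 0) (fun=> 0) X (fun=> 0)) _ (attaining_block_tuple Y aX) wx.
rewrite addn_gt0 d0 => /(_ isT)/submxP[z].
rewrite row_mx_blowup_block_tuple blowup0 !mulmx0 !add0r -[z]mulmx1 -tr_tens_dsumK mulmxA.
rewrite -[z *m _]hsubmxK row_mx_blowup_block_tuple blowup0 mulmx0 addr0.
move/(congr1 (mulmxr (tens_dsum d)^T)); rewrite /= -!mulmxA tens_dsumK !mulmx1.
by case/eq_row_mx=> -> _; rewrite submxMl.
Qed.

Lemma exists_blowup_closed d (X0 : 'I_p -> 'M[F]_d) : (0 < d)%N -> attaining X0 ->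
  exists q (K : 'M[F]_(q, n * d)), blowup_closed X0 K.
Proof.
move=> d0 aX; have [q [M [wM sM]]] := exists_spanning_rows (fun x => exists l, wong X0 l x).
exists q, M; split=> [|X]; apply/row_subP=> i.
  by apply: sM; exists 0%N; rewrite /= -row_mul mulmx_ker row0.
rewrite row_mul; case: (wM i) => l wl; have /submxP[y yE] := wong_sub X d0 aX wl.
by rewrite yE submxMr //; apply: sM; exists l.+1, X, (row i M).
Qed.

Lemma attaining_ncrank r d (X0 : 'I_p -> 'M[F]_d) :
  (0 < d)%N -> row_ncrank r -> attaining X0 -> \rank (bl X0) = (r * d)%N.
Proof. by move=> d0 rP /(exists_blowup_closed d0)[q [K /(blowup_closed_ncrank rP)]]. Qed.

End MatrixSpace.

(** * Polynomial families of row spaces *)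

Section Roots.
Variable F : numFieldType.

Lemma card_nat_roots (p : {poly F}) m : p != 0 ->
  (#|[pred j : 'I_m | (p.[(j : nat)%:R] == 0)%R]| <= (size p).-1)%N.
Proof.
move=> p0; set S := [pred j | _].
have := @max_poly_roots F p [seq (nat_of_ord j)%:R | j <- enum S] p0.
rewrite size_map -cardE => roots_lt; rewrite -ltnS prednK ?size_poly_gt0 // roots_lt //.
  by apply/allP=> _ /mapP[j jS ->]; move: jS; rewrite mem_enum.
by rewrite map_inj_uniq ?enum_uniq // => i j /eqP; rewrite eqr_nat => /eqP/val_inj.
Qed.

Lemma card_exceptions_leq (p : {poly F}) (P : nat -> Prop) b m :
  p != 0 -> (size p <= b.+1)%N -> (forall j : nat, p.[j%:R] != 0 -> P j) ->
  (#|[pred j : 'I_m | ~~ `[< P j >]]| <= b)%N.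
Proof.
move=> p0 sp pP; apply: (@leq_trans (size p).-1); last by lia.
apply: leq_trans (card_nat_roots m p0); apply: subset_leq_card; apply/fintype.subsetP=> j.
by rewrite !inE; apply: contraR => /pP Pj; exact/asboolP.
Qed.

Lemma exists_nonroot (p : {poly F}) : p != 0 -> exists2 e : F, e != 0 & p.[e] != 0.
Proof.
move=> p0; have Xp0 : 'X * p != 0 by rewrite mulf_neq0 // polyX_eq0.
have [j] : exists j : 'I_(size ('X * p)), ('X * p).[(j : nat)%:R] != 0.
  apply/existsP; apply: contraTT (card_nat_roots (size ('X * p)) Xp0).
  rewrite negb_exists => /forallP all0; rewrite -ltnNge (eq_card (B := predT)).
    by rewrite card_ord prednK ?size_poly_gt0.
  by move=> j; rewrite !inE; have := all0 j; rewrite negbK.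
by rewrite hornerM hornerX mulf_eq0 negb_or => /andP[j0 pj]; exists (j : nat)%:R.
Qed.

End Roots.

Section PolyMatrices.
Variable F : fieldType.
Implicit Types (q m n r : nat).

Local Notation eval_mx e := (map_mx (horner_eval e)).

Lemma mxrank_geq_mulmx1 q n (A : 'M[F]_(q, n)) r : (r <= \rank A)%N ->
  exists (L : 'M[F]_(r, q)) (K : 'M[F]_(n, r)), L *m A *m K = 1%:M.
Proof.
move=> rA.
exists (pid_mx r *m invmx (col_ebase A)), (invmx (row_ebase A) *m pid_mx r).
rewrite -{2}(mulmx_ebase A) !mulmxA mulmxKV ?col_ebase_unit //.
rewrite mulmxK ?row_ebase_unit // !mul_pid_mx -(pid_mx_1 F r).
by congr pid_mx; have := rank_leq_row A; have := rank_leq_col A; lia.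
Qed.

Lemma size_det_leq r dg (A : 'M[{poly F}]_r) :
  (forall i j, (size (A i j) <= dg.+1)%N) -> (size (\det A) <= (r * dg).+1)%N.
Proof.
move=> sA; apply: leq_trans (size_sum _ _ _) _; apply/bigmax_leqP => s _.
rewrite size_Msign; apply: leq_trans (size_poly_prod_leq _ _) _; rewrite card_ord.
have : (\sum_(i < r) size (A i (s i)) <= \sum_(i < r) dg.+1)%N by apply: leq_sum.
by rewrite sum_nat_const card_ord mulnS; move: (\sum_(i < r) _)%N (r * dg)%N => z w; lia.
Qed.

Lemma size_mulmx_leq m n q dg dg' (A : 'M[{poly F}]_(m, n)) (B : 'M[{poly F}]_(n, q)) :
  (forall i j, size (A i j) <= dg.+1)%N -> (forall i j, size (B i j) <= dg'.+1)%N ->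
  forall i j, (size ((A *m B) i j) <= (dg + dg').+1)%N.
Proof.
move=> sA sB i j; rewrite mxE; apply: leq_trans (size_sum _ _ _) _.
apply/bigmax_leqP=> k _; apply: leq_trans (size_polyMleq _ _) _.
have := sA i k; have := sB k j.
by move: (size (A i k)) (size (B k j)) => x y; lia.
Qed.

Lemma eval_mx_polyC m n (A : 'M[F]_(m, n)) e : eval_mx e (map_mx polyC A) = A.
Proof. by apply/matrixP=> i j; rewrite !mxE /horner_eval hornerC. Qed.

Lemma size_map_polyC m n (A : 'M[F]_(m, n)) i j : (size (map_mx polyC A i j) <= 1)%N.
Proof. by rewrite mxE size_polyC_leq1. Qed.

Definition affine_mx m n (A0 A1 : 'M[F]_(m, n)) : 'M[{poly F}]_(m, n) :=
  map_mx polyC A0 + 'X *: map_mx polyC A1.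

Lemma eval_affine_mx m n (A0 A1 : 'M[F]_(m, n)) e :
  eval_mx e (affine_mx A0 A1) = A0 + e *: A1.
Proof.
by apply/matrixP=> i j; rewrite !mxE /horner_eval hornerD hornerM hornerX !hornerC.
Qed.

Lemma size_affine_mx m n (A0 A1 : 'M[F]_(m, n)) i j : (size (affine_mx A0 A1 i j) <= 2)%N.
Proof.
rewrite !mxE; apply: leq_trans (size_polyD _ _) _; rewrite geq_max.
rewrite (leq_trans (size_polyC_leq1 _)) //= mulrC mul_polyC.
by rewrite (leq_trans (size_scale_leq _ _)) // size_polyX.
Qed.

Definition poly_space n dg q (V : F -> 'M[F]_(q, n)) :=
  exists r (M : 'M[{poly F}]_(r, n)),
    (forall i j, (size (M i j) <= dg.+1)%N) /\ forall e, (V e :=: eval_mx e M)%MS.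

Lemma poly_space_rank n dg q (V : F -> 'M[F]_(q, n)) e0 r :
  poly_space dg V -> (r <= \rank (V e0))%N ->
  exists2 p : {poly F}, p != 0 /\ (size p <= (r * dg).+1)%N &
    forall e, p.[e] != 0 -> (r <= \rank (V e))%N.
Proof.
case=> s [M [sM VE]]; rewrite VE => /mxrank_geq_mulmx1[L [K LK]].
pose A := map_mx polyC L *m M *m map_mx polyC K.
have detA e : (\det A).[e] = \det (L *m eval_mx e M *m K).
  by rewrite -/(horner_eval e (\det A)) -det_map_mx !map_mxM !eval_mx_polyC.
exists (\det A) => [|e].
  split; first by apply/eqP=> A0; have /eqP := detA e0; rewrite A0 LK det1 horner0 eq_sym oner_eq0.
  rewrite -[dg]addn0 -[dg]add0n; apply: size_det_leq.
  by apply: size_mulmx_leq; first apply: size_mulmx_leq => //; exact: size_map_polyC.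
rewrite detA VE => dn0.
have /mxrank_unit <- : L *m eval_mx e M *m K \in unitmx by rewrite unitmxE unitfE.
by apply: leq_trans (mxrankM_maxl _ _) _; exact: mxrankM_maxr.
Qed.

Lemma poly_space_affine n q (A0 A1 : 'M[F]_(q, n)) : poly_space 1 (fun e => A0 + e *: A1).
Proof.
exists q, (affine_mx A0 A1); split=> [i j|e]; first exact: size_affine_mx.
by rewrite eval_affine_mx.
Qed.

Lemma poly_space_const n dg q (K : 'M[F]_(q, n)) : poly_space dg (fun=> K).
Proof.
exists q, (map_mx polyC K); split=> [i j|e]; last by rewrite eval_mx_polyC.
exact: leq_trans (size_map_polyC _ _ _) _.
Qed.

Lemma poly_space_adds n dg q1 q2 (V1 : F -> 'M[F]_(q1, n)) (V2 : F -> 'M[F]_(q2, n)) :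
  poly_space dg V1 -> poly_space dg V2 -> poly_space dg (fun e => V1 e + V2 e)%MS.
Proof.
case=> r1 [M1 [s1 E1]] [r2 [M2 [s2 E2]]]; exists (r1 + r2)%N, (col_mx M1 M2).
split=> [i j|e]; first by rewrite mxE; case: fintype.split.
by rewrite map_col_mx; apply: eqmx_trans (adds_eqmx (E1 e) (E2 e)) (addsmxE _ _).
Qed.

Lemma poly_space_mul n m m' dg q (V : F -> 'M[F]_(q, n)) (A0 A1 : 'M[F]_(n, m))
    (G : 'M[F]_(m, m')) :
  poly_space dg V -> poly_space dg.+1 (fun e => V e *m (A0 + e *: A1) *m G).
Proof.
case=> r [M [sM ME]]; exists r, (M *m affine_mx (A0 *m G) (A1 *m G)); split=> [i j|e].
  by rewrite -addn1; apply: size_mulmx_leq => // i' j'; exact: size_affine_mx.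
rewrite map_mxM eval_affine_mx scalemxAl -mulmxDl mulmxA.
by rewrite -!(mulmxA _ (_ + _)); exact: eqmxMr.
Qed.

Lemma poly_space_eq n dg dg' q (V V' : F -> 'M[F]_(q, n)) :
  dg = dg' -> V =1 V' -> poly_space dg V -> poly_space dg' V'.
Proof. by move=> <- VV' [r [M [sM ME]]]; exists r, M; split=> // e; rewrite -VV'. Qed.

End PolyMatrices.

Lemma poly_space_generic2 (F : numFieldType) n q1 q2 dg1 dg2
    (V1 : F -> 'M[F]_(q1, n)) (V2 : F -> 'M[F]_(q2, n)) e1 e2 r1 r2 :
  poly_space dg1 V1 -> poly_space dg2 V2 ->
  (r1 <= \rank (V1 e1))%N -> (r2 <= \rank (V2 e2))%N ->
  exists2 e : F, e != 0 & (r1 <= \rank (V1 e))%N /\ (r2 <= \rank (V2 e))%N.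
Proof.
move=> p1 p2 /(poly_space_rank p1)[q1' [q10 _] rank1] /(poly_space_rank p2)[q2' [q20 _] rank2].
have [e e0] := exists_nonroot (mulf_neq0 q10 q20).
by rewrite hornerM mulf_eq0 negb_or => /andP[/rank1 ? /rank2 ?]; exists e.
Qed.

(** * Chains of preimages *)

Section Chain.
Variables (F : fieldType) (N : nat) (B : 'M[F]_N).

(* The preimage of [K C] under [B], provided that [K C <= B]. *)
Definition chain_step (K C : 'M[F]_N) : 'M[F]_N := (kermx B + K *m C *m pinvmx B)%MS.

Definition chain (s : seq 'M[F]_N) : 'M[F]_N := foldl chain_step (kermx B) s.

Lemma chain_rcons s C : chain (rcons s C) = chain_step (chain s) C.
Proof. exact: foldl_rcons. Qed.

Lemma chain_stepS K K' C : (K <= K')%MS -> (chain_step K C <= chain_step K' C)%MS.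
Proof. by move=> KK'; rewrite addsmxS // !submxMr. Qed.

Lemma chain_catl s s' : (chain s' <= chain (s ++ s'))%MS.
Proof.
rewrite /chain foldl_cat; have : (kermx B <= foldl chain_step (kermx B) s)%MS.
  by elim/last_ind: s => [|s C _]; rewrite //= foldl_rcons addsmxSl.
move: (kermx B) (foldl _ _ _) => K K'.
by elim: s' K K' => //= C s' IH K K' KK'; apply/IH/chain_stepS.
Qed.

Lemma kermx_chain s : (kermx B <= chain s)%MS.
Proof. by have := chain_catl s [::]; rewrite cats0. Qed.

Lemma chain_step_id K : (kermx B <= K)%MS -> (chain_step K B :=: K)%MS.
Proof.
move=> kK; have KB : K *m B *m pinvmx B *m B = K *m B by rewrite mulmxKpV ?submxMl.
apply/eqmxP; rewrite addsmx_sub kK /=; apply/andP; split.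
  by apply: (submx_preim kK); rewrite KB.
rewrite -{1}[K](subrK (K *m B *m pinvmx B)) addmx_sub_adds //.
by apply/sub_kermxP; rewrite mulmxBl KB subrr.
Qed.

Lemma chain_rcons_id s : (chain (rcons s B) :=: chain s)%MS.
Proof. by rewrite chain_rcons; apply/chain_step_id/kermx_chain. Qed.

Lemma chain_cat_nseq s k : (chain (s ++ nseq k B) :=: chain s)%MS.
Proof.
elim: k => [|k IHk]; first by rewrite cats0.
by rewrite -addn1 nseqD catA cats1; apply: eqmx_trans (chain_rcons_id _) IHk.
Qed.

Lemma chain_step_sub (K C U : 'M[F]_N) : (kermx B <= U)%MS -> (K *m C <= U *m B)%MS ->
  (chain_step K C <= U)%MS.
Proof.
move=> kU KCU; rewrite addsmx_sub kU; apply: (submx_preim kU).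
by rewrite mulmxKpV // (submx_trans KCU) ?submxMl.
Qed.

Lemma chain_step_line_sub K C e : e != 0 -> (K *m B <= B)%MS -> (K *m C <= B)%MS ->
  (chain_step K (B + e *: (C - B)) <= K)%MS -> (K *m C <= K *m B)%MS.
Proof.
move=> e0 KB KC /(submx_trans (addsmxSr _ _))/(submxMr B).
have KD : K *m (B + e *: (C - B)) = K *m B + e *: (K *m C - K *m B).
  by rewrite mulmxDr -scalemxAr mulmxBr.
rewrite mulmxKpV ?KD => [sub|]; last by rewrite addmx_sub ?scalemx_sub ?addmx_sub ?eqmx_opp.
have -> : K *m C = e^-1 *: ((K *m B + e *: (K *m C - K *m B)) - K *m B) + K *m B.
  by rewrite [K *m B + _]addrC addrK scalerA mulVf // scale1r subrK.
by rewrite addmx_sub // scalemx_sub // addmx_sub // eqmx_opp.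
Qed.

Definition line_seq (l : seq ('M[F]_N * 'M[F]_N)) (e : F) := [seq c.1 + e *: c.2 | c <- l].

Definition const_line (s : seq 'M[F]_N) : seq ('M[F]_N * 'M[F]_N) := [seq (C, 0) | C <- s].

Definition segment (s s' : seq 'M[F]_N) := [seq (c.1, c.2 - c.1) | c <- zip s s'].

Lemma line_seq_cat l l' e : line_seq (l ++ l') e = line_seq l e ++ line_seq l' e.
Proof. exact: map_cat. Qed.

Lemma line_seq_const s e : line_seq (const_line s) e = s.
Proof.
by rewrite /line_seq -map_comp map_id_in // => C _ /=; rewrite scaler0 addr0.
Qed.

Lemma size_segment s s' : size s = size s' -> size (segment s s') = size s.
Proof. by move=> ss'; rewrite size_map size_zip ss' minnn. Qed.

Lemma segment0 s s' : size s = size s' -> line_seq (segment s s') 0 = s.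
Proof.
elim: s s' => [|c s IHs] [|c' s'] //= [ss']; rewrite scale0r addr0.
by rewrite -[in RHS](IHs _ ss').
Qed.

Lemma segment1 s s' : size s = size s' -> line_seq (segment s s') 1 = s'.
Proof.
elim: s s' => [|c s IHs] [|c' s'] //= [ss']; rewrite scale1r addrC subrK.
by rewrite -[in RHS](IHs _ ss').
Qed.

Lemma poly_space_chain l : poly_space (size l) (fun e => chain (line_seq l e)).
Proof.
elim/last_ind: l => [|l c IHl]; first exact: poly_space_const.
apply: (poly_space_eq (dg := (size l).+1)
  (V := fun e => kermx B + chain (line_seq l e) *m (c.1 + e *: c.2) *m pinvmx B)%MS).
- by rewrite size_rcons.
- by move=> e; rewrite /line_seq map_rcons chain_rcons.
by apply: poly_space_adds; [exact: poly_space_const|exact: poly_space_mul].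
Qed.

End Chain.

Section GenericChain.
Variables (F : numFieldType) (N : nat) (B U : 'M[F]_N) (fam : {pred 'M[F]_N}).
Hypothesis famB : B \in fam.
Hypothesis fam_line : forall e C D, C \in fam -> D \in fam -> C + e *: (D - C) \in fam.
Hypothesis kerU : (kermx B <= U)%MS.
Hypothesis famU : {in fam, forall C, U *m C <= U *m B}%MS.
Hypothesis minU : forall K : 'M[F]_N, (kermx B <= K)%MS ->
  {in fam, forall C, K *m C <= K *m B}%MS -> (U <= K)%MS.

Local Notation chain := (chain B).
Local Notation in_fam := (all [in fam]).

Lemma in_fam_segment s s' e : size s = size s' -> in_fam s -> in_fam s' ->
  in_fam (line_seq (segment s s') e).
Proof.
elim: s s' => [|c s IHs] [|c' s'] //= [ss'] /andP[c_fam s_fam] /andP[c'_fam s'_fam].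
by rewrite fam_line //; exact: IHs.
Qed.

Lemma in_fam_nseq t : in_fam (nseq t B).
Proof. by rewrite all_nseq /= famB orbT. Qed.

Lemma chain_sub s : in_fam s -> (chain s <= U)%MS.
Proof.
elim/last_ind: s => [//|s C IHs]; rewrite all_rcons => /andP[/= C_fam /IHs sU].
by rewrite chain_rcons chain_step_sub // (submx_trans (submxMr _ sU)) ?famU.
Qed.

Let chain_rank t r := `[< exists s, [/\ size s = t, in_fam s & \rank (chain s) = r] >].

Let exists_chain_rank t : exists r, chain_rank t r.
Proof.
exists (\rank (chain (nseq t B))); apply/asboolP; exists (nseq t B).
by rewrite size_nseq in_fam_nseq.
Qed.

Let chain_rank_leq t r : chain_rank t r -> (r <= N)%N.
Proof. by move/asboolP=> [s [_ _ <-]]; exact: rank_leq_col. Qed.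

Definition max_rank t := ex_maxn (exists_chain_rank t) (@chain_rank_leq t).

Definition maximal t s := [/\ size s = t, in_fam s & \rank (chain s) = max_rank t].

Lemma exists_maximal t : exists s, maximal t s.
Proof. by rewrite /maximal /max_rank; case: ex_maxnP => r /asboolP. Qed.

Lemma max_rank_geq s : in_fam s -> (\rank (chain s) <= max_rank (size s))%N.
Proof.
move=> s_fam; rewrite /max_rank; case: ex_maxnP => r _; apply.
by apply/asboolP; exists s.
Qed.

Lemma max_rankS t : (max_rank t <= max_rank t.+1)%N.
Proof.
have [s [<- s_fam <-]] := exists_maximal t.
apply: leq_trans (mxrankS (chain_catl B [:: B] s)) _.
by apply: max_rank_geq; rewrite /= famB.
Qed.

(* Let [D1 :: mid ++ [:: D2]] be a maximal chain of length [t + 2]. A generic [m] on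
   the line from [mid] to a maximal chain of length [t] keeps both ranks maximal, so
   prepending [D1] to [m] does not change its chain. *)
Lemma max_rank_stagnates t :
  max_rank t = max_rank t.+1 -> max_rank t.+1 = max_rank t.+2.
Proof.
move=> mt; apply/eqP; rewrite eqn_leq max_rankS /=.
have [[|D1 s'] [//= [] ss' /andP[/= D1_fam s'_fam] rs]] := exists_maximal t.+2.
case/lastP: s' ss' s'_fam rs => [//|mid D2]; rewrite size_rcons all_rcons => -[smid].
case/andP=> /= D2_fam mid_fam rs; have [c [sc c_fam rc]] := exists_maximal t.
have mc : size mid = size c by rewrite smid sc.
pose l := segment mid c; pose l12 := const_line [:: D1] ++ l ++ const_line [:: D2].
have l12E e : line_seq l12 e = D1 :: rcons (line_seq l e) D2.
  by rewrite !line_seq_cat !line_seq_const cats1.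
have [e _ [r12]] : exists2 e : F, e != 0 &
    (max_rank t.+2 <= \rank (chain (line_seq l12 e)))%N /\
    (max_rank t <= \rank (chain (line_seq l e)))%N.
  apply: (poly_space_generic2 (e1 := 0) (e2 := 1) (poly_space_chain _ _) (poly_space_chain _ _)).
    by rewrite l12E segment0 // rs.
  by rewrite segment1 // rc.
rewrite l12E in r12; set m := line_seq l e in r12 * => rm.
have m_fam : in_fam m by exact: in_fam_segment.
have sm : size m = t by rewrite size_map size_segment.
have mE : (chain (D1 :: m) :=: chain m)%MS.
  apply/eqmx_sym/eqmx_rank_leq; first exact: (chain_catl B [:: D1] m).
  by rewrite (leq_trans _ rm) // mt -sm -[(size m).+1]/(size (D1 :: m)) max_rank_geq //= D1_fam.
apply: leq_trans r12 _; rewrite -rcons_cons chain_rcons.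
apply: (@leq_trans (\rank (chain (rcons m D2)))).
  by rewrite chain_rcons mxrankS // chain_stepS // mE.
by rewrite -sm -(size_rcons m D2) max_rank_geq // all_rcons /= D2_fam.
Qed.

Lemma max_rank_const t k : max_rank t = max_rank t.+1 -> max_rank (t + k) = max_rank t.
Proof.
move=> mt; suff : max_rank (t + k) = max_rank t /\ max_rank (t + k) = max_rank (t + k).+1 by case.
elim: k => [|k [IH1 IH2]]; first by rewrite addn0.
by rewrite addnS -IH2 IH1; split=> //; rewrite -IH1 IH2; exact: max_rank_stagnates.
Qed.

Lemma chain_cat_maximal t r s : max_rank t = max_rank t.+1 -> in_fam r -> size s = t ->
  in_fam s -> (max_rank t <= \rank (chain s))%N -> (chain (r ++ s) :=: chain s)%MS.
Proof.
move=> mt r_fam st s_fam rs; apply/eqmx_sym/eqmx_rank_leq; first exact: chain_catl.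
apply: leq_trans rs; rewrite -(max_rank_const (size r) mt) -st addnC -size_cat.
by rewrite max_rank_geq // all_cat r_fam.
Qed.

Lemma rank_adds_maximal t s s' : max_rank t = max_rank t.+1 -> maximal t s ->
  maximal t s' -> (\rank (chain s + chain s')%MS <= max_rank t)%N.
Proof.
move=> mt [ss s_fam rs] [ss' s'_fam _]; rewrite leqNgt; apply/negP=> gt_rank.
pose l := segment (nseq t B) s.
have sz_l : size (nseq t B) = size s by rewrite size_nseq ss.
have tail (r : seq 'M[F]_N) : size r = t ->
    poly_space (t + t) (fun e => chain (r ++ line_seq l e)).
  move=> sr; apply: poly_space_eq (poly_space_chain B (const_line r ++ l)).
    by rewrite size_cat size_map sr size_segment // size_nseq.
  by move=> e; rewrite line_seq_cat line_seq_const.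
have [e _ [rl]] : exists2 e : F, e != 0 & (max_rank t <= \rank (chain (line_seq l e)))%N /\
    (max_rank t < \rank (chain (s ++ line_seq l e) + chain (s' ++ line_seq l e))%MS)%N.
  apply: (poly_space_generic2 (e1 := 1) (e2 := 0) (poly_space_chain B l)
            (poly_space_adds (tail _ ss) (tail _ ss'))).
    by rewrite segment1 // rs.
  by rewrite segment0 // (adds_eqmx (chain_cat_nseq _ _ _) (chain_cat_nseq _ _ _)).
have l_fam : in_fam (line_seq l e) by apply: in_fam_segment => //; exact: in_fam_nseq.
have sl : size (line_seq l e) = t by rewrite size_map size_segment ?size_nseq.
rewrite (adds_eqmx (chain_cat_maximal mt s_fam sl l_fam rl)
                   (chain_cat_maximal mt s'_fam sl l_fam rl)).
by rewrite (elimT addsmx_idPl (submx_refl _)) ltnNge -sl max_rank_geq.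
Qed.

Lemma maximal_unique t s s' : max_rank t = max_rank t.+1 -> maximal t s -> maximal t s' ->
  (chain s :=: chain s')%MS.
Proof.
move=> mt ms ms'; have [_ _ rs] := ms; have [_ _ rs'] := ms'.
have le_max := rank_adds_maximal mt ms ms'.
apply: eqmx_trans (eqmx_sym _); last first.
  by apply: (eqmx_rank_leq (addsmxSr (chain s) _)); rewrite rs'.
by apply: (eqmx_rank_leq (addsmxSl _ (chain s'))); rewrite rs.
Qed.

(* For a generic [e], the chain [s] can be prolonged by [B + e (C - B)] as well as by [B]
   without gaining dimension, so both prolongations coincide. *)
Lemma maximal_closed t s : max_rank t = max_rank t.+1 -> maximal t s -> (U <= chain s)%MS.
Proof.
move=> mt [ss s_fam rs]; apply: minU => [|C C_fam]; first exact: kermx_chain.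
have sU := chain_sub s_fam.
have imB D : D \in fam -> (chain s *m D <= B)%MS.
  move=> /famU UD; rewrite (submx_trans (submxMr _ sU)) // (submx_trans UD) //.
  exact: submxMl.
pose l := const_line s ++ [:: (B, C - B)].
have lE e : line_seq l e = rcons s (B + e *: (C - B)).
  by rewrite line_seq_cat line_seq_const cats1.
have rsB : \rank (chain (rcons s B)) = max_rank t by rewrite chain_rcons_id rs.
have [e e0 [re _]] : exists2 e : F, e != 0 &
    (max_rank t <= \rank (chain (line_seq l e)))%N /\
    (max_rank t <= \rank (chain (line_seq l e)))%N.
  apply: (poly_space_generic2 (e1 := 0) (e2 := 0) (poly_space_chain _ _) (poly_space_chain _ _));
    by rewrite lE scale0r addr0 rsB.
have D_fam : B + e *: (C - B) \in fam by exact: fam_line.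
have maxD : maximal t.+1 (rcons s (B + e *: (C - B))).
  have rcons_fam : in_fam (rcons s (B + e *: (C - B))) by rewrite all_rcons /= D_fam.
  split; rewrite ?size_rcons ?ss //; apply/eqP; rewrite eqn_leq -{2}mt -lE re andbT lE.
  by rewrite -ss -(size_rcons s (B + e *: (C - B))) max_rank_geq.
have maxB : maximal t.+1 (rcons s B).
  by split; rewrite ?size_rcons ?ss ?all_rcons /= ?famB // rsB.
apply: (chain_step_line_sub e0); rewrite ?imB // -chain_rcons.
by rewrite (maximal_unique (max_rank_stagnates mt) maxD maxB) chain_rcons_id.
Qed.

Lemma exists_chain_geq : exists s, [/\ size s = N, in_fam s & (U <= chain s)%MS].
Proof.
have [t tN mt] : exists2 t, (t <= N)%N & max_rank t = max_rank t.+1.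
  apply: contrapT => increasing.
  suff : (N.+1 <= max_rank N.+1)%N.
    by have [s [_ _ <-]] := exists_maximal N.+1; rewrite ltnNge rank_leq_col.
  suff : forall k, (k <= N.+1)%N -> (k <= max_rank k)%N by apply.
  elim=> // k IHk kN; apply: leq_ltn_trans (IHk (ltnW kN)) _.
  by rewrite ltn_neqAle max_rankS andbT; apply/eqP=> mk; apply: increasing; exists k.
have mN : max_rank N = max_rank N.+1.
  have := max_rank_const (N - t) mt; have := max_rank_const (N - t).+1 mt.
  by rewrite addnS subnKC // => -> ->.
have [s ms] := exists_maximal N; exists s; have [sN s_fam _] := ms.
by split=> //; exact: maximal_closed mN ms.
Qed.

Fixpoint in_chain (Cs : nat -> 'M[F]_N) s (x : 'cV[F]_N) : Prop :=
  if s is s'.+1 then exists x0, in_chain Cs s' x0 /\ Cs 0 *m x + Cs s *m x0 = 0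
  else Cs 0 *m x = 0.

Lemma in_chainP (Cs : nat -> 'M[F]_N) t : (Cs 0)^T = B ->
  in_fam [seq (Cs s)^T | s <- iota 1 t] ->
  forall v, in_chain Cs t v <-> (v^T <= chain [seq (Cs s)^T | s <- iota 1 t])%MS.
Proof.
move=> BE; elim: t => [_ v|t IHt s_fam v].
  rewrite /= /chain /=; split=> [Bv|/sub_kermxP].
    by apply/sub_kermxP; rewrite -BE -trmx_mul Bv trmx0.
  by rewrite -BE -trmx_mul => /(congr1 trmx); rewrite trmxK trmx0.
rewrite -[t.+1]addn1 iotaD map_cat cats1 addn1 in s_fam *.
rewrite all_rcons in s_fam; case/andP: s_fam => /= C_fam /[dup] s_fam /IHt {}IHt.
rewrite chain_rcons add1n; set K := chain _ in IHt *; set C := (Cs t.+1)^T in C_fam *.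
have sKU : (K <= U)%MS by exact: chain_sub.
have KCB : K *m C *m pinvmx B *m B = K *m C.
  rewrite mulmxKpV // (submx_trans (submxMr _ sKU)) // (submx_trans (famU C_fam)) //.
  exact: submxMl.
have eqE (x : 'cV[F]_N) : Cs 0 *m v + Cs t.+1 *m x = 0 <-> v^T *m B = - (x^T *m C).
  rewrite -BE /C -!trmx_mul; split=> [/eqP|/(congr1 trmx)].
    by rewrite addr_eq0 => /eqP->; rewrite linearN.
  by rewrite linearN /= !trmxK => ->; rewrite addNr.
split=> [[x [/IHt/submxP[D xD] /eqE Bv]]|/sub_addsmxP[[D1 D2] /= vE]].
  rewrite -[v^T](addrK (D *m (K *m C *m pinvmx B))) addmx_sub_adds ?eqmx_opp ?submxMl //.
  by apply/sub_kermxP; rewrite mulmxDl Bv xD -(mulmxA D _ B) KCB (mulmxA D) addNr.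
exists (- (D2 *m K))^T; split; first by apply/IHt; rewrite trmxK eqmx_opp submxMl.
apply/eqE; rewrite trmxK vE mulmxDl -(mulmxA D1) mulmx_ker mulmx0 add0r.
by rewrite -(mulmxA D2) KCB mulNmx opprK mulmxA.
Qed.

End GenericChain.

(** * Random blow-ups *)

Section Draws.
Variables (F : numFieldType) (n m d : nat) (a : 'I_m -> 'M[F]_n).
Hypothesis d0 : (0 < d)%N.
Implicit Types (x y : nat -> F) (k s : nat).
Local Notation N := (n * d)%N.

Definition draw_index s l b b' := (((s * m + l) * d + b) * d + b')%N.

(* Transposed like [a]: the draw at [draw_index s l b b'] is the entry [(b, b')] of the
   coefficient of [A_l] in the [s]-th blow-up. *)
Definition drawn_tuple x s (l : 'I_m) : 'M[F]_d := \matrix_(b', b) x (draw_index s l b b').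

Definition drawn_blowup x s : 'M[F]_N := blowup a (drawn_tuple x s).

Definition position_blowup k s : 'M[F]_N :=
  blowup a (fun l => \matrix_(b', b) (draw_index s l b b' == k)%:R).

Lemma drawn_blowup_upd x k v s :
  drawn_blowup (upd x k v) s = drawn_blowup (upd x k 0) s + v *: position_blowup k s.
Proof.
rewrite /drawn_blowup /position_blowup -blowupZ -blowupD; apply: eq_bigr => l _; congr (_ *t _).
apply/matrixP=> b' b; rewrite !mxE /upd; case: eqP => _.
  by rewrite mulr1 add0r.
by rewrite mulr0 addr0.
Qed.

Lemma ltn_draw_index S s (l : 'I_m) (b b' : 'I_d) :
  (s < S)%N -> (draw_index s l b b' < S * m * d * d)%N.
Proof. by move=> sS; rewrite !ltn_rowmajor. Qed.

Lemma draw_index_geq s l b b' : (s * m * d * d <= draw_index s l b b')%N.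
Proof. by rewrite /draw_index !mulnDl; lia. Qed.

Lemma eq_drawn_blowup x y s : (forall e, (e < s.+1 * m * d * d)%N -> x e = y e) ->
  drawn_blowup x s = drawn_blowup y s.
Proof.
move=> xy; apply: eq_bigr => l _; congr (_ *t _); apply/matrixP=> b' b; rewrite !mxE.
exact/xy/ltn_draw_index.
Qed.

Lemma exists_draws (Y : nat -> 'I_m -> 'M[F]_d) :
  exists y, forall s, drawn_blowup y s = blowup a (Y s).
Proof.
pose y e :=
  if insub (e %/ d %/ d %% m)%N is Some l then
    if insub (e %/ d %% d)%N is Some b then
      if insub (e %% d)%N is Some b' then Y (e %/ d %/ d %/ m)%N l b' b else 0
    else 0
  else 0.
exists y => s; apply: eq_bigr => l _; congr (_ *t _); apply/matrixP=> b' b.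
by rewrite mxE /y /draw_index !(divn_rowmajor, modn_rowmajor) ?ltn_ord // !valK.
Qed.

Definition blowup_family : {pred 'M[F]_N} :=
  [pred C | `[< exists X : 'I_m -> 'M[F]_d, C = blowup a X >]].

Lemma blowup_in_family (X : 'I_m -> 'M[F]_d) : blowup a X \in blowup_family.
Proof. by apply/asboolP; exists X. Qed.

Lemma blowup_family_line c C D :
  C \in blowup_family -> D \in blowup_family -> C + c *: (D - C) \in blowup_family.
Proof.
move=> /asboolP[Y ->] /asboolP[Z ->].
apply/asboolP; exists (fun t => Y t + c *: (Z t + -1 *: Y t)).
by rewrite blowupD blowupZ blowupD blowupZ scaleN1r.
Qed.

Section GoodDraws.
Variables (r : nat) (U : 'M[F]_n).
Hypotheses (rP : row_ncrank a r) (minU : row_min_shrunk a (n - r) U).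

Definition drawn_chain x := chain (drawn_blowup x 0) [seq drawn_blowup x s | s <- iota 1 N].

Definition good_draws x :=
  \rank (drawn_blowup x 0) = (r * d)%N /\ (\rank U * d <= \rank (drawn_chain x))%N.

Definition completable k x := exists2 y, forall e, (e < k)%N -> y e = x e & good_draws y.

Lemma eq_good_draws x y :
  (forall e, (e < N.+1 * m * d * d)%N -> x e = y e) -> good_draws x -> good_draws y.
Proof.
move=> xy; have eq_blowup s : (s <= N)%N -> drawn_blowup x s = drawn_blowup y s.
  move=> sN; apply: eq_drawn_blowup => e es; apply: xy; apply: leq_trans es _.
  by rewrite !leq_mul2r ltnS sN !orbT.
rewrite /good_draws /drawn_chain eq_blowup //.
suff -> : [seq drawn_blowup x s | s <- iota 1 N] = [seq drawn_blowup y s | s <- iota 1 N] by [].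
by apply/eq_in_map => s; rewrite mem_iota => /andP[_ sN]; apply: eq_blowup; lia.
Qed.

Lemma minimal_closed x : \rank (drawn_blowup x 0) = (r * d)%N ->
  [/\ (kermx (drawn_blowup x 0) <= U *t (1%:M : 'M[F]_d))%MS,
      {in blowup_family, forall C, U *t (1%:M : 'M[F]_d) *m C <=
                                   U *t (1%:M : 'M[F]_d) *m drawn_blowup x 0}%MS &
      forall K : 'M[F]_N, (kermx (drawn_blowup x 0) <= K)%MS ->
        {in blowup_family, forall C, K *m C <= K *m drawn_blowup x 0}%MS ->
        (U *t (1%:M : 'M[F]_d) <= K)%MS].
Proof.
move=> rB; have [[kU cU] mU] := row_min_shrunk_closed d0 rP rB minU.
split=> // [C /asboolP[Y ->]|K kK cK]; first exact: cU.
by apply: mU; split=> // X; apply/cK/blowup_in_family.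
Qed.

Lemma exists_good_completion x : \rank (drawn_blowup x 0) = (r * d)%N ->
  completable (m * d * d) x.
Proof.
move=> rB; have [kU cU mU] := minimal_closed rB.
have [s [sN s_fam Us]] :=
  exists_chain_geq (blowup_in_family _) blowup_family_line kU cU mU.
have /boolp.choice[Y YE] : forall k, exists Y : 'I_m -> 'M[F]_d,
    (k < N)%N -> nth 0 s k = blowup a Y.
  move=> k; have [kN|_] := ltnP k N; last by exists (fun=> 0).
  by have /allP/(_ (nth 0 s k)) := s_fam; rewrite mem_nth ?sN // => /(_ isT)/asboolP[Y]; exists Y.
have [y0 y0E] := exists_draws (fun s => Y s.-1).
pose y e := if (e < m * d * d)%N then x e else y0 e.
have yx e : (e < m * d * d)%N -> y e = x e by rewrite /y => ->.
have yB : drawn_blowup y 0 = drawn_blowup x 0.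
  by apply: eq_drawn_blowup => e; rewrite mul1n => /yx.
have yS t : drawn_blowup y t.+1 = blowup a (Y t).
  rewrite -[Y t]/(Y t.+1.-1) -y0E; apply: eq_bigr => l _; congr (_ *t _).
  apply/matrixP=> b' b; rewrite !mxE /y ltnNge (leq_trans _ (draw_index_geq _ _ _ _)) //.
  by rewrite !leq_mul2r leq_pmull ?orbT.
exists y => //; split; first by rewrite yB.
rewrite /drawn_chain yB -rank_tens1.
suff -> : [seq drawn_blowup y t | t <- iota 1 N] = s by exact: mxrankS.
apply: (@eq_from_nth _ 0); rewrite size_map size_iota ?sN // => k kN.
by rewrite (nth_map 0%N) ?size_iota // nth_iota // add1n yS YE.
Qed.

Lemma completable0 x :
  (exists X : 'I_m -> 'M[F]_d, \rank (blowup a X) = (r * d)%N) -> completable 0 x.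
Proof.
case=> X rX; have [x0 x0E] := exists_draws (fun=> X).
have [|y _ gy] := @exists_good_completion x0; first by rewrite x0E.
by exists y.
Qed.

Lemma completable_good x : completable (N.+1 * m * d * d) x -> good_draws x.
Proof. by case=> y yx; exact: eq_good_draws. Qed.

Lemma completable_upd k x y v : (forall e, (e < k)%N -> y e = x e) ->
  completable k.+1 (upd y k v) -> completable k.+1 (upd x k v).
Proof.
move=> yx [z zy gz]; exists z => // e ek; rewrite zy // /upd; case: eqP => // /eqP ne.
by apply: yx; rewrite ltn_neqAle ne.
Qed.

(* Keeping the numbers before position [k], those at [k] which admit no good completion
   are roots of a nonzero polynomial of degree at most [N ^ 2]: a minor of the first
   blow-up or of the chain. *)
Lemma card_not_completable_base k x E : (k < m * d * d)%N -> good_draws x ->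
  (#|[pred j : 'I_E | ~~ `[< completable k.+1 (upd x k (nat_of_ord j)%:R) >]]| <= N * N)%N.
Proof.
move=> kB [rB _]; have updx : upd x k (x k) = x by apply/funext=> e; rewrite /upd;
  case: eqP => [->|].
have [|p [p0 sp] pB] := @poly_space_rank F _ _ _ _ (x k) (r * d)
    (poly_space_affine (drawn_blowup (upd x k 0) 0) (position_blowup k 0)).
  by rewrite -drawn_blowup_upd updx rB.
apply: (@card_exceptions_leq _ p (fun j => completable k.+1 (upd x k j%:R))) => // [|j /pB].
  rewrite (leq_trans sp) // ltnS muln1 (@leq_trans N) ?leq_mul2r ?(row_ncrank_leq rP) ?orbT //.
  by have [->|N0] := posnP N; rewrite // leq_pmulr.
rewrite -drawn_blowup_upd => rj.
have [|y yx gy] := @exists_good_completion (upd x k j%:R).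
  by apply/eqP; rewrite eqn_leq rj andbT rank_blowup_leq.
by exists y => // e ek; rewrite yx // (leq_trans ek).
Qed.

Lemma card_not_completable_chain k x E : (m * d * d <= k)%N -> good_draws x ->
  (#|[pred j : 'I_E | ~~ `[< completable k.+1 (upd x k (nat_of_ord j)%:R) >]]| <= N * N)%N.
Proof.
move=> kB [rB rC]; have updx : upd x k (x k) = x by apply/funext=> e; rewrite /upd;
  case: eqP => [->|].
pose l := [seq (drawn_blowup (upd x k 0) s, position_blowup k s) | s <- iota 1 N].
have lE v : line_seq l v = [seq drawn_blowup (upd x k v) s | s <- iota 1 N].
  by rewrite /line_seq -map_comp; apply: eq_map => s /=; rewrite -drawn_blowup_upd.
have base v : drawn_blowup (upd x k v) 0 = drawn_blowup x 0.
  by apply: eq_drawn_blowup => e; rewrite mul1n /upd => eB; rewrite ltn_eqF // (leq_trans eB).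
have [|p [p0 sp] pC] := @poly_space_rank F _ _ _ _ (x k) (\rank U * d)
    (poly_space_chain (drawn_blowup x 0) l).
  by rewrite lE updx.
apply: (@card_exceptions_leq _ p (fun j => completable k.+1 (upd x k j%:R))) => // [|j /pC].
  rewrite (leq_trans sp) // ltnS size_map size_iota !leq_mul2r rank_leq_col.
  by rewrite !orbT.
by rewrite lE => rj; exists (upd x k j%:R) => //; split; rewrite /drawn_chain base.
Qed.

Lemma card_not_completable k x E : completable k x ->
  (#|[pred j : 'I_E | ~~ `[< completable k.+1 (upd x k (nat_of_ord j)%:R) >]]| <= N * N)%N.
Proof.
case=> y yx gy; apply: (@leq_trans
    #|[pred j : 'I_E | ~~ `[< completable k.+1 (upd y k (nat_of_ord j)%:R) >]]|).
  apply: subset_leq_card; apply/fintype.subsetP=> j; rewrite !inE; apply: contra => /asboolP cy.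
  by apply/asboolP; exact: completable_upd cy.
have [kB|kB] := ltnP k (m * d * d).
  exact: card_not_completable_base.
exact: card_not_completable_chain.
Qed.

Lemma in_chain_good_draws x Cs : (forall s, (s <= N)%N -> (Cs s)^T = drawn_blowup x s) ->
  good_draws x -> forall v, in_chain Cs N v <-> (v^T <= U *t (1%:M : 'M[F]_d))%MS.
Proof.
move=> CsE [rB rC] v; have [kU cU mU] := minimal_closed rB.
have seqE : [seq (Cs s)^T | s <- iota 1 N] = [seq drawn_blowup x s | s <- iota 1 N].
  by apply/eq_in_map=> s; rewrite mem_iota => /andP[_ sN]; apply: CsE; lia.
have s_fam : all [in blowup_family] [seq drawn_blowup x s | s <- iota 1 N].
  by apply/allP=> _ /mapP[s _ ->]; exact: blowup_in_family.
rewrite (in_chainP kU cU); [rewrite seqE|exact: CsE|by rewrite seqE].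
have -> // : (chain (drawn_blowup x 0) [seq drawn_blowup x s | s <- iota 1 N]
              :=: U *t (1%:M : 'M[F]_d))%MS.
apply: eqmx_rank_leq; last by rewrite rank_tens1.
exact: chain_sub kU cU _ s_fam.
Qed.

End GoodDraws.

End Draws.

(** * Random trees *)

Section RandomTrees.
Variables S T : Type.
Implicit Types (t : rtree S) (E P : S -> Prop).

Lemma alwaysT t : always t (fun=> True).
Proof. by elim: t. Qed.

Lemma always_rbind t (g : S -> rtree T) (E : T -> Prop) :
  always t (fun s => always (g s) E) -> always (rbind t g) E.
Proof. by elim: t => //= m f IH fE j; apply: IH. Qed.

Lemma always_mono t E P : (forall s, E s -> P s) -> always t E -> always t P.
Proof. by move=> EP; elim: t => [s /EP|m f IH fE j] //=; apply: IH. Qed.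

Lemma always_and t E P : always t E -> always t P -> always t (fun s => E s /\ P s).
Proof. by elim: t => //= m f IH fE fP j; apply: IH. Qed.

Lemma prob_ge0 t E : 0 <= prob t E.
Proof.
elim: t => [s|m f IH] /=; first by rewrite ler0n.
by rewrite divr_ge0 ?ler0n // sumr_ge0.
Qed.

Lemma le_prob t E E' P : always t P -> (forall s, P s -> E s -> E' s) ->
  prob t E <= prob t E'.
Proof.
move=> + PEE'; elim: t => [s /PEE' EE'|m f IH always_f] /=.
  by rewrite ler_nat; case: asboolP => // /EE' E's; rewrite asboolT.
by rewrite ler_pM2r ?invr_gt0 ?ltr0n //; apply: ler_sum => j _; apply: IH.
Qed.

Lemma le_average m (f : 'I_m.+1 -> rat) q : (forall j, q <= f j) ->
  q <= (\sum_(j < m.+1) f j) / m.+1%:R.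
Proof.
move=> qf; rewrite ler_pdivlMr ?ltr0n //.
have -> : q * m.+1%:R = \sum_(j < m.+1) q by rewrite sumr_const card_ord mulr_natr.
exact: ler_sum.
Qed.

Lemma prob_always t E : always t E -> 1 <= prob t E.
Proof.
elim: t => [s Es|m f IH always_f] /=; first by rewrite asboolT.
by apply: le_average => j; apply: IH.
Qed.

Lemma prob_rbind_always t (g : S -> rtree T) P (E : T -> Prop) q :
  always t P -> (forall s, P s -> q <= prob (g s) E) -> q <= prob (rbind t g) E.
Proof.
by move=> + qE; elim: t => [s /qE|m f IH always_f] //=; apply: le_average => j; apply: IH.
Qed.

Lemma prob_draw m (f : 'I_m.+1 -> S) E b :
  (#|[pred j : 'I_m.+1 | ~~ `[< E (f j) >]]| <= b)%N ->
  1 - b%:R / m.+1%:R <= prob (Draw (fun j => Done (f j))) E.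
Proof.
move=> bad_le /=; rewrite -natr_sum.
have -> : (\sum_(j < m.+1) `[< E (f j) >])%N = #|[pred j : 'I_m.+1 | `[< E (f j) >]]|.
  by rewrite -sum1_card [RHS]big_mkcond; apply: eq_bigr => j _; rewrite inE; case: ifP.
have := cardC [pred j : 'I_m.+1 | `[< E (f j) >]]; rewrite card_ord => cE.
rewrite ler_pdivlMr ?ltr0n // mulrBl mul1r divfK ?pnatr_eq0 // lerBlDr -natrD ler_nat.
apply: leq_trans (eq_leq (esym cE)) _; rewrite leq_add2l; apply: leq_trans bad_le.
by rewrite subset_leq_card //; apply/fintype.subsetP=> j; rewrite !inE.
Qed.

End RandomTrees.

Lemma prob_rbind_ge S T (t : rtree S) (g : S -> rtree T) P E eps : 0 <= eps ->
  (forall s, P s -> 1 - eps <= prob (g s) E) -> prob t P - eps <= prob (rbind t g) E.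
Proof.
move=> eps0 gE; elim: t => [s|m f IH] /=.
  case: asboolP => [/gE //|_]; rewrite sub0r.
  by apply: le_trans (prob_ge0 _ _); rewrite oppr_le0.
have -> : (\sum_(j < m.+1) prob (f j) P) / m.+1%:R - eps =
    (\sum_(j < m.+1) (prob (f j) P - eps)) / m.+1%:R.
  rewrite sumrB sumr_const card_ord mulrBl; congr (_ - _).
  by rewrite -[eps *+ _]mulr_natr mulfK ?pnatr_eq0.
by rewrite ler_pM2r ?invr_gt0 ?ltr0n //; apply: ler_sum.
Qed.

Section Loops.
Variables (S : Type) (n : nat) (f : nat -> S -> rtree S) (I : nat -> S -> Prop) (s : S).
Local Notation loop k := (iteri k (fun j t => rbind t (f j)) (Done s)).
Hypothesis I0 : I 0 s.

Lemma always_iteri : (forall j s', (j < n)%N -> I j s' -> always (f j s') (I j.+1)) ->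
  always (loop n) (I n).
Proof.
elim: n => [|k IHk] If //=; apply: always_rbind.
apply: always_mono (IHk _) => [s' Is'|j s' jk]; first exact: If.
by apply: If; rewrite ltnS ltnW.
Qed.

Lemma prob_iteri eps : 0 <= eps ->
  (forall j s', (j < n)%N -> I j s' -> 1 - eps <= prob (f j s') (I j.+1)) ->
  1 - n%:R * eps <= prob (loop n) (I n).
Proof.
move=> eps0; elim: n => [|k IHk] If /=; first by rewrite mul0r subr0 asboolT.
apply: le_trans (prob_rbind_ge (loop k) eps0 (fun s' => If k s' (ltnSn k))).
rewrite -natr1 mulrDl mul1r opprD addrA lerD2r.
by apply: IHk => j s' jk; apply: If; rewrite ltnS ltnW.
Qed.

End Loops.

(** * Frames, costs and stored values *)

Section Frames.
Variable R : realType.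
Local Notation st := (state R[i]).
Implicit Types (s : st) (c : cmd).

Fixpoint assigned_iregs c : seq nat :=
  match c with
  | Seq c1 c2 | IfZero _ c1 c2 | IfLe _ _ c1 c2 => assigned_iregs c1 ++ assigned_iregs c2
  | ISet x _ => [:: x]
  | For v _ c => v :: assigned_iregs c
  | _ => [::]
  end.

Fixpoint assigned_sregs c : seq nat :=
  match c with
  | Seq c1 c2 | IfZero _ c1 c2 | IfLe _ _ c1 c2 => assigned_sregs c1 ++ assigned_sregs c2
  | SCst x _ _ | SOp _ x _ _ | SConj x _ | Fetch x _ _ | Rand x _ => [:: x]
  | For _ _ c => assigned_sregs c
  | _ => [::]
  end.

Fixpoint assigned_arrs c : seq nat :=
  match c with
  | Seq c1 c2 | IfZero _ c1 c2 | IfLe _ _ c1 c2 => assigned_arrs c1 ++ assigned_arrs c2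
  | Store a _ _ => [:: a]
  | For _ _ c => assigned_arrs c
  | _ => [::]
  end.

Definition frame c s s' :=
  [/\ forall x, x \notin assigned_iregs c -> ireg s' x = ireg s x,
      forall x, x \notin assigned_sregs c -> sreg s' x = sreg s x &
      forall a, a \notin assigned_arrs c -> arr s' a = arr s a].

Lemma frame_trans c s1 s2 s3 : frame c s1 s2 -> frame c s2 s3 -> frame c s1 s3.
Proof.
by move=> [i1 r1 a1] [i2 r2 a2]; split=> x xc; rewrite ?i2 ?r2 ?a2 ?i1 ?r1 ?a1.
Qed.

Lemma frame_sub c c' s s' :
  {subset assigned_iregs c <= assigned_iregs c'} ->
  {subset assigned_sregs c <= assigned_sregs c'} ->
  {subset assigned_arrs c <= assigned_arrs c'} -> frame c s s' -> frame c' s s'.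
Proof.
by move=> ic rc ac [i1 r1 a1]; split=> x xc; [apply: i1|apply: r1|apply: a1];
  apply: contra xc; [apply: ic|apply: rc|apply: ac].
Qed.

Lemma frame_seql c1 c2 s s' : frame c1 s s' -> frame (Seq c1 c2) s s'.
Proof. by apply: frame_sub; apply/mem_subseq/prefix_subseq. Qed.

Lemma frame_seqr c1 c2 s s' : frame c2 s s' -> frame (Seq c1 c2) s s'.
Proof. by apply: frame_sub; apply/mem_subseq/suffix_subseq. Qed.

Lemma frame_for v e c s s1 s2 j : frame (For v e c) s s1 ->
  frame c (tick 1 (set_ireg s1 v j)) s2 -> frame (For v e c) s s2.
Proof.
move=> fs1 [i2 r2 a2]; apply: frame_trans fs1 _; split=> //= x.
by rewrite inE negb_or => /andP[xv /i2->]; rewrite /= /upd (negPf xv).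
Qed.

Lemma exec_frame c s : always (exec c s) (frame c s).
Proof.
have updN (T : Type) (f : nat -> T) x v y : y \notin [:: x] -> upd f x v y = f y.
  by rewrite inE /upd => /negPf->.
elim: c s => //=; try by move=> *; split=> //= ? ?; rewrite ?updN.
- move=> c1 IH1 c2 IH2 s; apply: always_rbind.
  apply: always_mono (IH1 s) => s1 f1; apply: always_mono (IH2 s1) => s2 f2.
  exact: frame_trans (frame_seql c2 f1) (frame_seqr c1 f2).
- move=> x c1 IH1 c2 IH2 s; case: ifP => _.
    by apply: always_mono (IH1 _) => s1; exact: (@frame_seql c1 c2).
  by apply: always_mono (IH2 _) => s1; exact: (@frame_seqr c1 c2).
- move=> e1 e2 c1 IH1 c2 IH2 s; case: ifP => _.
    by apply: always_mono (IH1 _) => s1; exact: (@frame_seql c1 c2).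
  by apply: always_mono (IH2 _) => s1; exact: (@frame_seqr c1 c2).
- move=> v e c IH s; apply: (always_iteri (I := fun=> frame (For v e c) s)) => // j s' _ fs'.
  by apply: always_mono (IH _) => s1; exact: frame_for fs'.
Qed.

Lemma exec_seq c1 c2 s Q :
  always (exec c1 s) (fun s1 => frame c1 s s1 -> always (exec c2 s1) Q) ->
  always (exec (Seq c1 c2) s) Q.
Proof.
move=> Q2; apply: always_rbind.
by apply: always_mono (always_and Q2 (exec_frame c1 s)) => s1 []; apply.
Qed.

Lemma exec_step c1 c2 s s1 Q :
  exec c1 s = Done s1 -> always (exec c2 s1) Q -> always (exec (Seq c1 c2) s) Q.
Proof. by move=> /= ->. Qed.

Lemma exec_last c s s1 Q : exec c s = Done s1 -> Q s1 -> always (exec c s) Q.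
Proof. by move=> ->. Qed.

Lemma exec_rand x e c s Q :
  (forall j : nat, (j <= ieval (ireg s) e)%N ->
     always (exec c (tick 1 (set_sreg s x j%:R))) Q) ->
  always (exec (Seq (Rand x e) c) s) Q.
Proof. by move=> Qc j; apply: Qc; rewrite -ltnS; exact: ltn_ord. Qed.

Lemma exec_ifzero x c1 c2 s Q :
  (sreg s x = 0 -> always (exec c1 (tick 2 s)) Q) ->
  (sreg s x != 0 -> always (exec c2 (tick 2 s)) Q) -> always (exec (IfZero x c1 c2) s) Q.
Proof. by move=> Q1 Q2 /=; case: eqVneq => [/Q1|/Q2]. Qed.

Lemma exec_ifle e1 e2 c1 c2 s Q :
  ((ieval (ireg s) e1 <= ieval (ireg s) e2)%N -> always (exec c1 (tick 1 s)) Q) ->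
  ((ieval (ireg s) e2 < ieval (ireg s) e1)%N -> always (exec c2 (tick 1 s)) Q) ->
  always (exec (IfLe e1 e2 c1 c2) s) Q.
Proof. by move=> Q1 Q2 /=; case: leqP => [/Q1|/Q2]. Qed.

Lemma exec_for v e c s n (I : nat -> st -> Prop) : ieval (ireg s) e = n ->
  I 0%N (tick 1 s) ->
  (forall j s', (j < n)%N -> frame (For v e c) s s' -> I j s' ->
     always (exec c (tick 1 (set_ireg s' v j))) (I j.+1)) ->
  always (exec (For v e c) s) (fun s' => frame (For v e c) s s' /\ I n s').
Proof.
move=> <- I0 IS.
apply: (always_iteri (I := fun j s' => frame (For v e c) s s' /\ I j s')) => // j s' jn [fs' Is'].
apply: always_and; last exact: IS.
by apply: always_mono (exec_frame _ _) => s1; exact: frame_for fs'.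
Qed.

Lemma prob_for v e c s n (I : nat -> st -> Prop) eps : ieval (ireg s) e = n -> 0 <= eps ->
  I 0%N (tick 1 s) ->
  (forall j s', (j < n)%N -> frame (For v e c) s s' -> I j s' ->
     1 - eps <= prob (exec c (tick 1 (set_ireg s' v j))) (I j.+1)) ->
  1 - n%:R * eps <= prob (exec (For v e c) s) (I n).
Proof.
move=> <- eps0 I0 IS; pose I' j s' := frame (For v e c) s s' /\ I j s'.
have I'0 : I' 0%N (tick 1 s) by [].
apply: le_trans (prob_iteri I'0 eps0 _) (le_prob (alwaysT _) _) => [j s' jn [fs' Is']|s' _ []] //.
apply: le_trans (IS j s' jn fs' Is') (le_prob (exec_frame _ _) _) => s1 fs1 Is1; split=> //.
exact: frame_for fs' fs1.
Qed.

Fixpoint evars (e : iexp) : seq nat :=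
  match e with
  | IVar x => [:: x]
  | ICst _ => [::]
  | IAdd e1 e2 | ISub e1 e2 | IMul e1 e2 => evars e1 ++ evars e2
  end.

Fixpoint loop_vars c : seq nat :=
  match c with
  | Seq c1 c2 | IfZero _ c1 c2 | IfLe _ _ c1 c2 => loop_vars c1 ++ loop_vars c2
  | For _ e c => evars e ++ loop_vars c
  | _ => [::]
  end.

Fixpoint cost_bound (r : nat -> nat) c : nat :=
  match c with
  | Skip => 0
  | Seq c1 c2 => cost_bound r c1 + cost_bound r c2
  | SOp o _ _ _ => sop_cost o
  | IfZero _ c1 c2 => 2 + (cost_bound r c1 + cost_bound r c2)
  | IfLe _ _ c1 c2 => 1 + (cost_bound r c1 + cost_bound r c2)
  | For _ e c => 1 + ieval r e * (1 + cost_bound r c)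
  | _ => 1
  end.

Lemma eq_ieval (r r' : nat -> nat) e : {in evars e, r =1 r'} -> ieval r e = ieval r' e.
Proof.
elim: e => //= [x rr'|e1 IH1 e2 IH2 rr'|e1 IH1 e2 IH2 rr'|e1 IH1 e2 IH2 rr'];
  first by apply: rr'; rewrite inE.
all: by rewrite IH1 ?IH2 // => x xe; apply: rr'; rewrite mem_cat xe ?orbT.
Qed.

Definition unassigned (xs : seq nat) c := all [predC assigned_iregs c] xs.

Lemma unassigned_seq c1 c2 :
  unassigned (loop_vars (Seq c1 c2)) (Seq c1 c2) ->
  [/\ unassigned (loop_vars c1) c1, unassigned (loop_vars c2) c2 &
      unassigned (loop_vars c2) c1].
Proof.
rewrite /unassigned all_cat => /andP[/allP u1 /allP u2]; split; apply/allP=> x xc.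
- by have := u1 _ xc; rewrite !inE mem_cat negb_or => /andP[].
- by have := u2 _ xc; rewrite !inE mem_cat negb_or => /andP[].
- by have := u2 _ xc; rewrite !inE mem_cat negb_or => /andP[].
Qed.

Lemma in_loop_vars_seq c1 c2 (r r' : nat -> nat) :
  {in loop_vars (Seq c1 c2), r =1 r'} <->
  {in loop_vars c1, r =1 r'} /\ {in loop_vars c2, r =1 r'}.
Proof.
split=> [rr'|[r1 r2] x]; last by rewrite mem_cat => /orP[/r1|/r2].
by split=> x xc; apply: rr'; rewrite mem_cat xc ?orbT.
Qed.

Lemma exec_cost_bound c (r : nat -> nat) s :
  unassigned (loop_vars c) c -> {in loop_vars c, ireg s =1 r} ->
  always (exec c s) (fun s' => (cost s' <= cost_bound r c + cost s)%N).
Proof.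
elim: c s => //=.
- move=> c1 IH1 c2 IH2 s /unassigned_seq[u1 u2 u21] /in_loop_vars_seq[r1 r2].
  apply: always_rbind; apply: always_mono (always_and (IH1 s u1 r1) (exec_frame c1 s)).
  move=> s1 [cs1 [i1 _ _]]; apply: always_mono (IH2 s1 u2 _) => [s2|x xc]; first by lia.
  by rewrite i1 ?r2 //; exact: (allP u21).
- move=> x c1 IH1 c2 IH2 s /unassigned_seq[u1 u2 _] /in_loop_vars_seq[r1 r2].
  by case: ifP => _; [apply: always_mono (IH1 (tick 2 s) u1 r1)
                     |apply: always_mono (IH2 (tick 2 s) u2 r2)] => s1 /=; lia.
- move=> e1 e2 c1 IH1 c2 IH2 s /unassigned_seq[u1 u2 _] /in_loop_vars_seq[r1 r2].
  by case: ifP => _; [apply: always_mono (IH1 (tick 1 s) u1 r1)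
                     |apply: always_mono (IH2 (tick 1 s) u2 r2)] => s1 /=; lia.
move=> v e c IH s u rs; have eE : ieval (ireg s) e = ieval r e.
  by apply: eq_ieval => x xe; apply: rs; rewrite mem_cat xe.
have u' x : x \in loop_vars c -> (x != v) && (x \notin assigned_iregs c).
  by move=> xc; have /allP/(_ x) := u; rewrite mem_cat xc orbT !inE negb_or; apply.
pose I j s' := (cost s' <= 1 + j * (1 + cost_bound r c) + cost s)%N.
apply: always_mono (@exec_for v e c s _ I eE _ _) => [s' []//||j s' jn [i1 _ _] cs'].
  by rewrite /I mul0n addn0.
apply: always_mono (IH (tick 1 (set_ireg s' v j)) _ _) => [s1|//|x xc].
- by move: cs'; rewrite /I /= mulSn; lia.
- by apply/allP=> x /u'/andP[].
have /andP[xv xc'] := u' _ xc; rewrite /= /upd (negPf xv) i1 /= ?inE ?negb_or ?xv //.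
by apply: rs; rewrite mem_cat xc orbT.
Qed.

Definition archived s s' :=
  {subset stored s <= stored s'} /\
  forall a e, arr s' a e \in stored s' \/ arr s' a e = arr s a e.

Lemma archived_trans s1 s2 s3 : archived s1 s2 -> archived s2 s3 -> archived s1 s3.
Proof.
move=> [sub12 arr12] [sub23 arr23]; split=> [z /sub12/sub23//|a e].
by case: (arr23 a e) => [|->]; [left|case: (arr12 a e) => [/sub23|->]; [left|right]].
Qed.

Lemma eq_archived s s1 s2 : arr s1 = arr s -> stored s1 = stored s ->
  archived s1 s2 -> archived s s2.
Proof. by move=> ea es [sub12 arr12]; split=> [z|a e]; rewrite -?es -?ea;
  [apply: sub12|apply: arr12]. Qed.

Lemma exec_archived c s : always (exec c s) (archived s).
Proof.
elim: c s => //=; try by move=> *; split=> //= *; right.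
- move=> c1 IH1 c2 IH2 s; apply: always_rbind.
  apply: always_mono (IH1 s) => s1 arch1; apply: always_mono (IH2 s1) => s2.
  exact: archived_trans.
- move=> a e x s; split=> [z zs|a' e'] /=; first by rewrite inE zs orbT.
  rewrite /upd; case: eqP => [->|_]; last by right.
  by case: eqP => [_|_]; [left; rewrite inE eqxx|right].
- by move=> x c1 IH1 c2 IH2 s; case: ifP => _;
    [apply: always_mono (IH1 _)|apply: always_mono (IH2 _)] => s1; exact: eq_archived.
- by move=> e1 e2 c1 IH1 c2 IH2 s; case: ifP => _;
    [apply: always_mono (IH1 _)|apply: always_mono (IH2 _)] => s1; exact: eq_archived.
- move=> v e c IH s.
  apply: (always_iteri (I := fun=> archived s)) => [|j s' _ arch'].
    by split=> //= *; right.
  by apply: always_mono (IH _) => s1 arch1; apply: archived_trans arch' _; apply: eq_archived arch1.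
Qed.

End Frames.

(** ** Loops filling an array *)

Section Fill.
Variables (R : realType) (ok : {pred R[i]}).
Local Notation F := R[i].
Local Notation st := (state F).
Implicit Types (s : st) (c : cmd).

Definition stored_ok s := {subset stored s <= ok}.

Lemma stored_ok_store s a e v : stored_ok s -> v \in ok -> stored_ok (store s a e v).
Proof. by move=> oks okv z; rewrite inE => /predU1P[->|/oks]. Qed.

Definition fill (addr : nat -> nat) (val : nat -> F) k (f : nat -> F) : nat -> F :=
  iteri k (fun j g => upd g (addr j) (val j)) f.

Lemma fill_notin addr val k f x :
  (forall j, (j < k)%N -> addr j != x) -> fill addr val k f x = f x.
Proof.
elim: k => //= k IHk ne; rewrite /upd eq_sym (negPf (ne _ _)) // IHk // => j jk.
by rewrite ne // ltnS ltnW.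
Qed.

Lemma fill_in addr val k f j :
  injective addr -> (j < k)%N -> fill addr val k f (addr j) = val j.
Proof.
move=> addrI; elim: k => //= k IHk; rewrite ltnS leq_eqVlt /upd (inj_eq addrI).
by case: eqP => [->//|_] /=; exact: IHk.
Qed.

Lemma fill_id val k f j : fill id val k f j = if (j < k)%N then val j else f j.
Proof.
case: ltnP => [jk|kj]; first exact: (@fill_in id).
by apply: fill_notin => i ik; rewrite ltn_eqF // (leq_trans ik).
Qed.

Definition filled a addr val f k s := stored_ok s /\ arr s a = fill addr val k f.

Lemma exec_store_fill a e x addr val f k s : filled a addr val f k s ->
  sreg s x = val k -> ieval (ireg s) e = addr k -> val k \in ok ->
  always (exec (Store a e x) s) (filled a addr val f k.+1).
Proof.
move=> [oks aE] xE eE okv; split; first by apply: stored_ok_store; rewrite ?xE.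
by rewrite /= /upd eqxx aE xE eE.
Qed.

Lemma exec_for_fill v e c a addr val f k0 l n s : ieval (ireg s) e = n ->
  filled a addr val f k0 s ->
  (forall k s', (k < n)%N -> frame (For v e c) s s' ->
     filled a addr val f (k0 + k * l) s' ->
     always (exec c (tick 1 (set_ireg s' v k))) (filled a addr val f (k0 + k * l + l))) ->
  always (exec (For v e c) s) (filled a addr val f (k0 + n * l)).
Proof.
move=> eE fs IS; pose I k s' := filled a addr val f (k0 + k * l) s'.
apply: always_mono (@exec_for _ v e c s n I eE _ _) => [s' []//||k s' kn fr Is'].
  by rewrite /I addn0.
by rewrite /I mulSn [(l + _)%N]addnC addnA; exact: IS.
Qed.

Lemma exec_for2_fill v1 e1 v2 e2 c a addr val f k0 l n1 n2 s
    (nest := For v1 e1 (For v2 e2 c)) :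
  ieval (ireg s) e1 = n1 -> ieval (ireg s) e2 = n2 -> unassigned (evars e2) nest ->
  v1 \notin assigned_iregs (For v2 e2 c) -> filled a addr val f k0 s ->
  (forall k1 k2 s', (k1 < n1)%N -> (k2 < n2)%N -> frame nest s s' -> ireg s' v1 = k1 ->
     filled a addr val f (k0 + (k1 * n2 + k2) * l) s' ->
     always (exec c (tick 1 (set_ireg s' v2 k2)))
       (filled a addr val f (k0 + (k1 * n2 + k2) * l + l))) ->
  always (exec nest s) (filled a addr val f (k0 + n1 * n2 * l)).
Proof.
move=> n1E n2E e2_fixed v1_fixed fs IS; rewrite -mulnA.
apply: exec_for_fill => // k1 s1 k1n fr1 fs1; set s1' := tick 1 _.
apply: exec_for_fill => // [|k2 s2 k2n fr2 fs2].
  rewrite -n2E; apply: eq_ieval => x xe; have /allP/(_ x xe) := e2_fixed; rewrite inE /= => xN.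
  have [f1 _ _] := fr1; rewrite /s1' /= /upd f1 //.
  by case: eqP xN => // ->; rewrite inE eqxx.
have kE : (k0 + k1 * (n2 * l) + k2 * l = k0 + (k1 * n2 + k2) * l)%N by lia.
rewrite kE in fs2 *; have [f1 _ _] := fr2; apply: IS => //.
- exact: frame_for fr1 fr2.
- by rewrite f1 // /s1' /= /upd eqxx.
Qed.

Lemma exec_for_fill1 v e c a addr val f k0 n s : ieval (ireg s) e = n ->
  filled a addr val f k0 s ->
  (forall k s', (k < n)%N -> frame (For v e c) s s' -> filled a addr val f (k0 + k) s' ->
     always (exec c (tick 1 (set_ireg s' v k))) (filled a addr val f (k0 + k).+1)) ->
  always (exec (For v e c) s) (filled a addr val f (k0 + n)).
Proof.
move=> eE fs IS; rewrite -[n]muln1; apply: exec_for_fill => // k s' kn.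
by rewrite muln1 addn1; exact: IS.
Qed.

End Fill.

(** * The program *)

(* [reg_W] is the width of the window, [reg_sel] the number of selected matrices [A'_l],
   [reg_out] that of the output vectors and [reg_piv] the pivot of the last insertion;
   [reg_n], [reg_p], [reg_d], [reg_out], [arr_in] and [arr_out] are prescribed by
   [input] and [output].
   [arr_row] holds the row being inserted, [arr_prod] its product with the projection,
   [arr_proj] the projection times its denominator [sc_den], [arr_sel] the [A'_l],
   [arr_rand] the random numbers, [arr_blow] the blow-ups and [arr_corner] the part of
   [arr_proj] which survives a shift of the window. *)
Local Notation "c1 ;; c2" := (Seq c1 c2) (at level 61, right associativity).
Local Notation "$ x" := (IVar x) (at level 1, format "$ x").
Local Notation ix e1 W e2 := (IAdd (IMul e1 W) e2).

Local Notation reg_n := 0%N (only parsing).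
Local Notation reg_p := 1%N (only parsing).
Local Notation reg_d := 2%N (only parsing).
Local Notation reg_out := 4%N (only parsing).
Local Notation reg_sel := 5%N (only parsing).
Local Notation reg_t := 6%N (only parsing).
Local Notation reg_s := 7%N (only parsing).
Local Notation reg_i := 8%N (only parsing).
Local Notation reg_j := 9%N (only parsing).
Local Notation reg_l := 10%N (only parsing).
Local Notation reg_piv := 11%N (only parsing).
Local Notation reg_a := 12%N (only parsing).
Local Notation reg_b := 13%N (only parsing).
Local Notation reg_W := 14%N (only parsing).

Local Notation sc_den := 0%N (only parsing).
Local Notation sc_sum := 1%N (only parsing).
Local Notation sc_x := 2%N (only parsing).
Local Notation sc_y := 3%N (only parsing).
Local Notation sc_coef := 4%N (only parsing).
Local Notation sc_piv := 5%N (only parsing).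
Local Notation sc_zero := 6%N (only parsing).

Local Notation arr_in := 0%N (only parsing).
Local Notation arr_out := 1%N (only parsing).
Local Notation arr_row := 2%N (only parsing).
Local Notation arr_prod := 3%N (only parsing).
Local Notation arr_proj := 4%N (only parsing).
Local Notation arr_sel := 5%N (only parsing).
Local Notation arr_rand := 6%N (only parsing).
Local Notation arr_blow := 7%N (only parsing).
Local Notation arr_corner := 8%N (only parsing).

Local Notation exp_N := (IMul $reg_n $reg_d).

Arguments exec : simpl never.
Ltac step := eapply exec_step; [reflexivity|].
Ltac last_step := eapply exec_last; [reflexivity|].

Definition dot_entry : cmd :=
  For reg_i $reg_W (Fetch sc_x arr_row $reg_i ;;
                    Fetch sc_y arr_proj (ix $reg_i $reg_W $reg_j) ;;
                    SOp OMul sc_x sc_x sc_y ;; SOp OAdd sc_sum sc_sum sc_x).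
Definition dot_row : cmd :=
  For reg_j $reg_W (SCst sc_sum 0 0 ;; dot_entry ;; Store arr_prod $reg_j sc_sum).
Definition find_pivot : cmd :=
  ISet reg_piv $reg_W ;;
  For reg_j $reg_W (Fetch sc_x arr_prod $reg_j ;; IfZero sc_x Skip (ISet reg_piv $reg_j)).
Definition update_row : cmd :=
  For reg_j $reg_W (Fetch sc_y arr_proj (ix $reg_i $reg_W $reg_j) ;;
                    Fetch sc_x arr_prod $reg_j ;;
                    SOp OMul sc_y sc_piv sc_y ;; SOp OMul sc_x sc_coef sc_x ;;
                    SOp OSub sc_y sc_y sc_x ;; SOp ODiv sc_y sc_y sc_den ;;
                    Store arr_proj (ix $reg_i $reg_W $reg_j) sc_y).
Definition update : cmd :=
  Fetch sc_piv arr_prod $reg_piv ;;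
  For reg_i $reg_W (Fetch sc_coef arr_proj (ix $reg_i $reg_W $reg_piv) ;; update_row) ;;
  SCst sc_zero 0 0 ;; SOp OAdd sc_den sc_piv sc_zero.
Definition insert : cmd :=
  dot_row ;; find_pivot ;; IfLe (IAdd $reg_piv (ICst 1)) $reg_W update Skip.

(** ** Inserting a row *)

Section Insert.
Variables (R : realType) (ok : {pred R[i]}).
Local Notation F := R[i].
Local Notation st := (state F).
Implicit Types s : st.

Definition mxarr m W (f : nat -> F) : 'M[F]_(m, W) := \matrix_(i, j) f (i * W + j)%N.
Definition rowarr W (f : nat -> F) : 'rV[F]_W := \row_j f j.

Definition last_nonzero W (y : nat -> F) (c : nat) :=
  (c = W /\ forall j, (j < W)%N -> y j = 0) \/
  [/\ (c < W)%N, y c != 0 & forall j, (c < j < W)%N -> y j = 0].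

Lemma dot_entry_spec s W j : ireg s reg_W = W -> ireg s reg_j = j ->
  sreg s sc_sum = 0 -> stored_ok ok s ->
  always (exec dot_entry s) (fun s' => stored_ok ok s' /\
    sreg s' sc_sum = \sum_(i < W) arr s arr_row i * arr s arr_proj (i * W + j)%N).
Proof.
move=> sW sj s0 oks.
apply: always_mono (exec_for (n := W) (I := fun k s' => stored_ok ok s' /\ sreg s' sc_sum =
    \sum_(0 <= i < k) arr s arr_row i * arr s arr_proj (i * W + j)%N) _ _ _) => //.
- by move=> s' [_ [oks' ->]]; rewrite big_mkord.
- by rewrite big_nil.
move=> k s' _ [f_ireg _ f_arr] [oks' IH]; step; step; step; last_step; split=> //.
by rewrite big_nat_recr //= /upd /= IH !f_arr // !f_ireg // sW sj.
Qed.

Lemma dot_row_spec s W : ireg s reg_W = W -> stored_ok ok s ->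
  (forall j, (rowarr W (arr s arr_row) *m mxarr W W (arr s arr_proj)) 0 j \in ok) ->
  always (exec dot_row s) (fun s' => stored_ok ok s' /\
    rowarr W (arr s' arr_prod) = rowarr W (arr s arr_row) *m mxarr W W (arr s arr_proj)).
Proof.
move=> sW oks okY.
pose y j := \sum_(i < W) arr s arr_row i * arr s arr_proj (i * W + j)%N.
have YE (j : 'I_W) : (rowarr W (arr s arr_row) *m mxarr W W (arr s arr_proj)) 0 j = y j.
  by rewrite mxE; apply: eq_bigr => i _; rewrite !mxE.
apply: always_mono (@exec_for_fill1 _ ok _ _ _ arr_prod id y (arr s arr_prod) 0 W s _ _ _) => //.
  by move=> s' [oks' aE]; split=> //; apply/rowP=> j; rewrite YE mxE aE fill_id ltn_ord.
move=> k s' kW [f_ireg _ f_arr] [oks' aE]; step; apply: exec_seq.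
apply: always_mono (dot_entry_spec (W := W) (j := k) _ _ _ _) => //; last first.
  by rewrite /= /upd /= f_ireg.
move=> s2 [ok2 e2] [g_ireg _ g_arr].
have yk : sreg s2 sc_sum = y k by rewrite e2 /=; apply: eq_bigr => i _; rewrite !f_arr.
apply: exec_store_fill yk _ _; rewrite ?add0n.
- by split; rewrite // g_arr.
- by rewrite /= g_ireg.
by rewrite -(YE (Ordinal kW)); exact: okY.
Qed.

Lemma find_pivot_spec s W : ireg s reg_W = W -> stored_ok ok s ->
  always (exec find_pivot s) (fun s' => stored_ok ok s' /\
    last_nonzero W (arr s arr_prod) (ireg s' reg_piv)).
Proof.
move=> sW oks; step; set s1 := tick 1 _.
apply: always_mono (exec_for (n := W) (I := fun k s' => stored_ok ok s' /\
  ((ireg s' reg_piv = W /\ forall j, (j < k)%N -> arr s arr_prod j = 0) \/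
   [/\ (ireg s' reg_piv < k)%N, arr s arr_prod (ireg s' reg_piv) != 0 &
       forall j, (ireg s' reg_piv < j < k)%N -> arr s arr_prod j = 0])) _ _ _) => //.
- by move=> s' [_].
- by split=> //; left; rewrite /= /upd /= sW.
move=> k s' kW [f_ireg _ f_arr] [oks' IH]; step; apply: exec_ifzero => yk; last_step; split=> //;
  move: yk; rewrite /= /upd /= f_arr //= => yk.
  case: IH => [[-> IH]|[lt_piv piv0 above0]]; [left|right].
    by split=> // j; rewrite ltnS leq_eqVlt => /predU1P[->|/IH].
  split=> // [|j]; first exact: ltnW.
  rewrite ltnS => /andP[cj]; rewrite leq_eqVlt => /predU1P[->//|jk].
  by apply: above0; rewrite cj.
by right; split=> // j; lia.
Qed.

Lemma update_row_spec s W k val f : ireg s reg_W = W -> ireg s reg_i = k ->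
  filled ok arr_proj id val f (k * W) s ->
  (forall j, (j < W)%N -> val (k * W + j)%N \in ok /\ val (k * W + j)%N =
    (sreg s sc_piv * f (k * W + j)%N - sreg s sc_coef * arr s arr_prod j) / sreg s sc_den) ->
  always (exec update_row s) (filled ok arr_proj id val f (k * W + W)).
Proof.
move=> sW si fs valE; apply: exec_for_fill1 => // j s' jW [f_ireg f_sreg f_arr] fs'.
have [okj vj] := valE j jW; have [_ aE] := fs'.
do 6!step; apply: exec_store_fill => //; rewrite /= /upd /= !f_ireg // sW si //.
by rewrite vj aE fill_id ltnn !f_sreg // f_arr.
Qed.

Lemma update_spec s W c (new := fun i j =>
    (arr s arr_prod c * arr s arr_proj (i * W + j)%N -
     arr s arr_proj (i * W + c)%N * arr s arr_prod j) / sreg s sc_den) :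
  ireg s reg_W = W -> ireg s reg_piv = c -> (c < W)%N -> stored_ok ok s ->
  (forall i j, (i < W)%N -> (j < W)%N -> new i j \in ok) ->
  always (exec update s) (fun s' => [/\ stored_ok ok s', sreg s' sc_den = arr s arr_prod c &
    forall i j, (i < W)%N -> (j < W)%N -> arr s' arr_proj (i * W + j)%N = new i j]).
Proof.
move=> sW sc cW oks oknew; step; apply: exec_seq; set s1 := tick 1 _.
pose val e := new (e %/ W)%N (e %% W)%N.
have valE i j : (j < W)%N -> val (i * W + j)%N = new i j.
  by move=> jW; rewrite /val divn_rowmajor ?modn_rowmajor.
apply: always_mono (@exec_for_fill _ ok _ _ _ arr_proj id val (arr s arr_proj) 0 W W s1 _ _ _).
- move=> s' [oks' aE] [_ f_sreg _]; step; last_step; split=> // [|i j iW jW].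
    by rewrite /= /upd /= addr0 f_sreg //= /upd /= sc.
  by rewrite /= aE fill_id ltn_rowmajor // valE.
- by [].
- by split.
move=> k s' kW [f_ireg f_sreg f_arr] fs'; step; have [_ aE] := fs'; rewrite add0n in aE.
apply: update_row_spec => //; first by rewrite /= /upd /= f_ireg.
move=> j jW; rewrite valE //; split; first exact: oknew.
by rewrite /= /upd /= aE fill_id !f_ireg // !f_sreg // f_arr //= /upd /= sW sc ltnNge leq_addr.
Qed.

End Insert.

Section InsertRow.
Variables (R : realType) (entry ok : {pred R[i]}) (D0 : nat).
Local Notation F := R[i].
Local Notation st := (state F).
Implicit Types s : st.

Lemma scaled_deflateE W (Q : 'M[F]_W) v c dl i j : dl != 0 -> (v *m Q) 0 c != 0 ->
  (dl * (v *m Q) 0 c * (dl * Q i j) - dl * Q i c * (dl * (v *m Q) 0 j)) / dl =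
  dl * (v *m Q) 0 c * deflate Q v c i j.
Proof.
move=> dl0; rewrite deflateE; move: ((v *m Q) 0 c) ((v *m Q) 0 j) (Q i j) (Q i c).
by move=> y z q q' y0; field; rewrite y0 dl0.
Qed.

Definition elim_state D W s (Q : 'M[F]_W) :=
  [/\ mxarr W W (arr s arr_proj) = sreg s sc_den *: Q, reduced_proj Q &
      windowed entry D (sreg s sc_den) Q].

Definition inserted W (Q : 'M[F]_W) v (Q' : 'M[F]_W) (piv : nat) :=
  [/\ v *m Q = 0, Q' = Q & piv = W] \/
  exists c : 'I_W, [/\ (v *m Q) 0 c != 0, forall j : 'I_W, (c < j)%N -> (v *m Q) 0 j = 0,
                       Q' = deflate Q v c & piv = c].

Lemma fixed_inserted W (Q : 'M[F]_W) v Q' piv (x : 'cV[F]_W) :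
  reduced_proj Q -> inserted Q v Q' piv ->
  Q' *m x = x <-> Q *m x = x /\ v *m x = 0.
Proof.
move=> rQ [[vQ -> _]|[c [yc _ -> _]]]; last exact: fixed_deflate.
by split=> [Qx|[]//]; split=> //; rewrite -Qx mulmxA vQ mul0mx.
Qed.

Hypothesis safe : elimination_safe entry ok D0.

Lemma update_deflate_spec s D W (Q : 'M[F]_W) v (c : 'I_W) :
  (D <= D0)%N -> (W <= D0)%N -> ireg s reg_W = W -> ireg s reg_piv = c -> stored_ok ok s ->
  elim_state D s Q -> v \is a mxOver entry ->
  (forall j : 'I_W, arr s arr_prod j = sreg s sc_den * (v *m Q) 0 j) -> (v *m Q) 0 c != 0 ->
  always (exec update s) (fun s' => stored_ok ok s' /\ elim_state D s' (deflate Q v c)).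
Proof.
case: safe => entry0 _ _ safeW DD WD sW sc oks [QE rQ wQ] entry_v yE yc0.
have [den0 _ _ _] := safeW _ _ _ _ DD WD wQ.
have wQ' := windowed_deflate entry0 entry_v yc0 wQ.
have [_ _ /mxOverP okQ' _] := safeW _ _ _ _ DD WD wQ'.
have sQ (i j : 'I_W) : arr s arr_proj (i * W + j)%N = sreg s sc_den * Q i j.
  by move/matrixP/(_ i j): QE; rewrite !mxE.
have newE (i j : 'I_W) : (arr s arr_prod c * arr s arr_proj (i * W + j)%N -
    arr s arr_proj (i * W + c)%N * arr s arr_prod j) / sreg s sc_den =
    sreg s sc_den * (v *m Q) 0 c * deflate Q v c i j.
  by rewrite !yE !sQ scaled_deflateE.
apply: always_mono (update_spec sW sc (ltn_ord c) oks _) => [s' [oks' denE QE']|i j iW jW].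
  split=> //; split; rewrite ?denE ?yE //; last exact: reduced_proj_deflate.
  by apply/matrixP=> i j; rewrite mxE QE' // newE !mxE.
have /= -> := newE (Ordinal iW) (Ordinal jW).
by have := okQ' (Ordinal iW) (Ordinal jW); rewrite mxE.
Qed.

Lemma insert_spec s D W (Q : 'M[F]_W) (v := rowarr W (arr s arr_row)) :
  (D <= D0)%N -> (W <= D0)%N -> ireg s reg_W = W -> stored_ok ok s ->
  elim_state D s Q -> v \is a mxOver entry ->
  always (exec insert s) (fun s' => stored_ok ok s' /\
    exists2 Q', elim_state D s' Q' & inserted Q v Q' (ireg s' reg_piv)).
Proof.
move=> DD WD sW oks eQ entry_v; have [QE rQ wQ] := eQ.
have [den0 _ _ /(_ v entry_v)/mxOverP okY] :=
  let: And4 _ _ _ safeW := safe in safeW _ _ _ _ DD WD wQ.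
have YE : v *m mxarr W W (arr s arr_proj) = sreg s sc_den *: (v *m Q) by rewrite QE scalemxAr.
apply: exec_seq; apply: always_mono (dot_row_spec sW oks _) => [s1|j]; last first.
  by rewrite YE okY.
move=> [ok1 y1] [f_ireg f_sreg f_arr].
apply: exec_seq; apply: always_mono (find_pivot_spec (W := W) _ ok1) => [s2|];
  last by rewrite f_ireg.
move=> [ok2 piv] [g_ireg g_sreg g_arr]; have s2W : ireg s2 reg_W = W by rewrite g_ireg // f_ireg.
have s2den : sreg s2 sc_den = sreg s sc_den by rewrite g_sreg // f_sreg.
have eQ2 : elim_state D s2 Q by split; rewrite ?s2den // g_arr // f_arr.
have yE (j : 'I_W) : arr s1 arr_prod j = sreg s sc_den * (v *m Q) 0 j.
  by rewrite YE in y1; move/rowP/(_ j): y1; rewrite !mxE.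
have y0 (j : 'I_W) : arr s1 arr_prod j = 0 -> (v *m Q) 0 j = 0.
  by rewrite yE => /eqP; rewrite mulf_eq0 (negPf den0) => /eqP.
apply: exec_ifle => cW; rewrite /= s2W addn1 in cW; last first.
  case: piv => [[cE zero]|[lt_piv _ _]]; last by rewrite ltnS leqNgt lt_piv in cW.
  last_step; split=> //; exists Q => //; left; split=> //.
  by apply/rowP=> j; rewrite [RHS]mxE; apply/y0/zero.
case: piv => [[cE]|[_ yc ymax]]; first by rewrite cE ltnn in cW.
pose c := Ordinal cW; have yc0 : (v *m Q) 0 c != 0.
  by apply: contraNneq yc => vQ0; rewrite (yE c) vQ0 mulr0.
have yE2 (j : 'I_W) : arr s2 arr_prod j = sreg s2 sc_den * (v *m Q) 0 j.
  by rewrite g_arr // s2den yE.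
have update_ok :=
  @update_deflate_spec (tick 1 s2) D W Q v c DD WD s2W erefl ok2 eQ2 entry_v yE2 yc0.
apply: always_mono (always_and update_ok (exec_frame _ _)) => s3 [[ok3 eQ'] [h_ireg _ _]].
split=> //; exists (deflate Q v c) => //; right; exists c; split=> //; last by rewrite h_ireg.
by move=> j cj; apply/y0/ymax; rewrite cj ltn_ord.
Qed.

End InsertRow.

(** ** Moving vectors *)

Definition copy src (e_src q : iexp) dst (e_dst len : iexp) : cmd :=
  For reg_i len (Fetch sc_x src (IAdd e_src (IMul $reg_i q)) ;;
                 Store dst (IAdd e_dst $reg_i) sc_x).
Definition clear_square : cmd :=
  SCst sc_zero 0 0 ;; For reg_i (IMul $reg_W $reg_W) (Store arr_proj $reg_i sc_zero).
Definition reset_square (len : iexp) : cmd :=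
  clear_square ;; For reg_i len (Store arr_proj (ix $reg_i $reg_W $reg_i) sc_den).

Section Moves.
Variables (R : realType) (ok : {pred R[i]}).
Local Notation F := R[i].
Local Notation st := (state F).
Implicit Types s : st.

Lemma copy_spec src e_src q dst e_dst len s x0 k y0 n :
  src != dst -> reg_i \notin evars e_src ++ evars q ++ evars e_dst ->
  ieval (ireg s) e_src = x0 -> ieval (ireg s) q = k -> ieval (ireg s) e_dst = y0 ->
  ieval (ireg s) len = n -> stored_ok ok s ->
  (forall i, (i < n)%N -> arr s src (x0 + i * k)%N \in ok) ->
  always (exec (copy src e_src q dst e_dst len) s)
    (filled ok dst (addn y0) (fun i => arr s src (x0 + i * k)%N) (arr s dst) n).
Proof.
move=> src_dst i_free <- <- <- sn oks oksrc.
apply: (@exec_for_fill1 _ ok _ _ _ dst _ _ _ 0) => // i s' iN [f_ireg _ f_arr] fs'; step.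
have evalE e : {subset evars e <= evars e_src ++ evars q ++ evars e_dst} ->
    ieval (upd (ireg s') reg_i i) e = ieval (ireg s) e.
  move=> se; apply: eq_ieval => x /se xe.
  have xi : x != reg_i by apply: contraNneq i_free => <-.
  by rewrite /upd (negPf xi) f_ireg // mem_seq1.
have ieqs : [/\ ieval (upd (ireg s') reg_i i) e_src = ieval (ireg s) e_src,
    ieval (upd (ireg s') reg_i i) q = ieval (ireg s) q &
    ieval (upd (ireg s') reg_i i) e_dst = ieval (ireg s) e_dst].
  by split; apply: evalE => x xe; rewrite !mem_cat xe ?orbT.
case: ieqs => src_eq q_eq dst_eq; apply: exec_store_fill => //=; rewrite add0n.
- by rewrite {1}/upd /= src_eq q_eq f_arr ?mem_seq1 // {1}/upd.
- by rewrite dst_eq.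
- exact: oksrc.
Qed.

Hypothesis ok0 : 0 \in ok.

Lemma clear_square_spec s W : ireg s reg_W = W -> stored_ok ok s ->
  always (exec clear_square s) (fun s' => stored_ok ok s' /\
    forall e, (e < W * W)%N -> arr s' arr_proj e = 0).
Proof.
move=> sW oks; step; set s1 := tick 1 _.
apply: always_mono (@exec_for_fill1 _ ok _ _ _ arr_proj id (fun=> 0) (arr s arr_proj)
    0 (W * W) s1 _ _ _) => //.
- by move=> s' [oks' aE]; split=> // e eW; rewrite aE fill_id eW.
- by rewrite /= sW.
by move=> k s' _ [_ f_sreg _] fs'; apply: exec_store_fill; rewrite //= f_sreg.
Qed.

Lemma reset_square_spec len s W k : ireg s reg_W = W -> ieval (ireg s) len = k ->
  reg_i \notin evars len -> (k <= W)%N -> stored_ok ok s -> sreg s sc_den \in ok ->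
  always (exec (reset_square len) s) (fun s' => stored_ok ok s' /\
    mxarr W W (arr s' arr_proj) = sreg s sc_den *: pid_mx k).
Proof.
move=> sW sk i_free kW oks okd.
apply: exec_seq; apply: always_mono (clear_square_spec sW oks) => s1 [oks1 z1] [f_ireg f_sreg _].
have diagI : injective (fun i => i * W + i)%N.
  by move=> i j; rewrite -!mulnSr => /eqP; rewrite eqn_pmul2r // => /eqP.
have s1k : ieval (ireg s1) len = k.
  by rewrite -sk; apply: eq_ieval => x xe; rewrite f_ireg // mem_seq1;
    apply: contraNneq i_free => <-.
apply: always_mono (@exec_for_fill1 _ ok _ _ _ arr_proj (fun i => i * W + i)%N
    (fun=> sreg s sc_den) (arr s1 arr_proj) 0 k s1 s1k _ _) => //; first last.
  move=> i s' ik [g_ireg g_sreg _] fs'; apply: exec_store_fill => //=; rewrite /upd /=.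
    by rewrite g_sreg // f_sreg.
  by rewrite g_ireg // f_ireg // sW add0n.
move=> s' [oks' aE]; split=> //; apply/matrixP=> i j; rewrite !mxE aE.
have [ij|ij] := boolP ((i == j :> nat) && (i < k)%N).
  by case/andP: ij => /eqP <- ik; rewrite mulr1 (fill_in _ _ diagI).
rewrite mulr0 fill_notin ?z1 ?ltn_rowmajor // => l lk.
rewrite eq_addl_mul ?(leq_trans lk) // xpair_eqE; apply: contra ij => /andP[/eqP <- /eqP <-].
by rewrite eqxx.
Qed.

End Moves.

(** ** Selecting independent matrices *)

Definition load_matrix : cmd :=
  copy arr_in (IMul $reg_t $reg_W) (ICst 1) arr_row (ICst 0) $reg_W.
Definition keep_matrix : cmd :=
  copy arr_row (ICst 0) (ICst 1) arr_sel (IMul $reg_sel $reg_W) $reg_W ;;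
  ISet reg_sel (IAdd $reg_sel (ICst 1)).
Definition select_one : cmd :=
  load_matrix ;; insert ;; IfLe (IAdd $reg_piv (ICst 1)) $reg_W keep_matrix Skip.
Definition select : cmd :=
  ISet reg_W (IMul $reg_n $reg_n) ;; SCst sc_den 1 0 ;; reset_square $reg_W ;;
  For reg_t $reg_p select_one.

Section KernelProjections.
Variable F : fieldType.

Definition kernel_proj m W (S : 'M[F]_(m, W)) (Q : 'M[F]_W) :=
  forall x : 'cV[F]_W, Q *m x = x <-> S *m x = 0.

Lemma submx_kernel_proj m W (S : 'M[F]_(m, W)) Q (v : 'rV[F]_W) :
  reduced_proj Q -> kernel_proj S Q -> (v <= S)%MS = (v *m Q == 0).
Proof.
move=> /reduced_proj_idem QQ kQ; apply/idP/eqP=> [/submxP[D ->]|vQ].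
  have SQ : S *m Q = 0; last by rewrite -mulmxA SQ mulmx0.
  apply/matrixP=> i j; have /kQ/colP/(_ i) : Q *m col j Q = col j Q by rewrite colE mulmxA QQ.
  by rewrite colE mulmxA -colE mxE => ->; rewrite !mxE.
rewrite submxE; apply/eqP/rowP=> j; have /kQ Qx : S *m col j (cokermx S) = 0.
  by rewrite colE mulmxA mulmx_coker mul0mx.
have := congr1 (mulmx v) Qx; rewrite mulmxA vQ mul0mx colE mulmxA -colE.
by move/rowP/(_ 0); rewrite !mxE.
Qed.

Lemma kernel_proj_adds m m' q W (S : 'M[F]_(m, W)) (S' : 'M[F]_(m', W)) (v : 'M[F]_(q, W)) Q Q' :
  (S' :=: S + v)%MS -> kernel_proj S Q ->
  (forall x : 'cV[F]_W, Q' *m x = x <-> Q *m x = x /\ v *m x = 0) -> kernel_proj S' Q'.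
Proof.
move=> S'E kQ Q'P x; rewrite Q'P kQ; split=> [[/sub_kermxP Sx /sub_kermxP vx]|/sub_kermxP].
  by apply/sub_kermxP; rewrite S'E addsmx_sub Sx.
by rewrite S'E addsmx_sub => /andP[/sub_kermxP ? /sub_kermxP ?].
Qed.

End KernelProjections.

Section Selected.
Variables (R : realType) (W : nat).
Local Notation F := R[i].
Implicit Types (f g : nat -> F) (t m : nat).

Definition arr_line f t : 'rV[F]_W := \row_i f (t * W + i)%N.

Lemma row_mxarr m f l : row l (mxarr m W f) = arr_line f l.
Proof. by apply/rowP=> i; rewrite !mxE. Qed.

Lemma mxarrS m f : (mxarr m.+1 W f :=: mxarr m W f + arr_line f m)%MS.
Proof.
apply/eqmxP/andP; split; last first.
  rewrite addsmx_sub -[arr_line f m](row_mxarr f (ord_max : 'I_m.+1)) row_sub andbT.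
  apply/row_subP=> l; rewrite row_mxarr -(row_mxarr f (widen_ord (leqnSn m) l)).
  exact: row_sub.
apply/row_subP=> l; rewrite row_mxarr; have [lm|ml] := ltnP l m.
  by rewrite -(row_mxarr f (Ordinal lm)) (submx_trans (row_sub _ _)) ?addsmxSl.
have -> : nat_of_ord l = m by apply/eqP; rewrite eqn_leq ml -ltnS ltn_ord.
exact: addsmxSr.
Qed.

Definition selected f t m g :=
  [/\ (m <= t)%N, row_free (mxarr m W g),
      forall l, (l < m)%N -> exists2 t', (t' < t)%N & arr_line g l = arr_line f t' &
      (mxarr t W f <= mxarr m W g)%MS].

Lemma selected0 f g : selected f 0 0 g.
Proof. by split=> //; [rewrite /row_free -leqn0 rank_leq_row|apply/row_subP=> -[]]. Qed.

Lemma selected_skip f t m g :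
  (arr_line f t <= mxarr m W g)%MS -> selected f t m g -> selected f t.+1 m g.
Proof.
move=> ft [mt free orig span]; split=> //; first exact: leqW.
  by move=> l /orig[t' t't e]; exists t' => //; exact: leqW.
by rewrite mxarrS addsmx_sub span.
Qed.

Lemma selected_keep f t m g g' : ~~ (arr_line f t <= mxarr m W g)%MS ->
  (forall l, (l < m)%N -> arr_line g' l = arr_line g l) -> arr_line g' m = arr_line f t ->
  selected f t m g -> selected f t.+1 m.+1 g' /\
  (mxarr m.+1 W g' :=: mxarr m W g + arr_line f t)%MS.
Proof.
move=> ft g'l g'm [mt free orig span].
have g'E : mxarr m W g' = mxarr m W g by apply/row_matrixP=> l; rewrite !row_mxarr g'l.
have S' := mxarrS m g'; rewrite g'E g'm in S'; split=> //; split=> //.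
- rewrite /row_free eqn_leq rank_leq_row S' -{1}(eqP free).
  by apply: rank_ltmx; rewrite ltmx_addsl.
- move=> l; rewrite ltnS leq_eqVlt => /predU1P[->|lm]; first by exists t.
  by have [t' t't e] := orig l lm; exists t'; rewrite ?g'l ?leqW.
- by rewrite mxarrS S' addsmxS.
Qed.

End Selected.

Section Select.
Variables (R : realType) (entry ok : {pred R[i]}) (D0 W : nat).
Local Notation F := R[i].
Local Notation st := (state F).
Implicit Types s : st.
Hypotheses (safe : elimination_safe entry ok D0) (WD : (W <= D0)%N).

Lemma eq_elim_state D s s' (Q : 'M[F]_W) :
  arr s' arr_proj = arr s arr_proj -> sreg s' sc_den = sreg s sc_den ->
  elim_state entry D s Q -> elim_state entry D s' Q.
Proof. by move=> aE dE []; rewrite /elim_state aE dE. Qed.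

Definition selecting f t s :=
  [/\ stored_ok ok s, selected W f t (ireg s reg_sel) (arr s arr_sel) &
      exists2 Q, elim_state entry W s Q & kernel_proj (mxarr (ireg s reg_sel) W (arr s arr_sel)) Q].

Lemma load_matrix_spec s t : ireg s reg_W = W -> ireg s reg_t = t -> stored_ok ok s ->
  arr_line W (arr s arr_in) t \is a mxOver ok ->
  always (exec load_matrix s) (fun s' => stored_ok ok s' /\
    rowarr W (arr s' arr_row) = arr_line W (arr s arr_in) t).
Proof.
move=> sW st_ oks /mxOverP okl.
apply: always_mono (copy_spec (ok := ok) (n := W) _ _ _ _ _ _ _ _) => //=.
  move=> s' [oks' aE]; split=> //; apply/rowP=> i; rewrite !mxE aE.
  by rewrite -[nat_of_ord i in LHS]/(0 + i)%N (fill_in _ _ (@addnI 0)) // muln1 sW st_.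
by move=> i iW; have := okl 0 (Ordinal iW); rewrite mxE sW st_ muln1.
Qed.

Lemma keep_matrix_spec s m : ireg s reg_W = W -> ireg s reg_sel = m -> stored_ok ok s ->
  rowarr W (arr s arr_row) \is a mxOver ok ->
  always (exec keep_matrix s) (fun s' => [/\ stored_ok ok s', ireg s' reg_sel = m.+1,
    forall l, (l < m)%N -> arr_line W (arr s' arr_sel) l = arr_line W (arr s arr_sel) l &
    arr_line W (arr s' arr_sel) m = rowarr W (arr s arr_row)]).
Proof.
move=> sW sm oks /mxOverP okv; apply: exec_seq.
apply: always_mono (copy_spec (ok := ok) (n := W) _ _ _ _ _ _ _ _) => //=.
  move=> s' [oks' aE] [f_ireg _ _]; split=> //=; rewrite ?aE.
  - by rewrite /upd /= f_ireg // sm addn1.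
  - move=> l lm; apply/rowP=> i; rewrite !mxE fill_notin // => j jW.
    by rewrite sm sW eq_addl_mul // xpair_eqE gtn_eqF.
  apply/rowP=> i; rewrite !mxE sm sW fill_in ?muln1 // => x y /addnI //.
by move=> i iW; have := okv 0 (Ordinal iW); rewrite mxE muln1.
Qed.

Lemma select_one_spec s t : ireg s reg_W = W -> ireg s reg_t = t ->
  arr_line W (arr s arr_in) t \is a mxOver entry -> selecting (arr s arr_in) t s ->
  always (exec select_one s) (selecting (arr s arr_in) t.+1).
Proof.
case: safe => _ _ entry_ok _ sW st_ entry_l [oks sel [Q eQ kQ]];
  set f := arr s arr_in in entry_l sel *.
have rQ : reduced_proj Q by case: eQ.
apply: exec_seq; apply: always_mono (load_matrix_spec sW st_ oks _) => [s1 [oks1 v1]|].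
  move=> [f_ireg f_sreg f_arr].
  have s1W : ireg s1 reg_W = W by rewrite f_ireg.
  have eQ1 : elim_state entry W s1 Q by apply: eq_elim_state eQ; rewrite ?f_sreg ?f_arr.
  apply: exec_seq; apply: always_mono (insert_spec safe WD WD s1W oks1 eQ1 _); last by rewrite v1.
  move=> s2 [oks2 [Q' eQ' ins]] [g_ireg g_sreg g_arr]; rewrite v1 in ins.
  have s2W : ireg s2 reg_W = W by rewrite g_ireg.
  have s2m : ireg s2 reg_sel = ireg s reg_sel by rewrite g_ireg // f_ireg.
  have a2 : arr s2 arr_sel = arr s arr_sel by rewrite g_arr // f_arr.
  have v2 : rowarr W (arr s2 arr_row) = arr_line W f t by rewrite g_arr // v1.
  have fixQ' x := fixed_inserted x rQ ins.
  apply: exec_ifle => piv_lt; rewrite /= s2W addn1 in piv_lt; last first.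
    case: ins => [[vQ Q'E _]|[c [_ _ _ pivE]]]; last by rewrite ltnS pivE leqNgt ltn_ord in piv_lt.
    last_step; split; rewrite //= s2m a2.
      by apply: selected_skip sel; rewrite (submx_kernel_proj _ rQ kQ) vQ.
    by exists Q'; [exact: eq_elim_state eQ'|rewrite Q'E].
  case: ins => [[_ _ pivE]|[c [vQc _ _ _]]]; first by rewrite pivE ltnn in piv_lt.
  have notin : ~~ (arr_line W f t <= mxarr (ireg s reg_sel) W (arr s arr_sel))%MS.
    by rewrite (submx_kernel_proj _ rQ kQ); apply: contraNneq vQc => ->; rewrite mxE.
  have := keep_matrix_spec (s := tick 1 s2) s2W s2m oks2; rewrite /= v2 => keep.
  apply: always_mono (always_and (keep _) (exec_frame _ _)) => [s3|]; last first.
    by apply: mxOverS entry_l.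
  move=> [[oks3 m3 old new] [_ h_sreg h_arr]]; rewrite a2 in old.
  have [sel' S'E] := selected_keep notin old new sel.
  split=> //; first by rewrite m3.
  exists Q'; first by apply: eq_elim_state eQ'; rewrite ?h_sreg ?h_arr.
  by rewrite m3; exact: kernel_proj_adds S'E kQ fixQ'.
by apply: mxOverS entry_l.
Qed.

Lemma select_spec s n p : W = (n * n)%N -> ireg s reg_n = n -> ireg s reg_p = p ->
  ireg s reg_sel = 0%N -> stored_ok ok s ->
  (forall t, (t < p)%N -> arr_line W (arr s arr_in) t \is a mxOver entry) ->
  always (exec select s) (fun s' => stored_ok ok s' /\
    selected W (arr s arr_in) p (ireg s' reg_sel) (arr s' arr_sel)).
Proof.
move=> WE sn sp s5 oks entry_in; have [entry0 entry1 entry_ok _] := safe.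
step; step; set s1 := tick 1 _.
have s1W : ireg s1 reg_W = W by rewrite /s1 /= /upd /= sn.
have s1den : sreg s1 sc_den = 1 by [].
apply: exec_seq; apply: always_mono (reset_square_spec (len := $reg_W) (entry_ok _ entry0)
  s1W s1W _ _ oks _) => //;
  last by rewrite s1den entry_ok.
move=> s2 [oks2 Q2] [f_ireg f_sreg f_arr]; rewrite s1den scale1r pid_mx_1 in Q2.
have s2W : ireg s2 reg_W = W by rewrite f_ireg.
have a2 : arr s2 arr_in = arr s arr_in by rewrite f_arr.
have s2p : ieval (ireg s2) $reg_p = p by rewrite /= f_ireg.
apply: always_mono (exec_for (I := selecting (arr s arr_in)) s2p _ _) => [s' [_ [] //]||].
  have m0 : ireg (tick 1 s2) reg_sel = 0%N by rewrite /= f_ireg.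
  split; rewrite ?m0 //; first exact: selected0.
  exists 1%:M; first split; rewrite /= ?Q2 ?f_sreg ?scale1r //.
  - exact: reduced_proj1.
  - exact: windowed1.
  by move=> x; rewrite mul1mx; split=> // _; apply/matrixP=> -[].
move=> t s3 tp [g_ireg g_sreg g_arr] sel3.
have a3 : arr (tick 1 (set_ireg s3 reg_t t)) arr_in = arr s arr_in by rewrite /= g_arr.
by rewrite -a3; apply: select_one_spec; rewrite /= /upd /= ?g_ireg // ?g_arr ?a2 ?entry_in.
Qed.

End Select.

(** ** Computing the blow-ups *)

Definition blowup_cell : cmd :=
  SCst sc_sum 0 0 ;;
  For reg_l $reg_sel (Fetch sc_x arr_sel (ix (ix $reg_l $reg_n $reg_i) $reg_n $reg_j) ;;
                      Fetch sc_y arr_rand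
                        (ix (ix (ix $reg_s $reg_sel $reg_l) $reg_d $reg_a) $reg_d $reg_b) ;;
                      SOp OMul sc_x sc_x sc_y ;; SOp OAdd sc_sum sc_sum sc_x) ;;
  Store arr_blow (ix (ix $reg_s exp_N (ix $reg_i $reg_d $reg_a)) exp_N
                     (ix $reg_j $reg_d $reg_b)) sc_sum.
Definition blowup_row : cmd := For reg_j $reg_n (For reg_b $reg_d blowup_cell).
Definition blowup_matrix : cmd := For reg_i $reg_n (For reg_a $reg_d blowup_row).
Definition blowups : cmd := For reg_s (IAdd exp_N (ICst 1)) blowup_matrix.

Section Blowups.
Variables (R : realType) (ok : {pred R[i]}).
Local Notation F := R[i].
Local Notation st := (state F).
Implicit Types s : st.
Variables (n d m : nat) (sel rand : nat -> F).
Hypotheses (n0 : (0 < n)%N) (d0 : (0 < d)%N).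
Local Notation N := (n * d)%N.

Definition matarr q (f : nat -> F) t : 'M[F]_q := \matrix_(i, j) f ((t * q + i) * q + j)%N.

Definition sel_blowup t : 'M[F]_N :=
  blowup (fun l : 'I_m => matarr n sel l) (fun l => \matrix_(a, b) rand (draw_index m d t l a b)).

Definition blowup_entry t i a j b : F :=
  \sum_(l < m) sel ((l * n + i) * n + j)%N * rand (draw_index m d t l a b).

Definition blowup_val e : F :=
  let row := (e %/ N %% N)%N in let column := (e %% N)%N in
  blowup_entry (e %/ N %/ N) (row %/ d) (row %% d) (column %/ d) (column %% d).

Lemma blowup_valE t i a j b : (i < n)%N -> (a < d)%N -> (j < n)%N -> (b < d)%N ->
  blowup_val ((t * N + (i * d + a)) * N + (j * d + b)) = blowup_entry t i a j b.
Proof.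
by move=> *; rewrite /blowup_val !(divn_rowmajor, modn_rowmajor) ?ltn_rowmajor.
Qed.

Lemma sel_blowupE t (r q : 'I_N) : sel_blowup t r q = blowup_val ((t * N + r) * N + q).
Proof.
case: (mxtens_indexP r) => i a; case: (mxtens_indexP q) => j b.
rewrite blowup_valE // summxE; apply: eq_bigr => l _.
by rewrite tensmxE !mxE.
Qed.

Hypothesis ok_blowup : forall t, (t <= N)%N -> sel_blowup t \is a mxOver ok.

Lemma blowup_val_ok e : (e < N.+1 * N * N)%N -> blowup_val e \in ok.
Proof.
have N0 : (0 < N)%N by rewrite muln_gt0 n0.
move=> eN; rewrite (divn_eq e N) [X in (X * N)%N](divn_eq _ N).
rewrite -(sel_blowupE _ (Ordinal (ltn_pmod (e %/ N) N0)) (Ordinal (ltn_pmod e N0))).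
by apply/mxOverP/ok_blowup; rewrite -ltnS !ltn_divLR.
Qed.

Definition blowup_input s :=
  [/\ ireg s reg_n = n, ireg s reg_d = d, ireg s reg_sel = m, arr s arr_sel = sel &
      arr s arr_rand = rand].

Lemma blowup_cell_spec f s t i a j b e :
  (t <= N)%N -> (i < n)%N -> (a < d)%N -> (j < n)%N -> (b < d)%N ->
  e = ((t * N + (i * d + a)) * N + (j * d + b))%N -> blowup_input s ->
  ireg s reg_s = t -> ireg s reg_i = i -> ireg s reg_a = a -> ireg s reg_j = j ->
  ireg s reg_b = b -> filled ok arr_blow id blowup_val f e s ->
  always (exec blowup_cell s) (filled ok arr_blow id blowup_val f e.+1).
Proof.
move=> tN iN aN jN bN eE [sn sd sm ssel srand] st_ si sa sj sb fs; step; set s1 := tick 1 _.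
pose term l := sel ((l * n + i) * n + j)%N * rand (draw_index m d t l a b).
apply: exec_seq; apply: always_mono (exec_for (n := m) (I := fun k s' =>
  filled ok arr_blow id blowup_val f e s' /\ sreg s' sc_sum = \sum_(0 <= l < k) term l)
  _ _ _) => //.
- move=> s2 [[f_ireg _ _] [fs2 v2]] _; apply: exec_store_fill => //=.
  + by rewrite v2 big_mkord eE blowup_valE.
  + by rewrite !f_ireg //= sn sd st_ si sa sj sb eE.
  apply: blowup_val_ok; rewrite eE; apply: ltn_rowmajor; last exact: ltn_rowmajor.
  by apply: ltn_rowmajor; rewrite ?ltnS ?ltn_rowmajor.
- by rewrite big_nil.
move=> l s' _ [f_ireg _ f_arr] [fs' v']; do 3!step; last_step; split=> //.
by rewrite big_nat_recr //= /upd /= v' /term !f_arr // !f_ireg //= ssel srand sn sd sm st_ si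
  sa sj sb.
Qed.

Lemma blowup_row_spec f s t i a e : (t <= N)%N -> (i < n)%N -> (a < d)%N ->
  e = ((t * N + (i * d + a)) * N)%N -> blowup_input s ->
  ireg s reg_s = t -> ireg s reg_i = i -> ireg s reg_a = a ->
  filled ok arr_blow id blowup_val f e s ->
  always (exec blowup_row s) (filled ok arr_blow id blowup_val f (e + N)).
Proof.
move=> tN iN aN -> [sn sd sm ssel srand] st_ si sa fs; rewrite -[X in (_ + X)%N]muln1.
apply: exec_for2_fill => // j b s' jN bN [f_ireg _ f_arr] sj; rewrite muln1 addn1 => fs'.
apply: (@blowup_cell_spec _ _ t i a j b); rewrite //= /upd /= ?f_ireg //.
by split; rewrite /= /upd /= ?f_ireg ?f_arr.
Qed.

Lemma blowup_matrix_spec f s t : (t <= N)%N -> blowup_input s -> ireg s reg_s = t ->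
  filled ok arr_blow id blowup_val f (t * (N * N)) s ->
  always (exec blowup_matrix s) (filled ok arr_blow id blowup_val f (t * (N * N) + N * N)).
Proof.
move=> tN [sn sd sm ssel srand] st_ fs.
apply: exec_for2_fill => // i a s' iN aN [f_ireg _ f_arr] si fs'.
by apply: (@blowup_row_spec _ _ t i a); rewrite //= /upd /= ?f_ireg ?mulnDl ?mulnA //; split;
  rewrite /= /upd /= ?f_ireg ?f_arr.
Qed.

Lemma blowups_spec s : blowup_input s -> stored_ok ok s ->
  always (exec blowups s) (fun s' => stored_ok ok s' /\
    forall t, (t <= N)%N -> matarr N (arr s' arr_blow) t = sel_blowup t).
Proof.
move=> [sn sd sm ssel srand] oks.
apply: always_mono (exec_for_fill (ok := ok) (a := arr_blow) (addr := id) (val := blowup_val)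
  (f := arr s arr_blow) (k0 := 0) (l := N * N) (n := N.+1) _ _ _).
- move=> s' [oks' aE]; split=> // t tN; apply/matrixP=> r q; rewrite mxE aE fill_id sel_blowupE.
  by rewrite add0n (mulnA N.+1) !ltn_rowmajor.
- by rewrite /= sn sd addn1.
- by split.
move=> t s' tN [f_ireg _ f_arr] fs'; apply: blowup_matrix_spec => //.
by split; rewrite /= /upd /= ?f_ireg ?f_arr.
Qed.

End Blowups.

(** ** Computing the chain *)

Definition copy_block src (e_src w_src : iexp) dst (e_dst w_dst rows len : iexp) : cmd :=
  For reg_j rows (copy src (IAdd e_src (IMul $reg_j w_src)) (ICst 1)
                       dst (IAdd e_dst (IMul $reg_j w_dst)) len).
Definition save_corner : cmd :=
  copy_block arr_proj (ICst 0) $reg_W arr_corner (ICst 0) exp_N exp_N exp_N.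
Definition restore_corner : cmd :=
  copy_block arr_corner (ICst 0) exp_N arr_proj (ix exp_N $reg_W exp_N) $reg_W exp_N exp_N.
Definition shift_window : cmd := save_corner ;; reset_square exp_N ;; restore_corner.
Definition chain_row : cmd :=
  copy arr_blow (IMul $reg_l exp_N) (ICst 1) arr_row (ICst 0) exp_N ;;
  copy arr_blow (IMul (ix $reg_s exp_N $reg_l) exp_N) (ICst 1) arr_row exp_N exp_N.
Definition chain_rows : cmd := For reg_l exp_N (chain_row ;; insert).
Definition chains : cmd :=
  ISet reg_W (IAdd exp_N exp_N) ;; SCst sc_den 1 0 ;; clear_square ;;
  For reg_s (IAdd exp_N (ICst 1)) (shift_window ;; chain_rows).

Section ShiftedProjections.
Variables (F : fieldType) (m : nat).
Implicit Types (P : 'M[F]_m) (Q : 'M[F]_(m + m)).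

Definition shift_proj P : 'M[F]_(m + m) := block_mx 1%:M 0 0 P.

Lemma reduced_proj_shift P : reduced_proj P -> reduced_proj (shift_proj P).
Proof.
move=> rP c; case: (split_ordP c) => c' ->.
  right=> j; case: (split_ordP j) => j' ->; last by rewrite block_mxEur mxE eq_lrshift.
  by rewrite block_mxEul mxE (inj_eq (@lshift_inj _ _)).
case: (rP c') => Pc; [left|right] => j; case: (split_ordP j) => j' ->.
- by rewrite block_mxEur mxE.
- by rewrite block_mxEdr Pc.
- by rewrite block_mxEdl mxE eq_rlshift.
- by rewrite block_mxEdr Pc (inj_eq (@rshift_inj _ _)).
Qed.

Lemma reduced_proj_ulsubmx Q : reduced_proj Q -> reduced_proj (ulsubmx Q).
Proof.
by move=> rQ c; case: (rQ (lshift m c)) => Qc; [left|right] => j;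
  rewrite !mxE Qc // (inj_eq (@lshift_inj _ _)).
Qed.

Lemma fixed_shift_proj P (x : 'cV[F]_(m + m)) :
  shift_proj P *m x = x <-> P *m dsubmx x = dsubmx x.
Proof.
rewrite -{1 2}[x]vsubmxK mul_block_col !mul0mx mul1mx add0r addr0.
by split=> [/eq_col_mx[]|->].
Qed.

Lemma fixed_ulsubmx Q (x : 'cV[F]_m) : reduced_proj Q -> ursubmx Q = 0 ->
  ulsubmx Q *m x = x <-> exists y, Q *m col_mx x y = col_mx x y.
Proof.
move=> /reduced_proj_idem QQ Q0.
have Qx y : Q *m col_mx x y = col_mx (ulsubmx Q *m x) (dlsubmx Q *m x + drsubmx Q *m y).
  by rewrite -{1}[Q]submxK Q0 mul_block_col mul0mx addr0.
split=> [Px|[y]]; last by rewrite Qx => /eq_col_mx[].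
exists (dlsubmx Q *m x); have Q0x := Qx 0; rewrite mulmx0 addr0 Px in Q0x.
by rewrite -Q0x mulmxA QQ.
Qed.

End ShiftedProjections.

(* The pivot being the last nonzero column, it lies in the right half unless the row
   vanishes there. *)
Lemma ursubmx_inserted (R : realType) m (Q Q' : 'M[R[i]]_(m + m)) v piv :
  ursubmx Q = 0 -> inserted Q v Q' piv -> ursubmx Q' = 0.
Proof.
move=> Q0 [[_ -> _]//|[c [yc ymax -> _]]].
have uQ0 a b : Q (lshift m a) (rshift m b) = 0 by move/matrixP/(_ a b): Q0; rewrite !mxE.
apply/matrixP=> i j; rewrite [LHS]mxE [in LHS]mxE deflateE [RHS]mxE uQ0 sub0r.
case: (split_ordP c) yc ymax => c' -> yc ymax; last by rewrite uQ0 mul0r mulr0 oppr0.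
by rewrite (ymax (rshift m j)) ?mulr0 ?oppr0 //=; apply: ltn_addr.
Qed.

Section Chains.
Variables (R : realType) (entry ok : {pred R[i]}) (D0 : nat).
Local Notation F := R[i].
Local Notation st := (state F).
Implicit Types s : st.
Hypothesis safe : elimination_safe entry ok D0.

Lemma copy_block_spec src e_src w_src dst e_dst w_dst rows len s x0 ws y0 wd m l :
  src != dst ->
  all [predC [:: reg_i; reg_j]]
    (evars e_src ++ evars w_src ++ evars e_dst ++ evars w_dst ++ evars len) ->
  ieval (ireg s) e_src = x0 -> ieval (ireg s) w_src = ws -> ieval (ireg s) e_dst = y0 ->
  ieval (ireg s) w_dst = wd -> ieval (ireg s) rows = m -> ieval (ireg s) len = l ->
  (l <= wd)%N -> stored_ok ok s ->
  (forall i j, (i < m)%N -> (j < l)%N -> arr s src (x0 + (i * ws + j))%N \in ok) ->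
  always (exec (copy_block src e_src w_src dst e_dst w_dst rows len) s) (fun s' =>
    [/\ stored_ok ok s',
        forall i j, (i < m)%N -> (j < l)%N ->
          arr s' dst (y0 + (i * wd + j))%N = arr s src (x0 + (i * ws + j))%N &
        forall e, (forall i j, (i < m)%N -> (j < l)%N -> (y0 + (i * wd + j))%N != e) ->
          arr s' dst e = arr s dst e]).
Proof.
move=> src_dst free <- <- <- <- sm <- lw oks oksrc.
move: lw oksrc; set x1 := ieval _ e_src; set w1 := ieval _ w_src; set y1 := ieval _ e_dst.
set w2 := ieval _ w_dst; set l1 := ieval _ len => lw oksrc.
apply: always_mono (exec_for (n := m) (I := fun k s' => [/\ stored_ok ok s',
    forall i j, (i < k)%N -> (j < l1)%N ->
      arr s' dst (y1 + (i * w2 + j))%N = arr s src (x1 + (i * w1 + j))%N &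
    forall e, (forall i j, (i < k)%N -> (j < l1)%N -> (y1 + (i * w2 + j))%N != e) ->
      arr s' dst e = arr s dst e]) _ _ _) => // [s' []//|k s' km [f_ireg _ f_arr] [oks' old out]].
set s1 := tick 1 _.
have evalE e : {subset evars e <= evars e_src ++ evars w_src ++ evars e_dst ++ evars w_dst ++
    evars len} -> ieval (ireg s1) e = ieval (ireg s) e.
  move=> se; apply: eq_ieval => x /se/(allP free) /=; rewrite !inE negb_or => /andP[xi xj].
  by rewrite /upd (negPf xj) f_ireg // !inE negb_or xj.
have i_free : reg_i \notin evars e_src ++ evars w_src ++ evars e_dst ++ evars w_dst ++ evars len.
  by apply/negP=> /(allP free); rewrite !inE eqxx.
have src_eq : arr s1 src = arr s src by rewrite /= f_arr // mem_seq1.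
have [e1 e2 e3 e4 e5] : [/\ ieval (ireg s1) e_src = x1, ieval (ireg s1) w_src = w1,
    ieval (ireg s1) e_dst = y1, ieval (ireg s1) w_dst = w2 & ieval (ireg s1) len = l1].
  by split; apply: evalE => x xe; rewrite !mem_cat xe ?orbT.
apply: always_mono (@copy_spec _ ok _ _ _ _ _ _ s1 (x1 + k * w1) 1 (y1 + k * w2) l1
  _ _ _ _ _ _ _ _) => //.
- move=> s2 [oks2 aE]; split=> // [i j|e nin]; rewrite aE.
    rewrite ltnS leq_eqVlt => /predU1P[->|ik] jl.
      by rewrite addnA (fill_in _ _ (@addnI _)) // muln1 src_eq addnA.
    rewrite fill_notin => [|j' j'l]; first by rewrite -old.
    rewrite -addnA eqn_add2l eq_addl_mul ?(leq_trans _ lw) // xpair_eqE.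
    by rewrite gtn_eqF.
  rewrite fill_notin => [|j jl]; last by rewrite -addnA nin.
  by apply: out => i j ik; apply: nin; exact: ltnW.
- by move: i_free; rewrite /= !(mem_cat, inE) !negb_or => /and5P[-> -> -> -> _].
- by rewrite /= e1 e2 /upd eqxx.
- by rewrite /= e3 e4 /upd eqxx.
by move=> i il; rewrite muln1 src_eq -addnA oksrc.
Qed.

Variables (n d : nat) (blow : nat -> F).
Local Notation N := (n * d)%N.
Local Notation C := (matarr N blow).
Hypothesis DD : (N * (N + 3) <= D0)%N.
Hypothesis entry_C : forall t, (t <= N)%N -> C t \is a mxOver entry.

Definition chain_input s :=
  [/\ ireg s reg_n = n, ireg s reg_d = d, ireg s reg_W = (N + N)%N & arr s arr_blow = blow].

Definition corner s : 'M[F]_N := ulsubmx (mxarr (N + N) (N + N) (arr s arr_proj)).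

Definition chain_state D (P : 'M[F]_N) s :=
  [/\ stored_ok ok s, corner s = sreg s sc_den *: P, reduced_proj P &
      windowed entry D (sreg s sc_den) (shift_proj P)].

Lemma save_corner_spec s : chain_input s -> stored_ok ok s -> corner s \is a mxOver ok ->
  always (exec save_corner s) (fun s' =>
    stored_ok ok s' /\ mxarr N N (arr s' arr_corner) = corner s).
Proof.
move=> [sn sd sW _] oks /mxOverP okP.
have cE (i j : 'I_N) : arr s arr_proj (i * (N + N) + j)%N = corner s i j by rewrite !mxE.
apply: always_mono (copy_block_spec (x0 := 0) (ws := N + N) (y0 := 0) (wd := N) (m := N) (l := N)
  _ _ _ _ _ _ _ _ _ _ _) => //=; rewrite ?sn ?sd //.
  by move=> s' [oks' saved _]; split=> //; apply/matrixP=> i j; rewrite -cE mxE; exact: saved.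
by move=> i j iN jN; have := okP (Ordinal iN) (Ordinal jN); rewrite -cE.
Qed.

Lemma restore_corner_spec s (M := mxarr (N + N) (N + N) (arr s arr_proj))
    (P := mxarr N N (arr s arr_corner)) :
  chain_input s -> stored_ok ok s -> P \is a mxOver ok ->
  always (exec restore_corner s) (fun s' => stored_ok ok s' /\
    mxarr (N + N) (N + N) (arr s' arr_proj) =
      block_mx (ulsubmx M) (ursubmx M) (dlsubmx M) P).
Proof.
move=> [sn sd sW _] oks /mxOverP okP.
apply: always_mono (copy_block_spec (x0 := 0) (ws := N) (y0 := N * (N + N) + N) (wd := N + N)
  (m := N) (l := N) _ _ _ _ _ _ _ _ _ _ _) => //=; rewrite ?sn ?sd ?sW ?leq_addr //; last first.
  by move=> i j iN jN; have := okP (Ordinal iN) (Ordinal jN); rewrite mxE.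
move=> s' [oks' new out]; split=> //.
have newE (i j : 'I_N) : arr s' arr_proj ((N + i) * (N + N) + (N + j))%N = P i j.
  by rewrite mxE -[RHS](new i j) // mulnDl !addnA; congr (arr s' _ _); lia.
have oldE (i j : 'I_(N + N)) : ~~ ((N <= i) && (N <= j))%N ->
    arr s' arr_proj (i * (N + N) + j)%N = M i j.
  move=> ij; rewrite mxE; apply: out => i1 j1 iN jN; apply: contra ij => /eqP e.
  have : (((N + i1) * (N + N) + (N + j1))%N == (i * (N + N) + j)%N) by rewrite -e; lia.
  by rewrite eq_addl_mul ?ltn_add2l // => /eqP[<- <-]; rewrite !leq_addr.
apply/matrixP=> i j; rewrite mxE.
case: (split_ordP i) => i' ->; case: (split_ordP j) => j' ->;
  rewrite ?(block_mxEul, block_mxEur, block_mxEdl, block_mxEdr) -?newE // oldE ?mxE //=.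
- by rewrite leqNgt ltn_ord.
- by rewrite leqNgt ltn_ord.
by rewrite [(_ <= j')%N]leqNgt ltn_ord andbF.
Qed.

Lemma chain_state_ok s D P : (D <= D0)%N -> (N + N <= D0)%N -> chain_state D P s ->
  [/\ sreg s sc_den != 0, sreg s sc_den \in ok & corner s \is a mxOver ok].
Proof.
move=> DD' WD [_ -> _ wP]; case: safe => _ _ _ /(_ _ _ _ _ DD' WD wP)[d0 okd /mxOverP okP _].
split=> //; apply/mxOverP=> i j; have := okP (rshift N i) (rshift N j).
by rewrite mxE [X in _ -> X \in _]mxE block_mxEdr.
Qed.

Lemma shift_window_spec s D P : (D <= D0)%N -> (N + N <= D0)%N -> chain_input s ->
  chain_state D P s ->
  always (exec shift_window s) (fun s' => stored_ok ok s' /\ elim_state entry D s' (shift_proj P)).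
Proof.
move=> DD' WD inp stP; have [_ okd okP] := chain_state_ok DD' WD stP.
have [oks cP rP wP] := stP; have [sn sd sW _] := inp; have [entry0 _ entry_ok _] := safe.
apply: exec_seq; apply: always_mono (save_corner_spec inp oks okP).
move=> s1 [oks1 saved] [f_ireg f_sreg f_arr].
rewrite cP in saved okP; apply: exec_seq.
apply: always_mono (reset_square_spec (ok := ok) (s := s1) (len := exp_N) (W := N + N) (k := N)
  _ _ _ _ _ _ _) => //=; rewrite ?f_ireg ?f_sreg ?sn ?sd ?leq_addr //; last exact: entry_ok.
move=> s2 [oks2 reset] [g_ireg g_sreg g_arr].
have inp2 : chain_input s2 by case: inp => *; split; rewrite ?g_ireg ?g_arr // ?f_ireg ?f_arr.
apply: always_mono (always_and (restore_corner_spec inp2 oks2 _) (exec_frame _ _)); last first.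
  by rewrite g_arr // saved.
move=> s3 [[oks3 projE] [_ h_sreg _]].
have s3d : sreg s3 sc_den = sreg s sc_den by rewrite h_sreg // g_sreg // f_sreg.
split=> //; split; [|exact: reduced_proj_shift|by rewrite s3d].
rewrite projE reset s3d g_arr // saved pid_mx_block scale_block_mx.
by rewrite block_mxKul block_mxKur block_mxKdl scale_block_mx.
Qed.

Definition chain_system (P : 'M[F]_N) t l (x : 'cV[F]_(N + N)) :=
  P *m dsubmx x = dsubmx x /\
  forall i : 'I_N, (i < l)%N -> (C 0 *m usubmx x + C t *m dsubmx x) i 0 = 0.

Lemma chain_systemS P t (l : 'I_N) x : chain_system P t l.+1 x <->
  chain_system P t l x /\ row_mx (row l (C 0)) (row l (C t)) *m x = 0.
Proof.
have -> : row_mx (row l (C 0)) (row l (C t)) *m x = 0 <->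
    (C 0 *m usubmx x + C t *m dsubmx x) l 0 = 0.
  rewrite -{1}[x]vsubmxK mul_row_col -!row_mul -[_ + _](linearD (row l)).
  split=> [/matrixP/(_ 0 0)|Cl]; first by rewrite mxE => ->; rewrite mxE.
  by apply/matrixP=> a b; rewrite !ord1 mxE Cl mxE.
split=> [[Px Cx]|[[Px Cx] Cl]].
  by split; [split=> // i il; apply: Cx; exact: ltnW|exact: Cx].
split=> // i; rewrite ltnS leq_eqVlt => /predU1P[/val_inj->|/Cx] //.
Qed.

Lemma chain_systemN P t x : chain_system P t N x <->
  P *m dsubmx x = dsubmx x /\ C 0 *m usubmx x + C t *m dsubmx x = 0.
Proof.
split=> -[Px Cx]; split=> //; last by move=> i _; rewrite Cx mxE.
by apply/matrixP=> i j; rewrite !ord1 Cx ?mxE.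
Qed.

Lemma chain_row_spec s t (l : 'I_N) : (t <= N)%N -> chain_input s ->
  ireg s reg_s = t -> ireg s reg_l = l -> stored_ok ok s ->
  always (exec chain_row s) (fun s' => stored_ok ok s' /\
    rowarr (N + N) (arr s' arr_row) = row_mx (row l (C 0)) (row l (C t))).
Proof.
move=> tN [sn sd _ sblow] ss sl oks; have [_ _ entry_ok _] := safe.
have C_ok t' j : (t' <= N)%N -> (j < N)%N -> blow ((t' * N + l) * N + j)%N \in ok.
  by move=> /entry_C/mxOverP eC jN; apply: entry_ok; have := eC l (Ordinal jN); rewrite mxE.
apply: exec_seq; apply: always_mono (copy_spec (ok := ok) (x0 := l * N) (k := 1) (y0 := 0) (n := N)
  _ _ _ _ _ _ _ _) => //=; rewrite ?sn ?sd ?sl //; last first.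
  by move=> i iN; rewrite muln1 sblow -[l in (l * N)%N]/(0 * N + l)%N C_ok.
move=> s1 [oks1 upE] [f_ireg f_sreg f_arr]; have s1blow : arr s1 arr_blow = blow by rewrite f_arr.
apply: always_mono (copy_spec (ok := ok) (s := s1) (x0 := (t * N + l) * N) (k := 1) (y0 := N)
  (n := N)
  _ _ _ _ _ _ _ _) => //=; rewrite ?f_ireg ?sn ?sd ?sl ?ss ?s1blow //; last first.
  by move=> i iN; rewrite muln1 C_ok.
move=> s2 [oks2 downE]; split=> //; apply/rowP=> j; rewrite mxE downE.
case: (split_ordP j) => j' ->; rewrite ?row_mxEl ?row_mxEr !mxE.
  rewrite fill_notin => [|i iN]; last by rewrite gtn_eqF //= ltn_addr.
  by rewrite upE -[nat_of_ord (lshift _ _)]/(0 + j')%N (fill_in _ _ (@addnI 0)) // muln1 sblow.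
by rewrite (fill_in _ _ (@addnI N)) // muln1.
Qed.

Definition chain_row_state D (P : 'M[F]_N) t l s :=
  stored_ok ok s /\ exists Q : 'M[F]_(N + N),
    [/\ elim_state entry D s Q, ursubmx Q = 0 & forall x, Q *m x = x <-> chain_system P t l x].

Lemma chain_rows_spec s D P t : (D <= D0)%N -> (N + N <= D0)%N -> (t <= N)%N ->
  chain_input s -> ireg s reg_s = t -> chain_row_state D P t 0 s ->
  always (exec chain_rows s) (chain_row_state D P t N).
Proof.
move=> DD' WD tN [sn sd sW sblow] ss st0; have [entry0 _ _ _] := safe.
apply: always_mono (exec_for (n := N) (I := chain_row_state D P t) _ _ _) => [s' []//|||] //.
  by rewrite /= sn sd.
move=> l s1 lN [f_ireg f_sreg f_arr] [oks1 [Q [eQ Q0 kQ]]].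
apply: exec_seq; apply: always_mono (@chain_row_spec _ t (Ordinal lN) _ _ _ _ _) => //=.
  move=> s2 [oks2 rowE] [g_ireg g_sreg g_arr].
  have s2W : ireg s2 reg_W = (N + N)%N by rewrite g_ireg //= /upd /= f_ireg.
  have eQ2 : elim_state entry D s2 Q by apply: eq_elim_state eQ; rewrite ?g_sreg ?g_arr.
  apply: always_mono (insert_spec safe DD' WD s2W oks2 eQ2 _) => [s3 [oks3 [Q' eQ' ins]]|].
    split=> //; exists Q'; split=> //; first exact: ursubmx_inserted ins.
    move=> x; rewrite (fixed_inserted x _ ins); last by case: eQ.
    by rewrite kQ rowE (chain_systemS P t (Ordinal lN)).
  rewrite rowE; apply/mxOverP=> i j; case: (split_ordP j) => j' ->;
    rewrite ?row_mxEl ?row_mxEr mxE; exact/mxOverP/entry_C.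
- by split; rewrite /= /upd /= ?f_ireg ?f_arr.
- by rewrite /upd /= f_ireg.
Qed.

Lemma chain_block_spec s D P t : (D + N <= D0)%N -> (N + N <= D)%N -> (t <= N)%N ->
  chain_input s -> ireg s reg_s = t -> chain_state D P s ->
  always (exec (shift_window ;; chain_rows) s) (fun s' => exists2 P' : 'M[F]_N,
    chain_state (D + N) P' s' &
    forall x, P' *m x = x <-> exists x0 : 'cV[F]_N, P *m x0 = x0 /\ C 0 *m x + C t *m x0 = 0).
Proof.
move=> DD' ND tN inp ss stP; have DD1 : (D <= D0)%N := leq_trans (leq_addr _ _) DD'.
have WD := leq_trans ND DD1; have [entry0 _ _ _] := safe.
apply: exec_seq; apply: always_mono (shift_window_spec DD1 WD inp stP).
move=> s1 [oks1 eP] [f_ireg f_sreg f_arr].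
apply: always_mono (@chain_rows_spec s1 D P t DD1 WD tN _ _ _) => [s2|||].
- move=> [oks2 [Q [[QE rQ wQ] Q0 kQ]]].
  have QB : Q = block_mx (ulsubmx Q) 0 (dlsubmx Q) (drsubmx Q) by rewrite -Q0 submxK.
  exists (ulsubmx Q); first split=> //.
  + by rewrite /corner QE; apply/matrixP=> i j; rewrite !mxE.
  + exact: reduced_proj_ulsubmx.
  + by apply: (windowed_shift entry0 (Q21 := dlsubmx Q) (Q22 := drsubmx Q)); rewrite -QB.
  move=> x; rewrite (fixed_ulsubmx _ rQ Q0).
  by split=> -[y]; [move=> /kQ/chain_systemN|move=> Py];
    [|exists y; apply/kQ/chain_systemN]; rewrite ?col_mxKu ?col_mxKd // => Py; exists y.
- by case: inp => *; split; rewrite ?f_ireg ?f_arr.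
- by rewrite f_ireg.
split=> //; exists (shift_proj P); split=> //; first exact: block_mxKur.
by move=> x; rewrite fixed_shift_proj; split=> [Px|[]//]; split.
Qed.

Lemma chains_spec s : ireg s reg_n = n -> ireg s reg_d = d -> arr s arr_blow = blow ->
  stored_ok ok s ->
  always (exec chains s) (fun s' => [/\ stored_ok ok s', ireg s' reg_W = (N + N)%N,
    sreg s' sc_den != 0, corner s' \is a mxOver ok &
    exists P : 'M[F]_N, [/\ corner s' = sreg s' sc_den *: P, reduced_proj P &
                  forall x, P *m x = x <-> in_chain C N x]]).
Proof.
move=> sn sd sblow oks; have [entry0 entry1 entry_ok _] := safe.
step; step; set s1 := tick 1 _; have s1W : ireg s1 reg_W = (N + N)%N by rewrite /= /upd /= sn sd.
apply: exec_seq; apply: always_mono (clear_square_spec (entry_ok _ entry0) s1W oks).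
move=> s2 [oks2 cleared] [f_ireg f_sreg f_arr].
have N1E : ieval (ireg s2) (IAdd exp_N (ICst 1)) = N.+1.
  by rewrite /= !f_ireg //= /upd /= sn sd addn1.
have NDk k : (k <= N)%N -> (k * N + (N + N) + N <= D0)%N.
  move=> kN; apply: leq_trans DD; rewrite mulnDr; have := leq_mul2r N k N; rewrite kN orbT.
  by lia.
apply: always_mono (exec_for (n := N.+1) (I := fun k s' => exists2 P : 'M[F]_N,
    chain_state (k * N + (N + N)) P s' &
    forall x, P *m x = x <-> if k is k'.+1 then in_chain C k' x else x = 0) N1E _ _).
- move=> s' [[g_ireg _ _] [P stP kP]]; have DN : (N.+1 * N + (N + N) <= D0)%N.
    by apply: leq_trans (NDk N (leqnn _)); rewrite mulSn; lia.
  have [den0 _ okP] := chain_state_ok DN (leq_trans (leq_addl _ _) DN) stP.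
  by case: stP => oks' cP rP _; split=> //; [rewrite g_ireg // f_ireg|exists P].
- exists 0; last by move=> x; rewrite mul0mx; split=> [<-|->].
  split=> //; last by rewrite /= f_sreg //; exact: windowed_pid.
    rewrite scaler0; apply/matrixP=> i j; rewrite !mxE /= cleared ?ltn_rowmajor //.
      by rewrite ltn_addr.
    by rewrite ltn_addr.
  by move=> c; left=> i; rewrite mxE.
move=> k s3 kN [g_ireg g_sreg g_arr] [P stP kP]; rewrite ltnS in kN.
apply: always_mono (@chain_block_spec (tick 1 (set_ireg s3 reg_s k)) _ _ k (NDk k kN)
  (leq_addl _ _) kN _ _ stP) => //; last first.
  by split; rewrite /= /upd /= ?g_ireg ?g_arr // ?f_ireg ?f_arr.
move=> s4 [P' stP' kP']; exists P'; first by move: stP'; rewrite mulSn addnC addnA.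
move=> x; rewrite kP'; case: k {kN g_ireg stP stP' kP'} kP => [|k] kP.
  split=> [[x0 [/kP-> ]]|Cx]; first by rewrite mulmx0 addr0.
  by exists 0; split; rewrite mulmx0 // addr0.
by split=> -[x0 [/kP kx0 Cx]]; exists x0.
Qed.

End Chains.

(** ** Reading off a basis *)

Definition emit_vector : cmd :=
  copy arr_proj (IMul $reg_j $reg_d) (IMul $reg_d $reg_W)
       arr_out (IMul $reg_out $reg_n) $reg_n.
Definition emit : cmd :=
  For reg_j $reg_n
    (Fetch sc_x arr_proj (ix (IMul $reg_j $reg_d) $reg_W (IMul $reg_j $reg_d)) ;;
     IfZero sc_x Skip (emit_vector ;; ISet reg_out (IAdd $reg_out (ICst 1)))).

(** ** Drawing random numbers *)

Definition ndraws : iexp :=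
  IMul (IMul (IMul (IAdd exp_N (ICst 1)) $reg_sel) $reg_d) $reg_d.
(* At most [2 N ^ 3] numbers are drawn, at most [N ^ 2] values of each are bad: the range
   [4 N ^ 5] keeps the probability of failure below [1 / 2]. *)
Definition draw_range : iexp :=
  IMul (ICst 4) (IMul (IMul (IMul (IMul exp_N exp_N) exp_N) exp_N) exp_N).
Definition draw_one : cmd := Rand sc_x draw_range ;; Store arr_rand $reg_t sc_x.
Definition draws : cmd := For reg_t ndraws draw_one.

Section ReducedColumns.
Variables (F : fieldType) (n : nat).
Implicit Types Q : 'M[F]_n.

Lemma reduced_proj_slices d (b : 'I_d) (P : 'M[F]_(n * d)) :
  reduced_proj P -> reduced_proj ((slice F n b)^T *m P *m slice F n b).
Proof.
move=> rP j; case: (rP (mxtens_index (j, b))) => Pj; [left|right] => i;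
  rewrite -mulmxA trslice_mulmxE mulmx_sliceE Pj // eq_mxtens_index eqxx andbT //.
Qed.

Lemma fixed_slices d (b : 'I_d) (P : 'M[F]_(n * d)) (U : 'M[F]_n) : reduced_proj P ->
  (forall x : 'cV[F]_(n * d), P *m x = x <-> (x^T <= U *t (1%:M : 'M[F]_d))%MS) ->
  forall x : 'cV[F]_n,
    (slice F n b)^T *m P *m slice F n b *m x = x <-> (x^T <= U)%MS.
Proof.
move=> /reduced_proj_idem PP PU x; split=> [Qx|/submxP[D xE]].
  have /submxP[D yE] : ((P *m (slice F n b *m x))^T <= U *t (1%:M : 'M[F]_d))%MS.
    by apply/PU; rewrite mulmxA PP.
  by rewrite -Qx -!mulmxA trmx_mul trmxK yE -mulmxA tens1_slice mulmxA submxMl.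
have Px : P *m (slice F n b *m x) = slice F n b *m x.
  by apply/PU; rewrite trmx_mul xE -mulmxA -trslice_tens1 mulmxA submxMl.
by rewrite -!mulmxA Px mulmxA trslice_sliceK mul1mx.
Qed.

Lemma reduced_proj_diag0 Q j i : reduced_proj Q -> Q j j = 0 -> Q i j = 0.
Proof.
by move=> rQ; case: (rQ j) => // ->; rewrite eqxx => /eqP; rewrite oner_eq0.
Qed.

Lemma reduced_proj_diag1 Q j i : reduced_proj Q -> Q j j != 0 -> Q j i = (j == i)%:R.
Proof. by move=> rQ; case: (rQ j) => Qj; rewrite Qj ?eqxx. Qed.

Lemma reduced_columns_free Q dl js : reduced_proj Q -> dl != 0 -> uniq js ->
  all [pred j | Q j j != 0] js -> free [seq col j (dl *: Q) | j <- js].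
Proof.
move=> rQ dl0 ujs /allP js_free; pose j0 := tnth (in_tuple js).
have j0I : injective j0 by apply/tuple_uniqP.
have -> : [seq col j (dl *: Q) | j <- js] = map_tuple (fun j => col j (dl *: Q)) (in_tuple js).
  by [].
apply/freeP=> k kE i; have /colP/(_ (j0 i)) := kE.
have colE (i' : 'I_(size js)) : (map_tuple (fun j => col j (dl *: Q)) (in_tuple js))`_i' (j0 i) 0 =
    dl * (i == i')%:R.
  rewrite -tnth_nth tnth_map !mxE reduced_proj_diag1 ?(inj_eq j0I) //.
  exact/js_free/mem_tnth.
rewrite summxE (bigD1 i) //= big1 ?addr0 => [|i' /negPf i'i]; rewrite mxE colE.
  by rewrite eqxx mulr1 mxE => /eqP; rewrite mulf_eq0 (negPf dl0) orbF => /eqP.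
by rewrite eq_sym i'i !mulr0.
Qed.

Lemma reduced_columns_basis Q dl (V : {vspace 'cV[F]_n}) : reduced_proj Q -> dl != 0 ->
  (forall x, Q *m x = x <-> x \in V) ->
  basis_of V [seq col j (dl *: Q) | j <- enum 'I_n & (dl *: Q) j j != 0].
Proof.
move=> rQ dl0 QV; set js := [seq j <- _ | _].
have jsP j : (j \in js) = (Q j j != 0).
  by rewrite mem_filter mem_enum andbT mxE mulf_eq0 (negPf dl0).
have ujs : uniq js by apply/filter_uniq/enum_uniq.
rewrite /basis_of reduced_columns_free ?andbT //; last by apply/allP=> j; rewrite jsP.
rewrite eqEsubv; apply/andP; split.
  apply/span_subvP=> _ /mapP[j _ ->]; rewrite linearZ rpredZ //=.
  by apply/QV; rewrite colE mulmxA reduced_proj_idem.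
apply/subvP=> x /QV <-.
have -> : Q *m x = \sum_j (dl^-1 * x j 0) *: col j (dl *: Q).
  apply/colP=> i; rewrite mxE summxE; apply: eq_bigr => j _.
  by rewrite !mxE [RHS]mulrACA mulVf // mul1r mulrC.
apply: rpred_sum => j _; apply: rpredZ; have [Qjj|jj0] := eqVneq (Q j j) 0.
  suff -> : col j (dl *: Q) = 0 by exact: rpred0.
  by apply/colP=> i; rewrite !mxE reduced_proj_diag0 ?mulr0.
by apply/memv_span/map_f; rewrite jsP.
Qed.

End ReducedColumns.

Section EmitDraws.
Variables (R : realType) (ok : {pred R[i]}).
Local Notation F := R[i].
Local Notation st := (state F).
Implicit Types s : st.

(* The projection restricted to the first slice. *)
Definition strided n d W (f : nat -> F) : 'M[F]_n := \matrix_(i, j) f (i * d * W + j * d)%N.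

Lemma emit_vector_spec s n d W (j : 'I_n) : ireg s reg_n = n -> ireg s reg_d = d ->
  ireg s reg_W = W -> ireg s reg_j = j -> stored_ok ok s ->
  strided n d W (arr s arr_proj) \is a mxOver ok ->
  always (exec emit_vector s) (fun s' => [/\ stored_ok ok s',
    forall l i, (l < ireg s reg_out)%N -> (i < n)%N ->
      arr s' arr_out (l * n + i)%N = arr s arr_out (l * n + i)%N &
    forall i : 'I_n, arr s' arr_out (ireg s reg_out * n + i)%N =
      strided n d W (arr s arr_proj) i j]).
Proof.
move=> sn sd sW sj oks /mxOverP okv.
have stridedE (i : 'I_n) : arr s arr_proj (j * d + i * (d * W))%N =
    strided n d W (arr s arr_proj) i j by rewrite mxE addnC mulnA.
apply: always_mono (copy_spec (ok := ok) (x0 := j * d) (k := d * W) (y0 := ireg s reg_out * n)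
  (n := n) _ _ _ _ _ _ _ _) => //=; rewrite ?sn ?sd ?sW ?sj //; last first.
  by move=> i iN; rewrite (stridedE (Ordinal iN)).
move=> s' [oks' aE]; split=> // [l i lt_l iN|i]; rewrite aE.
  rewrite fill_notin // => k kn; rewrite eq_addl_mul // xpair_eqE gtn_eqF //.
by rewrite (fill_in _ _ (@addnI _)).
Qed.

Lemma emit_spec s n d W (Q := strided n d W (arr s arr_proj)) :
  ireg s reg_n = n -> ireg s reg_d = d ->
  ireg s reg_W = W -> ireg s reg_out = 0%N -> stored_ok ok s -> Q \is a mxOver ok ->
  always (exec emit s) (fun s' => stored_ok ok s' /\
    output n s' = [seq col j Q | j <- enum 'I_n & Q j j != 0]).
Proof.
move=> sn sd sW s0 oks okQ.
pose column (k : nat) : 'cV[F]_n := \col_i arr s arr_proj (i * d * W + k * d)%N.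
pose kept k := arr s arr_proj (k * d * W + k * d)%N != 0.
have iotaS k : iota 0 k.+1 = rcons (iota 0 k) k by rewrite -cats1 -addn1 iotaD.
apply: always_mono (exec_for (e := $reg_n) (I := fun k s' => stored_ok ok s' /\
    output n s' = [seq column j | j <- iota 0 k & kept j]) sn _ _).
- move=> s' [_ [oks' ->]]; split=> //.
  rewrite -val_enum_ord filter_map -map_comp (eq_filter (a2 := fun j => Q j j != 0)) => [|j].
    by apply: eq_map => j; apply/colP=> i; rewrite !mxE.
  by rewrite /kept mxE.
- by split=> //; rewrite /output /= s0.
move=> k s' kn [f_ireg _ f_arr] [oks' IH]; step; set s1 := tick 1 _.
have s1x : sreg s1 sc_x = arr s arr_proj (k * d * W + k * d)%N.
  by rewrite /s1 /= /upd /= !f_ireg // f_arr // sd sW.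
apply: exec_ifzero; rewrite s1x => kx.
  by last_step; split=> //; rewrite iotaS filter_rcons /kept kx eqxx.
have s2Q : strided n d W (arr (tick 2 s1) arr_proj) = Q by rewrite /s1 /= f_arr.
have [s2n s2d s2W] : [/\ ireg (tick 2 s1) reg_n = n, ireg (tick 2 s1) reg_d = d &
    ireg (tick 2 s1) reg_W = W] by rewrite /s1 /= /upd /= !f_ireg.
have okQ2 := okQ; rewrite -s2Q in okQ2; apply: exec_seq.
apply: always_mono (@emit_vector_spec _ n d W (Ordinal kn) s2n s2d s2W erefl oks' okQ2).
move=> s3 [oks3 old new] [g_ireg _ _]; last_step; split=> //.
rewrite iotaS filter_rcons /kept kx map_rcons -IH /output.
rewrite [X in iota 0 X](_ : _ = (ireg s' reg_out).+1); last by rewrite /= /upd /= g_ireg // addn1.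
rewrite iotaS map_rcons.
congr rcons; last by apply/colP=> i; rewrite !mxE [LHS]new s2Q mxE.
by apply/eq_in_map => l; rewrite mem_iota add0n => lt_l; apply/colP=> i; rewrite !mxE [LHS]old.
Qed.

Lemma draws_spec s T E (small : {pred F}) : ieval (ireg s) ndraws = T ->
  ieval (ireg s) draw_range = E -> stored_ok ok s ->
  (forall j : nat, (j <= E)%N -> j%:R \in small) -> {subset small <= ok} ->
  always (exec draws s) (fun s' => stored_ok ok s' /\
    forall e, (e < T)%N -> arr s' arr_rand e \in small).
Proof.
move=> sT sE oks smallN small_ok.
apply: always_mono (exec_for (I := fun k s' => stored_ok ok s' /\
    forall e, (e < k)%N -> arr s' arr_rand e \in small) sT _ _) => [s' []//|//|].
move=> k s' kT [f_ireg _ _] [oks' IH]; apply: exec_rand => j.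
move=> jE; have {}jE : (j <= E)%N by move: jE; rewrite -sE /= /upd /= !f_ireg.
last_step; split.
  by apply: stored_ok_store; rewrite //= /upd /=; apply/small_ok/smallN.
move=> e; rewrite ltnS leq_eqVlt /= /upd /=.
by case: eqP => [_ _|_ /= /IH]; first exact: smallN.
Qed.

Lemma draws_prob s T E b (I : nat -> (nat -> F) -> Prop) : ieval (ireg s) ndraws = T ->
  ieval (ireg s) draw_range = E -> I 0%N (arr s arr_rand) ->
  (forall k x, (k < T)%N -> I k x ->
     (#|[pred j : 'I_E.+1 | ~~ `[< I k.+1 (upd x k (nat_of_ord j)%:R) >]]| <= b)%N) ->
  1 - T%:R * (b%:R / E.+1%:R) <= prob (exec draws s) (fun s' => I T (arr s' arr_rand)).
Proof.
move=> sT sE I0 IS; apply: (prob_for (I := fun k s' => I k (arr s' arr_rand)) sT) => //.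
move=> k s' kT [f_ireg _ _] Ik; set s1 := tick 1 _.
have s1E : ieval (ireg s1) draw_range = E by rewrite -sE /= /upd /= !f_ireg.
pose drawn (j : nat) : st := tick 1 (store (tick 1 (set_sreg s1 sc_x j%:R)) arr_rand k j%:R).
suff: forall m, m = E -> 1 - b%:R / E.+1%:R <=
    prob (@Draw _ m (fun j => Done (drawn j))) (fun s' => I k.+1 (arr s' arr_rand)) by apply.
by move=> _ ->; apply/prob_draw/IS.
Qed.

End EmitDraws.

(** * Subspaces of column vectors *)

Section RowVspace.
Variables (F : fieldType) (n : nat).

Definition row_vspace q (U : 'M[F]_(q, n)) : {vspace 'cV[F]_n} :=
  limg (linfun (trmx \o mulmxr U : 'rV[F]_q -> 'cV[F]_n)).

Lemma mem_row_vspace q (U : 'M[F]_(q, n)) v : (v \in row_vspace U) = (v^T <= U)%MS.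
Proof.
apply/memv_imgP/submxP => [[x _ ->]|[x vE]].
  by exists x; rewrite lfunE /= trmxK.
by exists x; rewrite ?memvf // lfunE /= -vE trmxK.
Qed.

Lemma row_vspace_sub q q' (U : 'M[F]_(q, n)) (V : 'M[F]_(q', n)) :
  (row_vspace U <= row_vspace V)%VS = (U <= V)%MS.
Proof.
apply/subvP/idP => [UV|UV v]; last by rewrite !mem_row_vspace => /submx_trans; apply.
by apply/row_subP => i; rewrite -[row i U]trmxK -mem_row_vspace UV // mem_row_vspace trmxK row_sub.
Qed.

Lemma dim_row_vspace q (U : 'M[F]_(q, n)) : \dim (row_vspace U) = \rank U.
Proof.
have -> : row_vspace U = row_vspace (row_base U).
  by apply/vspaceP=> v; rewrite !mem_row_vspace eq_row_base.
rewrite limg_dim_eq ?dimvf /dim /= ?mul1n //.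
apply/eqP; rewrite -subv0; apply/subvP=> x; rewrite memv_cap memvf memv_ker lfunE /=.
move=> /eqP/(congr1 trmx); rewrite trmxK trmx0 memv0 => xU.
by apply/eqP/(row_free_inj (row_base_free U)); rewrite xU mul0mx.
Qed.

Lemma row_vspace_surj (V : {vspace 'cV[F]_n}) : exists U : 'M[F]_n, V = row_vspace U.
Proof.
pose U := \matrix_(i < \dim V) ((vbasis V)`_i)^T.
exists (genmx U); apply/vspaceP=> v; rewrite mem_row_vspace genmxE; apply/idP/idP.
  move=> /coord_vbasis ->; rewrite linear_sum summx_sub // => i _.
  by rewrite linearZ scalemx_sub // (submx_trans _ (row_sub i U)) // rowK.
case/submxP=> x /(congr1 trmx); rewrite trmxK => ->.
rewrite mulmx_sum_row linear_sum; apply: rpred_sum => i _.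
by rewrite linearZ rowK /= trmxK rpredZ // vbasis_mem // mem_nth // size_tuple.
Qed.

End RowVspace.

Section MatrixSpan.
Variables (F : fieldType) (n p : nat) (A : 'I_p -> 'M[F]_n).
Local Notation a := (fun t => (A t)^T).

Lemma mem_mxspan t : A t \in mxspan A.
Proof. by apply: memv_span; apply: map_f; rewrite mem_enum. Qed.

Lemma mxact_row_vspace (U : 'M[F]_n) :
  mxact (mxspan A) (row_vspace U) = row_vspace (rowact a U).
Proof.
apply/eqP; rewrite eqEsubv; apply/andP; split; last first.
  apply/subvP => v; rewrite mem_row_vspace => /sub_sumsmxP[u vE].
  rewrite -[v]trmxK vE linear_sum; apply: rpred_sum => t _ /=.
  rewrite mulmxA trmx_mul trmxK.
  apply: (mxact_sub _ _ _).1 (subvv _) _ _ (mem_mxspan t) _.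
  by rewrite mem_row_vspace trmxK submxMl.
apply/mxact_sub => B u BA; rewrite !mem_row_vspace => uU; rewrite trmx_mul.
have /allP/= actA : all (fun B : 'M[F]_n => (U *m B^T <= rowact a U)%MS) [seq A t | t <- enum 'I_p].
  by apply/allP => _ /mapP[t _ ->]; exact: (rowact_subP _ _ _ (submx_refl _)).
apply: submx_trans (submxMr _ uU) _.
rewrite (coord_span BA) linear_sum mulmx_sumr summx_sub // => i _.
by rewrite linearZ /= -scalemxAr scalemx_sub // actA // mem_nth // size_tuple.
Qed.

Lemma row_ncrank_mxspan : row_ncrank a (ncrank (mxspan A)).
Proof.
rewrite /ncrank; case: ex_minnP => r /asboolP[V rE] rmin; split.
  by have [U VE] := row_vspace_surj V; exists U; rewrite rE VE mxact_row_vspace !dim_row_vspace.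
move=> U; apply: rmin; apply/asboolP; exists (row_vspace U).
by rewrite mxact_row_vspace !dim_row_vspace.
Qed.

Lemma min_shrunk_row_vspace c U :
  row_min_shrunk a c U -> min_shrunk (mxspan A) c (row_vspace U).
Proof.
case=> sU mU; split; first by rewrite /shrunk mxact_row_vspace !dim_row_vspace.
move=> V; have [W ->] := row_vspace_surj V; rewrite /shrunk mxact_row_vspace !dim_row_vspace.
by rewrite row_vspace_sub => /mU.
Qed.

Lemma trmx_blowup d (X : 'I_p -> 'M[F]_d) : (blowup A X)^T = blowup a (fun t => (X t)^T).
Proof. by rewrite linear_sum; apply: eq_bigr => t _; exact: trmx_tens. Qed.

End MatrixSpan.

Lemma blowup_attains_attaining (R : realType) n p d (A : 'I_p -> 'M[R[i]]_n) :
  (0 < d)%N -> blowup_attains A d -> exists X : 'I_p -> 'M[R[i]]_d,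
    attaining (fun t => (A t)^T) X.
Proof.
move=> d0 [X XE]; exists (fun t => (X t)^T) => d' Y.
have [d'E|d'0] := posnP d'.
  have := rank_leq_col (blowup (fun t => (A t)^T) Y); move: (\rank (blowup _ Y)) => x.
  by rewrite d'E !muln0 leqn0 => /eqP->; rewrite mul0n.
rewrite -trmx_blowup mxrank_tr.
have -> : blowup (fun t => (A t)^T) Y = (blowup A (fun t => (Y t)^T))^T.
  by rewrite trmx_blowup; apply: eq_bigr => t _; rewrite trmxK.
rewrite mxrank_tr; set Z := fun t => (Y t)^T.
have sup_ratios : has_sup (blowup_ratios A).
  split; first by exists ((\rank (blowup A X))%:R / d%:R), d, X.
  exists n%:R => _ [e [W [e0 ->]]].
  by rewrite ler_pdivrMr ?ltr0n // -natrM ler_nat rank_leq_col.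
have : (\rank (blowup A Z))%:R / d'%:R <= sup (blowup_ratios A).
  by apply: sup_upper_bound => //; exists d', Z.
by rewrite -XE ler_pdivrMr ?ltr0n // mulrAC ler_pdivlMr ?ltr0n // -!natrM ler_nat.
Qed.

Section Generators.
Variables (F : fieldType) (n p m : nat) (A : 'I_p -> 'M[F]_n) (A' : 'I_m -> 'M[F]_n).

Lemma blowup_lincomb d (c : 'I_p -> 'I_m -> F) (X : 'I_p -> 'M[F]_d) :
  (forall t, A t = \sum_l c t l *: A' l) ->
  blowup A X = blowup A' (fun l => \sum_t c t l *: X t).
Proof.
move=> AE; apply/matrixP=> i j.
case: (mxtens_indexP i) => i1 i2; case: (mxtens_indexP j) => j1 j2; rewrite !summxE.
under eq_bigr => t _ do rewrite tensmxE AE summxE mulr_suml.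
rewrite exchange_big; apply: eq_bigr => l _; rewrite tensmxE summxE mulr_sumr.
by apply: eq_bigr => t _; rewrite !mxE [RHS]mulrCA mulrA.
Qed.

End Generators.

Section SpanningSubfamily.
Variables (F : fieldType) (n p m : nat) (A : 'I_p -> 'M[F]_n) (A' : 'I_m -> 'M[F]_n).
Hypothesis A_span : forall t, exists c : 'I_m -> F, A t = \sum_l c l *: A' l.
Hypothesis A'_sub : forall l, exists t, A' l = A t.

Lemma mxspan_subfamily : mxspan A' = mxspan A.
Proof.
apply/eqP; rewrite eqEsubv; apply/andP; split; apply/span_subvP=> _ /mapP[t _ ->].
  by have [u ->] := A'_sub t; exact: mem_mxspan.
by have [c ->] := A_span t; apply: rpred_sum => l _; rewrite rpredZ // mem_mxspan.
Qed.

Lemma attaining_subfamily d (X : 'I_p -> 'M[F]_d) : attaining (fun t => (A t)^T) X ->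
  exists X' : 'I_m -> 'M[F]_d, attaining (fun l => (A' l)^T) X'.
Proof.
have /fin_all_exists[c cE] := A_span; have /fin_all_exists[g gE] := A'_sub.
move=> aX; exists (fun l => \sum_t c t l *: X t) => d' Y.
rewrite -(@blowup_lincomb _ _ _ _ (fun t => (A t)^T)) => [|t]; last first.
  by rewrite cE linear_sum; apply: eq_bigr => l _; rewrite linearZ.
rewrite (@blowup_lincomb _ _ _ _ _ (fun t => (A t)^T) _ (fun l t => (t == g l)%:R)) => [|l].
  exact: aX.
rewrite gE (bigD1 (g l)) //= eqxx scale1r big1 ?addr0 // => t /negPf ->; exact: scale0r.
Qed.

End SpanningSubfamily.

(** * Magnitudes *)

Section GaussianIntegers.
Variable R : realType.
Local Notation F := R[i].

Definition gauss : {pred F} := [pred z | `[< gaussint z >]].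

Lemma gauss_subring : subring_closed gauss.
Proof.
split=> [|x y /asboolP[a [b ->]] /asboolP[a' [b' ->]]|x y /asboolP[a [b ->]] /asboolP[a' [b' ->]]];
  apply/asboolP; first by exists 1, 0.
  by exists (a - a'), (b - b'); rewrite !rmorphB.
by exists (a * a' - b * b'), (a * b' + b * a'); rewrite !rmorphB !rmorphD !rmorphM.
Qed.

HB.instance Definition _ := GRing.isSubringClosed.Build F gauss gauss_subring.

Lemma gauss_boundedP (H : R) (z : F) :
  reflect (gaussint z /\ magnitude z <= H) (z \in bounded_in gauss H%:C%C).
Proof.
rewrite inE [`|z|]/(Normc.normc z)%:C%C lecR.
by apply: (iffP andP) => -[/asboolP].
Qed.

Lemma minor_boundC (H : R) D : (minor_bound H D)%:C%C = minor_bound H%:C%C D.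
Proof. by rewrite rmorphM rmorphXn rmorph_nat. Qed.

End GaussianIntegers.

Lemma leq_fact_exp n : (n`! <= n ^ n)%N.
Proof.
have -> : (n ^ n = \prod_(1 <= i < n.+1) n)%N by rewrite prod_nat_const_nat subn1.
by rewrite fact_prod big_nat [leqRHS]big_nat; apply: leq_prod => i /andP[_ /ltnSE].
Qed.

Section ValueBound.
Variables (R : realFieldType) (x : R).
Hypothesis x1 : 1 <= x.

Lemma minor_bound_le_exp H D a b : 0 <= H -> H <= x ^+ b -> D.+1%:R <= x ^+ a ->
  minor_bound H D <= x ^+ (a * D.+1 + b * D).
Proof.
move=> H_ge0 Hx Dx; have x0 : 0 <= x by apply: le_trans x1.
rewrite exprD !exprM ler_pM ?exprn_ge0 ?ler0n ?lerXn2r ?nnegrE ?exprn_ge0 //.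
apply: le_trans (_ : (D.+1 ^ D.+1)%:R <= _); first by rewrite ler_nat leq_fact_exp.
by rewrite natrX lerXn2r ?nnegrE ?ler0n ?exprn_ge0.
Qed.

Lemma value_bound_le_exp M N (H := (N ^ 2)%:R * M * (4 * N ^ 5)%:R) (D := (4 * N ^ 2)%N) :
  (0 < N)%N -> 0 <= M -> 2 <= x -> M <= x -> N%:R <= x ->
  D%:R * H * minor_bound H D <= x ^+ (79 * N ^ 2).
Proof.
move=> N0 M0 x2 Mx Nx; have x0 : 0 <= x by apply: le_trans x1.
have NX k : (N ^ k)%:R <= x ^+ k by rewrite natrX lerXn2r ?nnegrE ?ler0n.
have x4 : 4 <= x ^+ 2.
  by rewrite (_ : 4 = 2 ^+ 2) ?lerXn2r ?nnegrE ?ler0n // -natrX.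
have HX : H <= x ^+ 10.
  rewrite (_ : x ^+ 10 = x ^+ 2 * x * (x ^+ 2 * x ^+ 5)); last by rewrite -!exprD -!exprSr -exprD.
  by rewrite /H natrM !ler_pM ?mulr_ge0 ?ler0n ?NX.
have H_ge0 : 0 <= H by rewrite !mulr_ge0 ?ler0n.
have DX : D%:R <= x ^+ 4.
  by rewrite /D natrM (exprD _ 2 2) ler_pM ?ler0n ?NX.
have DX' : D.+1%:R <= x ^+ 5.
  rewrite -natr1 exprS; apply: (@le_trans _ _ (x ^+ 4 + x ^+ 4)).
    by rewrite lerD // exprn_ege1.
  by rewrite -mulr2n -mulr_natl ler_wpM2r ?exprn_ge0.
apply: (@le_trans _ _ (x ^+ (4 + 10 + (5 * D.+1 + 10 * D)))).
  rewrite exprD (exprD _ 4 10) ler_pM ?mulr_ge0 ?exprn_ge0 ?ler0n //.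
    by rewrite ler_pM ?ler0n.
  exact: minor_bound_le_exp.
have N2 : (0 < N ^ 2)%N by rewrite expn_gt0 N0.
by rewrite ler_weXn2l //; move: N2; rewrite /D; move: (N ^ 2)%N => y; clear; lia.
Qed.

End ValueBound.

(** * The algorithm *)

Definition shrunk_program : cmd := select ;; draws ;; blowups ;; chains ;; emit.

(** ** Running time *)

Section Costs.
Variable R : realType.
Local Notation st := (state R[i]).
Implicit Types s : st.

Lemma insert_cost_bound r W : (0 < W)%N -> r reg_W = W -> (cost_bound r insert <= 100 * (W * W))%N.
Proof.
move=> W0 rW; rewrite [cost_bound _ _]/= !rW.
have : (W <= W * W)%N by nia.
have : (1 <= W * W)%N by nia.
by lia.
Qed.

Lemma select_cost s n p : ireg s reg_n = n -> ireg s reg_p = p -> (0 < n)%N -> (0 < p)%N ->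
  always (exec select s) (fun s' => (cost s' <= 300 * (p * (n * n) * (n * n)) + cost s)%N).
Proof.
move=> sn sp n0 p0; step; set s1 := tick 1 _; set W := (n * n)%N.
have W0 : (0 < W)%N by rewrite muln_gt0 n0.
have rW : ireg s1 reg_W = W by rewrite /s1 /= /upd /= sn.
have rp : ireg s1 reg_p = p by rewrite /s1 /= /upd /= sp.
apply: always_mono (exec_cost_bound (r := ireg s1) _ _) => // s'.
rewrite [cost s1]/(1 + cost s)%N; move: (cost s') (cost s) => x y.
have := insert_cost_bound W0 rW; move: rW rp; move: (ireg s1) => r rW rp insert_le.
rewrite [cost_bound _ _]/= -/(cost_bound r insert) rW rp.
move: (cost_bound r insert) insert_le => ci insert_le.
have : (p * ci <= p * (100 * (W * W)))%N by rewrite leq_mul2l insert_le orbT.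
have : (p * W <= p * (W * W))%N by rewrite leq_mul2l leq_pmulr ?orbT.
have : (W * W <= p * (W * W))%N by rewrite leq_pmull.
have : (p <= p * W)%N by rewrite leq_pmulr.
have : (W <= p * W)%N by rewrite leq_pmull.
by rewrite -mulnA; lia.
Qed.

Lemma draws_cost s n d m : ireg s reg_n = n -> ireg s reg_d = d -> ireg s reg_sel = m ->
  always (exec draws s) (fun s' => (cost s' <= 1 + 3 * ((n * d + 1) * m * d * d) + cost s)%N).
Proof.
move=> sn sd sm; apply: always_mono (exec_cost_bound (r := ireg s) _ _) => // s'.
by rewrite [cost_bound _ _]/= sn sd sm; move: (cost s') (cost s) => x y; lia.
Qed.

Lemma blowups_cost s n d m : ireg s reg_n = n -> ireg s reg_d = d -> ireg s reg_sel = m ->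
  (0 < n)%N -> (0 < d)%N ->
  always (exec blowups s) (fun s' =>
    (cost s' <= 1 + (n * d + 1) * (n * d * (n * d) * (20 + 20 * m)) + cost s)%N).
Proof.
move=> sn sd sm n0 d0; apply: always_mono (exec_cost_bound (r := ireg s) _ _) => // s'.
rewrite [cost_bound _ _]/= sn sd sm; move: (cost s') (cost s) => x y cost_le.
apply: leq_trans cost_le _; rewrite leq_add2r.
set c1 := (X in (_ * X)%N); suff c1_le : (c1 <= n * d * (n * d) * (20 + 20 * m))%N.
  by rewrite add1n ltnS leq_mul2l c1_le orbT.
by rewrite /c1; nia.
Qed.

Lemma chains_cost s n d (N := (n * d)%N) : ireg s reg_n = n -> ireg s reg_d = d -> (0 < N)%N ->
  always (exec chains s) (fun s' => (cost s' <= 2000 * (N * N * N * N) + cost s)%N).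
Proof.
move=> sn sd N0; step; set s1 := tick 1 _.
have rW : ireg s1 reg_W = (N + N)%N by rewrite /s1 /= /upd /= sn sd.
have rn : ireg s1 reg_n = n by rewrite /s1 /= /upd.
have rd : ireg s1 reg_d = d by rewrite /s1 /= /upd.
apply: always_mono (exec_cost_bound (r := ireg s1) _ _) => // s'.
rewrite [cost s1]/(1 + cost s)%N; move: (cost s') (cost s) => x y.
have NN0 : (0 < N + N)%N by rewrite addn_gt0 N0.
have := insert_cost_bound NN0 rW; move: rW rn rd; move: (ireg s1) => r rW rn rd insert_le.
rewrite [cost_bound _ _]/= -/(cost_bound r insert) rW rn rd -/N.
move: (cost_bound r insert) insert_le => ci insert_le.
have : (N * N * ci <= N * N * (100 * ((N + N) * (N + N))))%N by rewrite leq_mul2l insert_le orbT.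
have : (N * ci <= N * N * ci)%N by nia.
have : (N <= N * N)%N by nia.
have : (N * N <= N * N * N)%N by nia.
have : (N * N * N <= N * N * N * N)%N by nia.
by lia.
Qed.

Lemma emit_cost s n : ireg s reg_n = n -> (0 < n)%N ->
  always (exec emit s) (fun s' => (cost s' <= 20 * (n * n) + cost s)%N).
Proof.
move=> sn n0; apply: always_mono (exec_cost_bound (r := ireg s) _ _) => // s'.
rewrite [cost_bound _ _]/= sn; move: (cost s') (cost s) => x y.
have : (n <= n * n)%N by nia.
by lia.
Qed.

Lemma total_cost n p d m c0 c1 c2 c3 c4 c5 (N := (n * d)%N) :
  (0 < n)%N -> (0 < d)%N -> (0 < p)%N -> (m <= p)%N ->
  (c1 <= 300 * (p * (n * n) * (n * n)) + c0)%N ->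
  (c2 <= 1 + 3 * ((N + 1) * m * d * d) + c1)%N ->
  (c3 <= 1 + (N + 1) * (N * N * (20 + 20 * m)) + c2)%N ->
  (c4 <= 2000 * (N * N * N * N) + c3)%N -> (c5 <= 20 * (n * n) + c4)%N ->
  (c5 <= 3000 * (p * d ^ 4 * n ^ 4) + c0)%N.
Proof.
move=> n0 d0 p0 mp; have N0 : (0 < N)%N by rewrite muln_gt0 n0.
have -> : (p * d ^ 4 * n ^ 4 = p * (N * N * N * N))%N by rewrite /N; lia.
have nN : (n <= N)%N by rewrite leq_pmulr.
have dN : (d <= N)%N by rewrite leq_pmull.
clearbody N; set T := (N * N * N * N)%N; have T0 : (0 < T)%N by rewrite !muln_gt0 N0.
have Tp : (T <= p * T)%N by rewrite leq_pmull.
have emit_le : (n * n <= T)%N.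
  by apply: leq_trans (leq_mul nN nN) _; rewrite /T -mulnA leq_pmulr // muln_gt0 N0.
have select_le : (p * (n * n) * (n * n) <= p * T)%N.
  by rewrite -mulnA leq_mul2l /T -(mulnA (N * N)) !leq_mul ?orbT.
have pN : (p * (N * N * N) <= p * T)%N by rewrite leq_mul2l /T leq_pmulr ?orbT.
have draws_le : ((N + 1) * m * d * d <= 2 * (p * T))%N.
  apply: (@leq_trans (2 * N * p * N * N)); first by rewrite !leq_mul //; lia.
  by move: pN; move: (p * T)%N => w; lia.
have blowups_le : ((N + 1) * (N * N * (20 + 20 * m)) <= 80 * (p * T))%N.
  apply: (@leq_trans (2 * N * (N * N * (40 * p)))); first by rewrite !leq_mul //; lia.
  by move: pN; move: (p * T)%N => w; lia.
clear pN; move: T0 Tp emit_le select_le draws_le blowups_le;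
  move: (p * T)%N (n * n)%N (p * _ * _)%N => y z u.
move: T ((N + 1) * _)%N ((N + 1) * m * d * d)%N => T v w; clear; lia.
Qed.

Lemma shrunk_program_cost s n p d : ireg s reg_n = n -> ireg s reg_p = p -> ireg s reg_d = d ->
  (0 < n)%N -> (0 < p)%N -> (0 < d)%N ->
  always (exec select s) (fun s' => (ireg s' reg_sel <= p)%N) ->
  always (exec shrunk_program s) (fun s' => (cost s' <= 3000 * (p * d ^ 4 * n ^ 4) + cost s)%N).
Proof.
move=> sn sp sd n0 p0 d0 sel_le.
apply: exec_seq; apply: always_mono (always_and sel_le (select_cost sn sp n0 p0)).
move=> s1 [mp c1] [f_ireg _ _].
have {f_ireg} [s1n s1d] : ireg s1 reg_n = n /\ ireg s1 reg_d = d by rewrite !f_ireg.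
apply: exec_seq; apply: always_mono (draws_cost s1n s1d erefl) => s2 c2 [f_sreg _ _].
have {f_sreg} [s2n s2d s2m] : [/\ ireg s2 reg_n = n, ireg s2 reg_d = d &
    ireg s2 reg_sel = ireg s1 reg_sel] by rewrite !f_sreg.
apply: exec_seq; apply: always_mono (blowups_cost s2n s2d s2m n0 d0) => s3 c3 [f_arr _ _].
have {f_arr} [s3n s3d] : ireg s3 reg_n = n /\ ireg s3 reg_d = d by rewrite !f_arr.
have N0 : (0 < n * d)%N by rewrite muln_gt0 n0.
apply: exec_seq; apply: always_mono (chains_cost s3n s3d N0) => s4 c4 [f4 _ _].
have {f4} s4n : ireg s4 reg_n = n by rewrite f4.
apply: always_mono (emit_cost s4n n0) => s5 c5.
exact: total_cost n0 d0 p0 mp c1 c2 c3 c4 c5.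
Qed.

End Costs.

(** ** Correctness *)

Section SelectedMatrices.
Variables (R : realType) (n p m : nat) (A : 'I_p -> 'M[R[i]]_n) (sel : nat -> R[i]).
Hypothesis selP : selected (n * n) (input_arr A 0) p m sel.
Local Notation A' := (fun l : 'I_m => matarr n sel l).

Lemma matarr_input (t : 'I_p) : matarr n (input_arr A 0) t = A t.
Proof.
apply/matrixP=> i j; rewrite mxE /input_arr eqxx.
have posE (t' : 'I_p) (i' j' : 'I_n) : ((t * n + i) * n + j == (t' * n + i') * n + j')%N =
    [&& t == t', i == i' & j == j'].
  by rewrite !eq_addl_mul // !xpair_eqE eq_addl_mul // xpair_eqE -!val_eqE -andbA.
rewrite (bigD1 t) //= (bigD1 i) //= (bigD1 j) //= posE !eqxx mulr1n !big1 ?addr0 //.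
- move=> t' tt; rewrite big1 // => i' _; rewrite big1 // => j' _.
  by rewrite posE eq_sym (negPf tt).
- by move=> i' ii; rewrite big1 // => j' _; rewrite posE [i == _]eq_sym (negPf ii) andbF.
- by move=> j' jj; rewrite posE [j == _]eq_sym (negPf jj) !andbF.
Qed.

Lemma arr_lineE (f : nat -> R[i]) t (i j : 'I_n) :
  arr_line (n * n) f t 0 (mxtens_index (i, j)) = matarr n f t i j.
Proof. by rewrite !mxE /= mulnA mulnDl addnA. Qed.

Lemma selected_matarr l : exists t, A' l = A t.
Proof.
case: selP => _ _ orig _; have [t tp lineE] := orig l (ltn_ord l); exists (Ordinal tp).
by rewrite -matarr_input; apply/matrixP=> i j; rewrite -!arr_lineE lineE.
Qed.

Lemma matarr_selected t : exists c, A t = \sum_l c l *: A' l.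
Proof.
case: selP => _ _ _ span; have /submxP[D lineE] := submx_trans (row_sub t _) span.
exists (D 0); apply/matrixP=> i j; rewrite -matarr_input -arr_lineE -row_mxarr lineE mxE summxE.
by apply: eq_bigr => l _; rewrite !mxE /= mulnA mulnDl addnA.
Qed.

Lemma selected_leq : (m <= n * n)%N.
Proof. by case: selP => _ /eqP <- _ _; exact: rank_leq_col. Qed.

Lemma selected_mxspan : mxspan A' = mxspan A.
Proof. exact: mxspan_subfamily matarr_selected selected_matarr. Qed.

Lemma selected_row_ncrank : row_ncrank (fun l => (A' l)^T) (ncrank (mxspan A)).
Proof. rewrite -selected_mxspan; exact: row_ncrank_mxspan. Qed.

Lemma selected_full_rank d : (0 < d)%N -> blowup_attains A d ->
  exists X : 'I_m -> 'M[R[i]]_d,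
    \rank (blowup (fun l => (A' l)^T) X) = (ncrank (mxspan A) * d)%N.
Proof.
move=> d0 /(blowup_attains_attaining d0)[X0].
case/(attaining_subfamily matarr_selected selected_matarr) => X aX; exists X.
exact: attaining_ncrank selected_row_ncrank aX.
Qed.

Lemma trmx_sel_blowup d rand t :
  (sel_blowup n d m sel rand t)^T = drawn_blowup d (fun l => (A' l)^T) rand t.
Proof.
rewrite trmx_blowup; apply: eq_bigr => l _; congr (_ *t _).
by apply/matrixP=> b' b; rewrite !mxE.
Qed.

End SelectedMatrices.

Lemma half_le_onem x y e : (2 * (x * y) <= e.+1)%N ->
  (1 / 2 : rat) <= 1 - x%:R * (y%:R / e.+1%:R).
Proof.
move=> le_e; rewrite mulrA -natrM lerBrDr -lerBrDl ler_pdivrMr; last exact: ltr0Sn.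
have -> : (1 - 1 / 2 : rat) = 2^-1 by [].
by rewrite mulrC ler_pdivlMr ?ltr0n // -natrM ler_nat mulnC.
Qed.

Lemma failure_bound n d m (N := (n * d)%N) : (0 < N)%N -> (m <= n * n)%N ->
  (1 / 2 : rat) <= 1 - (N.+1 * m * d * d)%:R * ((N * N)%:R / (4 * N ^ 5).+1%:R).
Proof.
move=> N0 mn; have mN : (m * d * d <= N * N)%N by rewrite -mulnA mulnACA leq_mul2r mn orbT.
clearbody N; apply: half_le_onem; have draws_le : (N.+1 * m * d * d <= 2 * N * (N * N))%N.
  rewrite -(mulnA N.+1 m) -(mulnA N.+1 (m * d)); apply: leq_mul mN.
  by move: N0; clear; lia.
apply: leq_trans (leq_mul (leqnn 2) (leq_mul draws_le (leqnn (N * N)))) _.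
by apply/leqW/eq_leq; rewrite !expnS expn0; clear; lia.
Qed.

Section Run.
Variables (R : realType) (n p d k : nat) (M : R) (A : 'I_p -> 'M[R[i]]_n).
Hypotheses (n0 : (0 < n)%N) (d0 : (0 < d)%N) (M1 : 1 <= M).
Hypothesis A_bounded : forall t i j, gaussint (A t i j) /\ magnitude (A t i j) <= M.
Local Notation F := R[i].
Local Notation st := (state F).
Implicit Types s : st.
Local Notation N := (n * d)%N.
Local Notation range := (4 * N ^ 5)%N.
Local Notation H := ((N ^ 2)%:R * M * range%:R).
Local Notation D0 := (4 * N ^ 2)%N.
Local Notation bounded B := (bounded_in (@gauss R) B%:C%C).
Local Notation ok := (bounded (D0%:R * H * minor_bound H D0)).
Local Notation entry := (bounded H).
Local Notation s0 := (input d k A).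
Local Notation r := (ncrank (mxspan A)).

Let N0 : (0 < N)%N. Proof. by rewrite muln_gt0 n0. Qed.

Let range_leq : range%:R <= H.
Proof. by rewrite ler_peMl ?ler0n // mulr_ege1 // ler1n expn_gt0 N0. Qed.

Lemma M_le_entry : M <= H.
Proof.
have M0 : 0 <= M := le_trans ler01 M1.
have range0 : (0 < range)%N by rewrite muln_gt0 expn_gt0 N0.
rewrite -[leLHS]mulr1 ler_pM ?ler1n //.
by rewrite ler_peMl // ler1n expn_gt0 N0.
Qed.

Lemma entry_elimination_safe : elimination_safe entry ok D0.
Proof.
rewrite (_ : (D0%:R * H * minor_bound H D0)%:C%C = D0%:R * H%:C%C * minor_bound H%:C%C D0);
  last first.
  by rewrite -minor_boundC 2!rmorphM rmorph_nat.
apply: bounded_elimination_safe; last by rewrite muln_gt0 expn_gt0 N0.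
by rewrite -(rmorph1 (real_complex R)) lecR (le_trans M1 M_le_entry).
Qed.

Lemma bounded_leq B B' : B <= B' -> {subset bounded B <= bounded B'}.
Proof. by move=> BB' z /gauss_boundedP[gz zB]; apply/gauss_boundedP; rewrite (le_trans zB). Qed.

Lemma input_entry t : (t < p)%N -> arr_line (n * n) (arr s0 arr_in) t \is a mxOver entry.
Proof.
move=> tp; apply/mxOverP=> i j; rewrite ord1; case: (mxtens_indexP j) => j1 j2.
rewrite arr_lineE (matarr_input A (Ordinal tp)); apply: bounded_leq M_le_entry _ _.
exact/gauss_boundedP.
Qed.

Definition chosen s :=
  [/\ stored_ok ok s, selected (n * n) (input_arr A 0) p (ireg s reg_sel) (arr s arr_sel),
      ireg s reg_n = n, ireg s reg_d = d & ireg s reg_out = 0%N].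

Lemma select_chosen : always (exec select s0) chosen.
Proof.
have WD : (n * n <= D0)%N.
  by apply: (@leq_trans (N ^ 2)); [rewrite -mulnn leq_mul // leq_pmulr|rewrite leq_pmull].
have select_ok :=
  select_spec entry_elimination_safe WD (s := s0) erefl erefl erefl erefl _ input_entry.
apply: always_mono (always_and (select_ok _) (exec_frame _ _)) => // s.
by case=> -[oks selP] [f_ireg _ _]; split=> //; rewrite f_ireg.
Qed.

Section Chosen.
Variables (m : nat) (sel : nat -> F).
Hypothesis selP : selected (n * n) (input_arr A 0) p m sel.
Local Notation a := (fun l : 'I_m => (matarr n sel l)^T).
Variable U : 'M[F]_n.
Hypothesis minU : row_min_shrunk a (n - r) U.
Let rP : row_ncrank a r := selected_row_ncrank selP.

Definition sampled s :=
  [/\ stored_ok ok s, blowup_input n d m sel (arr s arr_rand) s, ireg s reg_out = 0%N &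
      forall e, (e < N.+1 * m * d * d)%N -> arr s arr_rand e \in bounded range%:R].

Definition succeeds s := exists V : {vspace 'cV[F]_n},
  min_shrunk (mxspan A) (n - r) V /\ basis_of V (output n s).

Lemma sel_blowup_entry rand t : (t <= N)%N ->
  (forall e, (e < N.+1 * m * d * d)%N -> rand e \in bounded range%:R) ->
  sel_blowup n d m sel rand t \is a mxOver entry.
Proof.
move=> tN small; apply/mxOverP=> i j; case: (mxtens_indexP i) => i1 b;
  case: (mxtens_indexP j) => j1 b'.
have m_le : m%:R * (M * range%:R) <= H.
  rewrite mulrA !ler_wpM2r ?ler0n ?(le_trans ler01 M1) // ler_nat.
  by apply: leq_trans (selected_leq selP) _; rewrite -mulnn leq_mul // leq_pmulr.
apply: bounded_leq m_le _ _; rewrite 2!rmorphM rmorph_nat summxE.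
under eq_bigr => l _ do rewrite tensmxE [X in _ * X]mxE.
apply: sum_mul_bounded => l; last exact/small/ltn_draw_index.
by have [t' ->] := selected_matarr selP l; apply/gauss_boundedP.
Qed.

Lemma ndrawsE s : ireg s reg_n = n -> ireg s reg_d = d -> ireg s reg_sel = m ->
  ieval (ireg s) ndraws = (N.+1 * m * d * d)%N.
Proof. by move=> sn sd sm; rewrite /= sn sd sm addn1. Qed.

Lemma draw_rangeE s : ireg s reg_n = n -> ireg s reg_d = d -> ieval (ireg s) draw_range = range.
Proof. by move=> sn sd; rewrite /= sn sd !expnS expn0 muln1 !mulnA. Qed.

Lemma draws_sampled s : chosen s -> ireg s reg_sel = m -> arr s arr_sel = sel ->
  always (exec draws s) sampled.
Proof.
move=> [oks _ sn sd s_out] sm ssel; have [_ _ entry_ok _] := entry_elimination_safe.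
apply: always_mono (always_and (draws_spec (small := bounded range%:R) (ndrawsE sn sd sm)
  (draw_rangeE sn sd) oks _ _) (exec_frame _ _)).
- by move=> s' [[oks' small] [f_ireg _ f_arr]]; split=> //;
    [split; rewrite ?f_ireg ?(f_arr arr_sel)|rewrite f_ireg].
- by move=> j jE; rewrite inE rpred_nat normr_nat rmorph_nat ler_nat.
by move=> z /(bounded_leq range_leq)/entry_ok.
Qed.

Lemma emit_basis s P : ireg s reg_n = n -> ireg s reg_d = d -> ireg s reg_W = (N + N)%N ->
  ireg s reg_out = 0%N -> stored_ok ok s -> sreg s sc_den != 0 -> corner n d s \is a mxOver ok ->
  corner n d s = sreg s sc_den *: P -> reduced_proj P ->
  always (exec emit s) (fun s' => stored_ok ok s' /\
    ((forall x : 'cV[F]_N, P *m x = x <-> (x^T <= U *t (1%:M : 'M[F]_d))%MS) -> succeeds s')).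
Proof.
move=> sn sd sW s_out oks den0 /mxOverP okP cP rP'; pose b := Ordinal d0.
have cornerE (i j : 'I_n) : strided n d (N + N) (arr s arr_proj) i j =
    corner n d s (mxtens_index (i, b)) (mxtens_index (j, b)) by rewrite !mxE /= !addn0.
have QE : strided n d (N + N) (arr s arr_proj) =
    sreg s sc_den *: ((slice F n b)^T *m P *m slice F n b).
  apply/matrixP=> i j; rewrite cornerE cP mxE [RHS]mxE; congr (_ * _).
  by rewrite -mulmxA trslice_mulmxE mulmx_sliceE.
apply: always_mono (emit_spec sn sd sW s_out oks _) => [s' [oks' out]|]; last first.
  by apply/mxOverP=> i j; rewrite cornerE.
split=> // PU; exists (row_vspace U); split.
  by rewrite -(selected_mxspan selP); apply: min_shrunk_row_vspace; rewrite (selected_mxspan selP).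
rewrite out QE; apply: reduced_columns_basis => // [|x]; first exact: reduced_proj_slices.
by rewrite mem_row_vspace; apply: fixed_slices.
Qed.

Lemma finish_spec s : sampled s ->
  always (exec (blowups ;; chains ;; emit) s)
    (fun s' => stored_ok ok s' /\ (good_draws d a r U (arr s arr_rand) -> succeeds s')).
Proof.
move=> [oks inp s_out small]; have [sn sd _ _ _] := inp.
have [_ _ entry_ok _] := entry_elimination_safe.
have entryC t : (t <= N)%N -> sel_blowup n d m sel (arr s arr_rand) t \is a mxOver entry.
  by move=> tN; exact: sel_blowup_entry.
apply: exec_seq; apply: always_mono (blowups_spec n0 d0 _ inp oks) => [s1|t /entryC]; last first.
  exact: mxOverS.
move=> [oks1 blowE] [f_ireg _ _].
have [s1n s1d] : ireg s1 reg_n = n /\ ireg s1 reg_d = d by rewrite !f_ireg.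
have DD : (N * (N + 3) <= D0)%N by move: N0; move: N => x; clear; nia.
have chains_ok := chains_spec entry_elimination_safe DD _ s1n s1d erefl oks1.
apply: exec_seq; apply: always_mono (chains_ok _) => [s2|t tN]; last first.
  by rewrite blowE // entryC.
move=> [oks2 s2W den0 okP [P [cP rP' PC]]] [g_ireg _ _].
have [s2n s2d s2_out] : [/\ ireg s2 reg_n = n, ireg s2 reg_d = d & ireg s2 reg_out = 0%N].
  by split; rewrite g_ireg // f_ireg.
apply: always_mono (emit_basis s2n s2d s2W s2_out oks2 den0 okP cP rP') => s3 [oks3 basis].
split=> // good; apply: basis => x; rewrite PC.
apply: (in_chain_good_draws d0 rP minU _ good) => t tN.
by rewrite blowE // trmx_sel_blowup.
Qed.

Lemma draws_good s : blowup_attains A d -> chosen s -> ireg s reg_sel = m ->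
  1 / 2 <= prob (exec draws s) (fun s' => good_draws d a r U (arr s' arr_rand)).
Proof.
move=> attains [_ _ sn sd _] sm; apply: le_trans (failure_bound N0 (selected_leq selP)) _.
apply: le_trans (draws_prob (b := N * N) (I := completable d a r U) (ndrawsE sn sd sm)
  (draw_rangeE sn sd) _ _) (le_prob (alwaysT _) _).
- exact: completable0 (selected_full_rank selP d0 attains).
- by move=> e x _; exact: card_not_completable.
by move=> s' _; exact: completable_good.
Qed.

End Chosen.

Lemma run_stored_ok : always (exec shrunk_program s0) (stored_ok ok).
Proof.
apply: exec_seq; apply: always_mono select_chosen => s cs _; have [_ selP _ _ _] := cs.
have [U minU] := exists_row_min_shrunk (selected_row_ncrank selP).
apply: exec_seq; apply: always_mono (draws_sampled cs erefl erefl) => s1 ss _.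
by apply: always_mono (finish_spec selP minU ss) => s2 [].
Qed.

Lemma run_succeeds : blowup_attains A d -> 1 / 2 <= prob (exec shrunk_program s0) succeeds.
Proof.
move=> attains; have continue := @prob_rbind_always _ _ (exec select s0)
  (exec (draws ;; blowups ;; chains ;; emit)).
apply: continue select_chosen _ => s cs; have [_ selP _ _ _] := cs.
have [U minU] := exists_row_min_shrunk (selected_row_ncrank selP).
have good := draws_good selP minU attains cs erefl.
have good' := le_prob (draws_sampled cs erefl erefl) (fun s' ss gs => conj ss gs).
rewrite -[leLHS]subr0; apply: le_trans (lerB (le_trans good (good' _)) (lexx 0)) _.
apply: (@prob_rbind_ge _ _ (exec draws s) (exec (blowups ;; chains ;; emit))) => // s' [ss gs].
rewrite subr0; apply: prob_always.
by apply: always_mono (finish_spec selP minU ss) => s2 [_]; apply.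
Qed.

Lemma run_cost : (0 < p)%N ->
  always (exec shrunk_program s0) (fun s => (cost s <= 3000 * (p * d ^ 4 * n ^ 4))%N).
Proof.
move=> p0; apply: always_mono (shrunk_program_cost (s := s0) erefl erefl erefl n0 p0 d0 _) => [s|].
  by rewrite addn0.
by apply: always_mono select_chosen => s [_ []].
Qed.

Lemma run_vector_entry : always (exec shrunk_program s0) (fun s =>
  forall z, vector_entry n s z -> gaussint z /\ magnitude z <= D0%:R * H * minor_bound H D0).
Proof.
have [entry0 _ entry_ok _] := entry_elimination_safe.
apply: always_mono (always_and run_stored_ok (exec_archived _ _)) => s [oks [_ archs]] z zs.
apply/gauss_boundedP; case: zs => [/oks//|[v /mapP[l _ ->] [j ->]]]; rewrite mxE.
by case: (archs arr_out (l * n + j)%N) => [/oks//|->]; exact: entry_ok.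
Qed.

End Run.

Lemma value_bound_le_expR (R : realType) n d k (M : R) (N := (n * d)%N) (x := M * (n * d * k)%:R)
    (H := (N ^ 2)%:R * M * (4 * N ^ 5)%:R) (D := (4 * N ^ 2)%N) :
  (0 < n)%N -> (0 < d)%N -> 1 <= M -> 2 <= x ->
  D%:R * H * minor_bound H D <=
    expR (79%:R * ((n ^ 2 * d ^ 2)%:R * ln x + (n * d)%:R * ln M)).
Proof.
move=> n0 d0 M1 x2; have N0 : (0 < N)%N by rewrite muln_gt0 n0.
have M0 : 0 <= M := le_trans ler01 M1.
have x0 : 0 < x by apply: lt_le_trans x2; rewrite ltr0n.
have k0 : (0 < k)%N.
  by rewrite lt0n; apply/eqP=> k0; move: x0; rewrite /x k0 muln0 mulr0 ltxx.
have Mx : M <= x by rewrite ler_peMr // ler1n muln_gt0 N0.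
have Nx : N%:R <= x by rewrite -[leLHS]mul1r ler_pM ?ler0n // ler_nat leq_pmulr.
apply: le_trans (value_bound_le_exp (le_trans M1 Mx) N0 M0 x2 Mx Nx) _.
rewrite -[x in leLHS](lnK x0) -expRM_natl ler_expR natrM -mulrA ler_wpM2l ?ler0n //.
by rewrite -expnMn lerDl mulr_ge0 ?ler0n // ln_ge0.
Qed.

Theorem theorem6p7 :
  exists (P : cmd) (K L : nat),
  forall (R : realType) (n p d k : nat) (M : R) (A : 'I_p -> 'M[R[i]]_n),
    (0 < n)%N -> (0 < p)%N -> 1 <= M ->
    (forall t i j, gaussint (A t i j) /\ magnitude (A t i j) <= M) ->
    min_blowup_size A d ->
    (ncrank (mxspan A) <= k)%N ->
    let c := (n - ncrank (mxspan A))%N in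
    let run := exec P (input d k A) in
    [/\ 1 / 2 <= prob run (fun s =>
          exists U : {vspace 'cV[R[i]]_n},
            min_shrunk (mxspan A) c U /\ basis_of U (output n s)),
        always run (fun s => (cost s <= K * (p * d ^ 4 * n ^ 4))%N) &
        always run (fun s => forall z : R[i], vector_entry n s z ->
          gaussint z /\
          (2 <= M * (n * d * k)%:R ->
           magnitude z <=
             expR (L%:R * ((n ^ 2 * d ^ 2)%:R * ln (M * (n * d * k)%:R)
                           + (n * d)%:R * ln M))))].
Proof.
exists shrunk_program, 3000%N, 79%N => R n p d k M A n0 p0 M1 A_bounded [d0 attains _] _ c run.
have correct := run_succeeds k n0 d0 M1 A_bounded attains.
have fast := run_cost k n0 d0 M1 A_bounded p0.
have bounded := run_vector_entry k n0 d0 M1 A_bounded.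
split; [exact: correct|exact: fast|apply: always_mono bounded => s bounded_s z].
case/bounded_s=> gz /le_trans z_le; split=> // x2; apply: z_le.
exact: value_bound_le_expR.
Qed.
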